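(* Let $G$ be a group and $B\in M(d\times d,\overline{\mathbb{Q}}G)$, and suppose that one of the cases (1), (2), (3) of the approximation situation described in the context applies, with corresponding groups $G_i$ and matrices $B[i]$. Assume $G_i\in\mathcal{G}$ for all $i$. Then $$\dim_G(\ker(B))=\lim_{i\in I}\dim_i(\ker(B[i])).$$
   Context: $\overline{\mathbb{Q}}$ is the field of algebraic numbers in $\mathbb{C}$. For a discrete group $G$, a matrix $A\in M(d\times d,\mathbb{C}G)$ acts by left convolution as a bounded operator on $l^2(G)^d$ commuting with the right $G$-action. For a bounded operator $T$ on $l^2(G)^n$ commuting with the right $G$-action put $\mathrm{tr}_G(T)=\sum_{i=1}^n\langle Te_i,e_i\rangle$, where $e_i\in l^2(G)^n$ has the trivial element $1\in G\subset l^2(G)$ in the $i$-th position and zeros elsewhere; the $\dim_G$ of the kernel of such an operator is $\mathrm{tr}_G$ of the orthogonal projection onto it. Directed system: the index set $I$ is partially ordered, any two $i,j\in I$ admit $k\in I$ with $i<k$, $j<k$, and there are compatible homomorphisms $p_{ij}\colon G_i\to G_j$ for $i<j$ (for direct limits) or $p_{ji}\colon G_j\to G_i$ for $i<j$ (for inverse limits). Natural maps are $p_i\colon G_i\to G$ for a direct limit $G$ and $p_i\colon G\to G_i$ for an inverse limit $G$. Generalized amenable extension: let $G$ be a finitely generated discrete group with a finite symmetric set of generators $S$, and let $U$ be a normal subgroup of $G$. $G$ is a generalized amenable extension of $U$ if there is a set $X$ with a free left $G$-action and a commuting free right $U$-action, and a sequence of $U$-invariant subsets $X_1\subset X_2\subset\cdots\subset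 X$ with $\bigcup_k X_k=X$, $|X_k/U|<\infty$ for every $k$, and $\frac{|(S\cdot X_k-X_k)/U|}{|X_k/U|}\to 0$ as $k\to\infty$. $\mathcal{G}$ is the smallest class of groups which contains the trivial group and is closed under: generalized amenable extensions (if $H\in\mathcal{G}$ and $G$ is a generalized amenable extension of $H$, then $G\in\mathcal{G}$); subgroups; and direct and inverse limits of directed systems of groups in $\mathcal{G}$. Approximation situation, for a group $G$ and $B\in M(d\times d,\mathbb{C}G)$: (1) $G$ is the inverse limit of a directed system of groups $(G_i)_{i\in I}$, and $B[i]=p_i(B)\in M(d\times d,\mathbb{C}G_i)$; or (2) $G$ is the direct limit of a directed system of groups $(G_i)_{i\in I}$; let $V\subset G$ be the finite set of group elements with non-zero coefficient in some entry of $B$; choose $j_0\in I$ with $V\subset p_{j_0}(G_{j_0})$ and an inverse image in $G_{j_0}$ of each $g\in V$; this gives $B[j_0]\in M(d\times d,\mathbb{C}G_{j_0})$ mapping to $B$, and $B[i]=p_{j_0i}(B[j_0])\in M(d\times d,\mathbb{C}G_i)$ for $i>j_0$ (only such $i$ are considered); or (3) $G$ is a generalized amenable extension of $U$, with $X$ and $X_1\subset X_2\subset\cdots$ as in that definition, $N_i=|X_i/U|$, $I=\mathbb{N}$; $B_X$ is the operator on $l^2(X)^d$ obtained from $B$ by letting $g\in G$ act by $\delta_x\mapsto\delta_{gx}$; $P_i\colon l^2(X)^d\to l^2(X_i)^d$ is the orthogonal projection; $B[i]=P_iB_XP_i^*$; and $G_i:=U$. Here $l^2(X_i)^d\cong l^2(U)^{N_id}$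 by choosing representatives of the free $U$-orbits, which defines $\mathrm{tr}_U$, $\dim_U$. In cases (1), (2) put $\dim_i=\dim_{G_i}$; in case (3) put $\dim_i=\frac{1}{N_i}\dim_U$. *)

(* Defs.v *)
From HB Require Import structures.
From mathcomp Require Import all_boot all_order all_algebra finmap complex.
From mathcomp Require Import all_classical all_reals all_analysis.

Set Implicit Arguments.
Unset Strict Implicit.
Unset Printing Implicit Defensive.

Import Order.TTheory GRing.Theory Num.Theory.
Import numFieldNormedType.Exports.

Local Open Scope classical_set_scope.
Local Open Scope ring_scope.
Local Open Scope complex_scope.

(* Sum of an absolutely summable family over an arbitrary index set: positive
   minus negative part, for the real and the imaginary part separately. *)
Definition rsum (R : realType) (X : choiceType) (f : X -> R) : R :=
  fine (\esum_(x in [set: X]) (Num.max (f x) 0)%:E)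
  - fine (\esum_(x in [set: X]) (Num.max (- f x) 0)%:E).

Definition csum (R : realType) (X : choiceType) (f : X -> R[i]) : R[i] :=
  rsum (fun x => complex.Re (f x)) +i* rsum (fun x => complex.Im (f x)).

(* l^2(G)^d is [l2] on the index set ['I_d * G]. *)
Definition l2 (R : realType) (X : choiceType) : set (X -> R[i]) :=
  [set f | (\esum_(x in [set: X]) (Normc.normc (f x) ^+ 2)%:E < +oo)%E].

Definition inner (R : realType) (X : choiceType) (f g : X -> R[i]) : R[i] :=
  csum (fun x => f x * (g x)^*).

(* Meaningful when [K] is a closed subspace of [l2], as is the kernel of a bounded operator. *)
Definition orth_proj (R : realType) (X : choiceType) (K : set (X -> R[i]))
    (f : X -> R[i]) : X -> R[i] :=
  xget (fun=> 0)
    [set g | K g /\ forall h, K h -> inner (fun x => f x - g x) h = 0].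

(* l^2(G)^n is indexed by [J * G] for a finite type [J] of cardinal n. *)
Definition unit_vec (R : realType) (G : groupType) (J : finType) (j : J) :
    J * G -> R[i] :=
  fun y => (y == (j, 1%g))%:R.

Definition vntrace (R : realType) (G : groupType) (J : finType)
    (T : (J * G -> R[i]) -> (J * G -> R[i])) : R[i] :=
  \sum_(j : J) inner (T (unit_vec R j)) (unit_vec R j).

Definition vndim (R : realType) (G : groupType) (J : finType)
    (K : set (J * G -> R[i])) : R[i] :=
  vntrace (orth_proj K).

Definition ker_on (R : realType) (X : Type) (H : set (X -> R[i]))
    (T : (X -> R[i]) -> (X -> R[i])) : set (X -> R[i]) :=
  [set f | H f /\ T f = (fun=> 0)].

Definition group_ring (R : realType) (G : groupType) : Type :=
  {fsfun G -> R[i] with 0}.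

(* The operator on l^2(X)^d obtained from [B] by letting [g] act by
   delta_x |-> delta_(g x), i.e. (g f)(x) = f (g^-1 x). *)
Definition mx_act (R : realType) (G : groupType) (d : nat)
    (B : 'M[group_ring R G]_d) (X : Type) (act : G -> X -> X)
    (f : 'I_d * X -> R[i]) : 'I_d * X -> R[i] :=
  fun y => \sum_(b < d) \sum_(g <- finsupp (B y.1 b))
             B y.1 b g * f (b, act g^-1%g y.2).

Definition ker_mx (R : realType) (G : groupType) (d : nat)
    (B : 'M[group_ring R G]_d) : set ('I_d * G -> R[i]) :=
  ker_on (@l2 R _) (mx_act B (fun g h : G => (g * h)%g)).

(* The linear extension CG -> CH of a map of sets [p]. *)
Definition push_ring (R : realType) (G H : groupType) (p : G -> H)
    (a : group_ring R G) : group_ring R H :=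
  [fsfun h in [fset p g | g in finsupp a]%fset =>
     \sum_(g <- finsupp a | p g == h) a g | 0].

Definition push_mx (R : realType) (G H : groupType) (d : nat) (p : G -> H)
    (B : 'M[group_ring R G]_d) : 'M[group_ring R H]_d :=
  map_mx (push_ring p) B.

Definition directed (disp : Order.disp_t) (I : porderType disp) : Prop :=
  (exists i : I, True) /\
  forall i j : I, exists k : I, (i < k)%O /\ (j < k)%O.

(* lim_(i in I) is the limit along this filter. *)
Definition tails (disp : Order.disp_t) (I : porderType disp) : set_system I :=
  filter_from [set: I] (fun i0 => [set i | (i0 <= i)%O]).

Arguments tails {disp} I.

Record direct_system (disp : Order.disp_t) (I : porderType disp) := {
  dir_grp :> I -> groupType;
  dir_map : forall i j, (i < j)%O -> {multiplicative dir_grp i -> dir_grp j};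
  dir_directed : directed I;
  dir_comp : forall i j k (ij : (i < j)%O) (jk : (j < k)%O) (ik : (i < k)%O) x,
    dir_map jk (dir_map ij x) = dir_map ik x }.

Record inverse_system (disp : Order.disp_t) (I : porderType disp) := {
  inv_grp :> I -> groupType;
  inv_map : forall i j, (i < j)%O -> {multiplicative inv_grp j -> inv_grp i};
  inv_directed : directed I;
  inv_comp : forall i j k (ij : (i < j)%O) (jk : (j < k)%O) (ik : (i < k)%O) x,
    inv_map ij (inv_map jk x) = inv_map ik x }.

(* The [p i] identify [G] with the disjoint union of the [D i] modulo
   "equal at a later stage". *)
Definition is_direct_limit (disp : Order.disp_t) (I : porderType disp)
    (D : direct_system I) (G : groupType)
    (p : forall i, {multiplicative D i -> G}) : Prop :=
  [/\ forall i j (ij : (i < j)%O) x, p j (dir_map D ij x) = p i x,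
      forall g : G, exists i x, p i x = g
    & forall i j x y, p i x = p j y ->
        exists k (ik : (i < k)%O) (jk : (j < k)%O),
          dir_map D ik x = dir_map D jk y].

(* The [p i] identify [G] with the group of compatible families in the product
   of the [D i]. *)
Definition is_inverse_limit (disp : Order.disp_t) (I : porderType disp)
    (D : inverse_system I) (G : groupType)
    (p : forall i, {multiplicative G -> D i}) : Prop :=
  (forall i j (ij : (i < j)%O) g, inv_map D ij (p j g) = p i g) /\
  (forall x : forall i, D i,
     (forall i j (ij : (i < j)%O), inv_map D ij (x j) = x i) ->
     exists! g : G, forall i, p i g = x i).

(* A/U, for a U-invariant subset [A] of [X]. *)
Definition orbits (U : groupType) (X : choiceType) (ract : X -> U -> X)
    (A : set X) : set (set X) :=
  [set range (ract x) | x in A].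

Definition num_orbits (U : groupType) (X : choiceType) (ract : X -> U -> X)
    (A : set X) : nat :=
  #|` fset_set (orbits ract A)|%fset.

Definition boundary (G : groupType) (X : Type) (lact : G -> X -> X)
    (S : {fset G}) (A : set X) : set X :=
  [set y | exists s x, [/\ s \in S, A x & y = lact s x]] `\` A.

Record sym_generators (G : groupType) (S : {fset G}) : Prop := {
  gen_sym : forall g, g \in S -> g^-1%g \in S;
  gen_all : forall H : {pred G}, group_closed H -> {subset S <= H} ->
    forall g, g \in H }.

(* The normal subgroup is given as the image of an injective homomorphism
   [iota : U -> G].  [X] is required to be nonempty because x / 0 = 0 would make
   the limit condition void on an empty [X]; finitely many [X_k] may be empty. *)
Record gen_amenable_data (R : realType) (U G : groupType)
    (iota : {multiplicative U -> G}) (X : choiceType) (lact : G -> X -> X)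
    (ract : X -> U -> X) (X_ : nat -> set X) : Prop := {
  gad_inj : injective iota;
  gad_normal : forall g u, exists v, iota v = (iota u ^ g)%g;
  gad_lact1 : forall x, lact 1%g x = x;
  gad_lactM : forall g h x, lact (g * h)%g x = lact g (lact h x);
  gad_lfree : forall g x, lact g x = x -> g = 1%g;
  gad_ract1 : forall x, ract x 1%g = x;
  gad_ractM : forall x u v, ract x (u * v)%g = ract (ract x u) v;
  gad_rfree : forall x u, ract x u = x -> u = 1%g;
  gad_comm : forall g x u, ract (lact g x) u = lact g (ract x u);
  gad_nonempty : exists x : X, True;
  gad_incr : forall k, X_ k `<=` X_ k.+1;
  gad_inv : forall k x u, X_ k x -> X_ k (ract x u);
  gad_cover : \bigcup_k X_ k = [set: X];
  gad_finite : forall k, finite_set (orbits ract (X_ k));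
  gad_folner : exists2 S : {fset G}, sym_generators S &
    ((num_orbits ract (boundary lact S (X_ k)))%:R
       / (num_orbits ract (X_ k))%:R : R) @[k --> \oo] --> (0 : R) }.

Definition gen_amenable_ext (R : realType) (U G : groupType) : Prop :=
  exists (iota : {multiplicative U -> G}) (X : choiceType)
         (lact : G -> X -> X) (ract : X -> U -> X) (X_ : nat -> set X),
    gen_amenable_data R iota lact ract X_.

(* [R] only serves to state the limit in [gad_folner]. Closure under
   isomorphism is contained in [class_sub]. *)
Inductive class_G (R : realType) : groupType -> Prop :=
| class_trivial (G : groupType) : (forall g : G, g = 1%g) -> class_G R G
| class_amenable (H G : groupType) :
    class_G R H -> gen_amenable_ext R H G -> class_G R G
| class_sub (H G : groupType) (f : {multiplicative H -> G}) :
    injective f -> class_G R G -> class_G R H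
| class_direct (disp : Order.disp_t) (I : porderType disp)
    (D : direct_system I) (G : groupType)
    (p : forall i, {multiplicative D i -> G}) :
    (forall i, class_G R (D i)) -> is_direct_limit p -> class_G R G
| class_inverse (disp : Order.disp_t) (I : porderType disp)
    (D : inverse_system I) (G : groupType)
    (p : forall i, {multiplicative G -> D i}) :
    (forall i, class_G R (D i)) -> is_inverse_limit p -> class_G R G.

(* l^2(A)^d, as the functions in l^2(X)^d vanishing off [A]; with this
   identification P^* is the inclusion and P is [cut A]. *)
Definition cut (R : realType) (d : nat) (X : choiceType) (A : set X)
    (f : 'I_d * X -> R[i]) : 'I_d * X -> R[i] :=
  fun y => if y.2 \in A then f y else 0.

Definition l2_on (R : realType) (d : nat) (X : choiceType) (A : set X) :
    set ('I_d * X -> R[i]) :=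
  [set f | l2 f /\ cut A f = f].

(* The kernel of P B_X P^* on l^2(A)^d. *)
Definition ker_compress (R : realType) (G : groupType) (d : nat)
    (B : 'M[group_ring R G]_d) (X : choiceType) (lact : G -> X -> X)
    (A : set X) : set ('I_d * X -> R[i]) :=
  ker_on (l2_on A) (fun f => cut A (mx_act B lact f)).

Definition orbit_reps (U : groupType) (X : choiceType) (ract : X -> U -> X)
    (A : set X) (N : nat) (r : 'I_N -> X) : Prop :=
  (forall n, A (r n)) /\
  (forall x, A x -> exists! n, exists u, x = ract (r n) u).

(* The isomorphism l^2(A)^d -> l^2(U)^(N d) given by representatives [r] of the
   U-orbits in [A]. *)
Definition orbit_coords (R : realType) (U : groupType) (d : nat)
    (X : choiceType) (ract : X -> U -> X) (N : nat) (r : 'I_N -> X)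
    (f : 'I_d * X -> R[i]) : ('I_N * 'I_d) * U -> R[i] :=
  fun z => f (z.1.2, ract (r z.1.1) z.2).

(* Main.v *)
Require Import Defs.
From mathcomp Require Import all_boot all_order all_algebra all_field finmap complex.
From mathcomp Require Import all_classical all_reals all_analysis.
From mathcomp Require Import ring lra.
Set Implicit Arguments.
Unset Strict Implicit.
Unset Printing Implicit Defensive.
Import Order.TTheory GRing.Theory Num.Theory.
Import numFieldNormedType.Exports.
Local Open Scope classical_set_scope.
Local Open Scope ring_scope.
Local Open Scope complex_scope.
Local Notation cj z := (z^*)%R.
Local Notation normc := Normc.normc.

(** Let [B] have Schur bound [kappa] and put [Q = 1 - B^* B / kappa^2], a positive
    contraction. The traces of [Q^n], here called moments, decrease to the dimension
    of the kernel of [B] ([gram_limit], [mom_vndim]). A single moment involves only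
    products of boundedly many elements of the support, so each of them converges in
    the three situations: for direct and inverse systems it is eventually equal to
    the moment of the limit, and for an amenable extension it differs from it only
    by the orbits that reach the boundary in boundedly many steps
    ([inverse_limit_moments], [direct_limit_moments], [folner_moments]).

    Exchanging this limit with [n -> oo] requires that the [B[i]] have uniformly
    little spectrum near zero. This follows from a lower bound for Fuglede-Kadison
    determinants. Because [- ln (1 - x)] is the sum of the [x^l / l], the partial sums
    [\sum_(l <= N) (mom l - mom M) / l] approximate minus the integral of [ln] over the
    nonzero spectrum; a common bound for them makes the distance from the [N]-th moment
    to the dimension at most a constant divided by the [N]-th harmonic number
    ([moments_to_limits]).

    The bound is an inequality between finitely many moments, so it passes to
    subgroups and to the three kinds of limits as the moments do. It starts from the
    trivial group, where it says that a nonzero integer has absolute value at least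
    one. For algebraic coefficients this applies to a norm only, hence the bound is
    stated for the sum over a whole family of conjugate matrices ([detbound]); for the
    trivial group, the product of the nonzero singular values of a matrix bounds its
    minors of maximal size, and a nonzero such minor has a nonzero norm ([pseudo_det],
    [detbound_trivial]). The family containing [B] is obtained by writing all
    coefficients as polynomials in one algebraic integer, up to a common denominator
    ([conjugates_exist]), and a bound for [B] alone follows because all terms are
    nonnegative ([detbound_single]).

    For amenable extensions, the compression to finitely many orbits of [U] is a matrix
    over the group ring of [U] ([compress_mx], [ker_coords]) with the same Schur bound
    and with [N_k] times as many rows, in accordance with the normalization of the
    dimension by [N_k]. *)

(** * Sums over arbitrary index sets *)
Section Summation.
Variables (R : realType) (X : choiceType).
Implicit Types (u v f g : X -> R).

Definition finsum u := (\esum_(x in [set: X]) (u x)%:E < +oo)%E.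

Lemma esum_fin u : (forall x, 0 <= u x) -> finsum u ->
  (fine (\esum_(x in [set: X]) (u x)%:E))%:E = (\esum_(x in [set: X]) (u x)%:E)%E.
Proof.
move=> u0 fu; rewrite fineK// ge0_fin_numE//.
by apply: esum_ge0 => x _; rewrite lee_fin.
Qed.

Lemma finsum_le u v : (forall x, u x <= v x) -> finsum v -> finsum u.
Proof.
move=> uv; apply: le_lt_trans; apply: le_esum => x _.
by rewrite lee_fin.
Qed.

Lemma finsumD u v : (forall x, 0 <= u x) -> (forall x, 0 <= v x) ->
  finsum u -> finsum v -> finsum (fun x => u x + v x).
Proof.
move=> u0 v0 fu fv; rewrite /finsum.
under eq_esum do rewrite EFinD.
by rewrite esumD ?lte_add_pinfty// => x _; rewrite lee_fin.
Qed.

(** Only the inequality needs an argument; applying it to [c^-1] gives the converse. *)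
Lemma esumZ (c : R) u : 0 <= c -> (forall x, 0 <= u x) ->
  (\esum_(x in [set: X]) (c * u x)%:E = c%:E * \esum_(x in [set: X]) (u x)%:E)%E.
Proof.
move=> c0 u0; have le1 (b : R) w : 0 <= b -> (forall x, 0 <= w x) ->
    (\esum_(x in [set: X]) (b * w x)%:E <= b%:E * \esum_(x in [set: X]) (w x)%:E)%E.
  move=> b0 w0; apply: ge_ereal_sup => _ [A [finA _] <-].
  rewrite fsbig_finite//=; under eq_bigr do rewrite EFinM.
  rewrite -ge0_sume_distrr; last by move=> x _; rewrite lee_fin.
  rewrite lee_wpmul2l ?lee_fin//.
  apply: esum_ge; exists A; first by split.
  by rewrite fsbig_finite.
apply/eqP; rewrite eq_le le1//=.
have [->|c_neq0] := eqVneq c 0.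
  by rewrite mul0e; apply: esum_ge0 => x _; rewrite mul0r.
rewrite [X in (c%:E * X)%E](_ : _ =
    \esum_(x in [set: X]) (c^-1 * (c * u x))%:E)%E; last first.
  by apply: eq_esum => x _; rewrite mulrA mulVf// mul1r.
have h := le1 c^-1 (fun x => c * u x); rewrite invr_ge0 in h.
apply: (le_trans (lee_wpmul2l _ (h c0 (fun x => mulr_ge0 c0 (u0 x))))).
  by rewrite lee_fin.
by rewrite muleA -EFinM mulfV// mul1e.
Qed.

(** The positive and negative parts in [rsum] can be replaced by any summable
    nonnegative decomposition; additivity of [rsum] rests on this. *)
Lemma rsumE f u v : (forall x, 0 <= u x) -> (forall x, 0 <= v x) ->
  finsum u -> finsum v -> (forall x, f x = u x - v x) ->
  rsum f = fine (\esum_(x in [set: X]) (u x)%:E)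
         - fine (\esum_(x in [set: X]) (v x)%:E).
Proof.
move=> u0 v0 fu fv fE; rewrite /rsum.
set p := fun x => Num.max (f x) 0; set n := fun x => Num.max (- f x) 0.
have p0 x : 0 <= p x by rewrite le_max lexx orbT.
have n0 x : 0 <= n x by rewrite le_max lexx orbT.
have fp : finsum p.
  apply: finsum_le fu => x; rewrite /p ge_max u0 andbT fE.
  by rewrite lerBlDr lerDl.
have fn : finsum n.
  apply: finsum_le fv => x; rewrite /n ge_max v0 andbT fE.
  by rewrite opprB lerBlDr lerDl.
have pnE x : p x + v x = n x + u x.
  have -> : u x = f x + v x by rewrite fE subrK.
  rewrite addrA; congr (_ + _); rewrite /p /n !maxElt oppr_lt0.
  by case: ltgtP => // [_|_|->]; rewrite ?(add0r, addNr, oppr0, addr0).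
have E : (\esum_(x in [set: X]) (p x)%:E + \esum_(x in [set: X]) (v x)%:E =
     \esum_(x in [set: X]) (n x)%:E + \esum_(x in [set: X]) (u x)%:E)%E.
  rewrite -!esumD; try by move=> x _; rewrite lee_fin.
  by apply: eq_esum => x _; rewrite -!EFinD pnE.
move: E; rewrite -(esum_fin p0 fp) -(esum_fin n0 fn) -(esum_fin u0 fu).
rewrite -(esum_fin v0 fv) -!EFinD => -[E].
by apply/eqP; rewrite subr_eq addrAC (addrC (fine _) (fine _)) -E addrK.
Qed.

Definition absum f := finsum (fun x => `|f x|).

Lemma absum_parts f : absum f ->
  finsum (fun x => Num.max (f x) 0) /\ finsum (fun x => Num.max (- f x) 0).
Proof.
move=> sf; split; apply: finsum_le sf => x; rewrite ge_max normr_ge0 andbT.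
  exact: ler_norm.
by rewrite -normrN ler_norm.
Qed.

Lemma maxr_split (x : R) : x = Num.max x 0 - Num.max (- x) 0.
Proof.
by rewrite !maxElt oppr_lt0; case: ltgtP => // [_|_|->];
  rewrite ?(subr0, sub0r, opprK).
Qed.

Lemma absumZ (c : R) f : absum f -> absum (fun x => c * f x).
Proof.
move=> sf; rewrite /absum /finsum; under eq_esum do rewrite normrM.
rewrite esumZ// -(esum_fin _ sf)// -EFinM; exact: ltry.
Qed.

Lemma rsumD f g : absum f -> absum g ->
  rsum (fun x => f x + g x) = rsum f + rsum g.
Proof.
move=> sf sg; have [fp fn] := absum_parts sf; have [gp gn] := absum_parts sg.
have m0 h (x : X) : 0 <= Num.max (h x) (0 : R) by rewrite le_max lexx orbT.
rewrite (@rsumE _ (fun x => Num.max (f x) 0 + Num.max (g x) 0)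
  (fun x => Num.max (- f x) 0 + Num.max (- g x) 0)); first last.
- by move=> x; rewrite {1}(maxr_split (f x)) {1}(maxr_split (g x)) opprD addrACA.
- by apply: finsumD => // x; apply: (m0 (fun x => - _ x)).
- by apply: finsumD => // x; apply: m0.
- by move=> x; rewrite addr_ge0// (m0 (fun x => - _ x)).
- by move=> x; rewrite addr_ge0// m0.
under eq_esum do rewrite EFinD.
under [in X in _ - fine X]eq_esum do rewrite EFinD.
have m1 h (x : X) : 0 <= Num.max (- h x) (0 : R) by rewrite le_max lexx orbT.
rewrite !esumD; try by move=> x _; rewrite lee_fin ?m0 ?m1.
rewrite !fineD ?ge0_fin_numE//; try by apply: esum_ge0 => x _; rewrite lee_fin ?m0 ?m1.
by rewrite /rsum opprD addrACA.
Qed.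

Lemma rsumN f : rsum (fun x => - f x) = - rsum f.
Proof. by rewrite /rsum; under [X in _ - fine X]eq_esum do rewrite opprK; rewrite opprB. Qed.

Lemma ge0_rsum f : (forall x, 0 <= f x) -> finsum f ->
  rsum f = fine (\esum_(x in [set: X]) (f x)%:E).
Proof.
move=> f0 ff; rewrite (@rsumE _ f (fun=> 0))//.
- by rewrite [X in _ - fine X]esum1 ?subr0.
- by rewrite /finsum esum1.
- by move=> x; rewrite subr0.
Qed.

Lemma rsumZ (c : R) f : absum f -> rsum (fun x => c * f x) = c * rsum f.
Proof.
move=> sf; wlog c0 : c / 0 <= c => [h|].
  have [/h//|/ltW c0] := leP 0 c.
  have -> : (fun x => c * f x) = (fun x => - (- c * f x)).
    by apply/funext => x; rewrite mulNr opprK.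
  by rewrite rsumN h ?oppr_ge0// mulNr opprK.
have [fp fn] := absum_parts sf.
have m0 h (x : X) : 0 <= Num.max (h x) (0 : R) by rewrite le_max lexx orbT.
have m1 h (x : X) : 0 <= Num.max (- h x) (0 : R) by rewrite le_max lexx orbT.
have fin w : (forall x, 0 <= w x) -> finsum w -> finsum (fun x => c * w x).
  by move=> w0 fw; rewrite /finsum esumZ// -(esum_fin _ fw)// -EFinM; exact: ltry.
rewrite (@rsumE _ (fun x => c * Num.max (f x) 0) (fun x => c * Num.max (- f x) 0)).
- rewrite !esumZ//.
  rewrite -(esum_fin _ fp)// -(esum_fin _ fn)// -!EFinM /=.
  by rewrite /rsum mulrBr.
- by move=> x; rewrite mulr_ge0// m0.
- by move=> x; rewrite mulr_ge0// m1.
- exact: fin.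
- exact: fin.
- by move=> x; rewrite {1}(maxr_split (f x)) mulrBr.
Qed.

End Summation.

(** * Square-summable functions *)
Section L2.
Variables (R : realType) (X : choiceType).
Local Notation C := R[i].
Implicit Types (f g h : X -> C) (c z : C).

Lemma normc_sqrE z : normc z ^+ 2 = complex.Re z ^+ 2 + complex.Im z ^+ 2.
Proof. by case: z => a b /=; rewrite sqr_sqrtr// addr_ge0// sqr_ge0. Qed.

Lemma normc_ge0 z : 0 <= normc z.
Proof. by case: z => a b; rewrite sqrtr_ge0. Qed.

Lemma normc_conj z : normc (cj z) = normc z.
Proof. by case: z => a b /=; rewrite sqrrN. Qed.

Lemma cjE z : cj z = conjc z.
Proof. by []. Qed.

Lemma cjM z (w : C) : cj (z * w) = cj z * cj w.
Proof. exact: rmorphM. Qed.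

Lemma cjB z (w : C) : cj (z - w) = cj z - cj w.
Proof. exact: rmorphB. Qed.

Lemma cjD z (w : C) : cj (z + w) = cj z + cj w.
Proof. exact: rmorphD. Qed.

Lemma cjR (x : R) : cj (x%:C) = x%:C.
Proof. exact: conjc_real. Qed.

Lemma cjK z : cj (cj z) = z.
Proof. exact: conjcK. Qed.

Lemma normcX z n : normc (z ^+ n) = normc z ^+ n.
Proof. elim: n => [|n IH]; first by rewrite !expr0 Normc.normc1.
by rewrite !exprS Normc.normcM IH. Qed.

Lemma normc_real (x : R) : normc x%:C = `|x|.
Proof. by rewrite /= expr0n addr0 sqrtr_sqr. Qed.

Lemma normrE z : `|z| = (normc z)%:C.
Proof. by []. Qed.

Lemma mulcJE z : z * cj z = (normc z ^+ 2)%:C.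
Proof.
by rewrite normc_sqrE; case: z => a b; simpc; congr (_ +i* _) => /=; ring.
Qed.

Lemma Re_le_normc z : `|complex.Re z| <= normc z.
Proof.
rewrite -(@ler_pXn2r _ 2)// ?nnegrE ?normc_ge0// normc_sqrE real_normK ?num_real//.
by rewrite lerDl sqr_ge0.
Qed.

Lemma Im_le_normc z : `|complex.Im z| <= normc z.
Proof.
rewrite -(@ler_pXn2r _ 2)// ?nnegrE ?normc_ge0// normc_sqrE real_normK ?num_real//.
by rewrite lerDr sqr_ge0.
Qed.

Lemma normc_leD z (w : C) : normc (z + w) <= normc z + normc w.
Proof. by have := ler_normD z w; rewrite !normrE -rmorphD lecR. Qed.

Lemma normcD_sqr_le z (w : C) : normc (z + w) ^+ 2 <= 2 * normc z ^+ 2 + 2 * normc w ^+ 2.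
Proof.
rewrite !normc_sqrE; case: z => a b; case: w => a' b' /=.
have := sqr_ge0 (a - a'); have := sqr_ge0 (b - b'); nra.
Qed.

(** The condition under which [csum] is linear. *)
Definition csummable f := finsum (fun x => normc (f x)).

Lemma csummable_parts f : csummable f ->
  absum (fun x => complex.Re (f x)) /\ absum (fun x => complex.Im (f x)).
Proof.
move=> sf; split; apply: finsum_le sf => x; [exact: Re_le_normc|exact: Im_le_normc].
Qed.

Lemma csumD f g : csummable f -> csummable g ->
  csum (fun x => f x + g x) = csum f + csum g.
Proof.
move=> /csummable_parts[fr fi] /csummable_parts[gr gi].
rewrite /csum; simpc; rewrite -!rsumD//.
apply: (congr2 (@Complex R)); congr (rsum _); apply/funext => x;
  by case: (f x) (g x) => a b [a' b'].
Qed.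

Lemma csumZ c f : csummable f -> csum (fun x => c * f x) = c * csum f.
Proof.
move=> /csummable_parts[fr fi]; rewrite /csum; case: c => a b; simpc.
have N (u : X -> R) : absum u -> absum (fun x => - u x).
  by move=> su; apply: finsum_le su => x; rewrite normrN.
have Zr k := absumZ k fr; have Zi k := absumZ k fi.
rewrite -!rsumZ// -rsumN -(rsumD (Zr a) (N _ (Zi b))) -(rsumD (Zi a) (Zr b)).
by apply: (congr2 (@Complex R)); congr (rsum _); apply/funext => x; case: (f x).
Qed.

Lemma csum_conj f : csum (fun x => cj (f x)) = cj (csum f).
Proof.
rewrite cjE /csum /= -rsumN; apply: (congr2 (@Complex R)); congr (rsum _); apply/funext => x;
  by case: (f x).
Qed.

Lemma rsum0 : rsum (fun _ : X => 0 : R) = 0.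
Proof. by rewrite ge0_rsum// /finsum esum1. Qed.

Lemma csum_ge0 (u : X -> R) : (forall x, 0 <= u x) -> finsum u ->
  csum (fun x => (u x)%:C) = (fine (\esum_(x in [set: X]) (u x)%:E))%:C.
Proof. by move=> u0 fu; rewrite /csum/= rsum0 ge0_rsum. Qed.

Definition nrm2 f := (\esum_(x in [set: X]) (normc (f x) ^+ 2)%:E)%E.
Definition nsq f : R := fine (nrm2 f).

Lemma nrm2_ge0 f : (0 <= nrm2 f)%E.
Proof. by apply: esum_ge0 => x _; rewrite lee_fin sqr_ge0. Qed.

Lemma nsq_ge0 f : 0 <= nsq f.
Proof. exact/fine_ge0/nrm2_ge0. Qed.

Lemma l2E f : l2 f -> nrm2 f = (nsq f)%:E.
Proof. by move=> lf; rewrite fineK// ge0_fin_numE// nrm2_ge0. Qed.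

Lemma l2_le f (K : R) : (nrm2 f <= K%:E)%E -> l2 f /\ nsq f <= K.
Proof.
move=> h; have lf : l2 f by apply: (le_lt_trans h); rewrite ltry.
by split=> //; rewrite -lee_fin -l2E.
Qed.

Lemma l2D f g : l2 f -> l2 g -> l2 (fun x => f x + g x).
Proof.
move=> lf lg.
have l2' h : l2 h -> finsum (fun x => 2 * normc (h x) ^+ 2).
  move=> lh; rewrite /finsum esumZ//; last by move=> x; exact: sqr_ge0.
  by rewrite -/(nrm2 h) (l2E lh) -EFinM ltry.
apply: finsum_le (finsumD _ _ (l2' _ lf) (l2' _ lg)) => x.
- exact: normcD_sqr_le.
- by rewrite mulr_ge0// sqr_ge0.
- by rewrite mulr_ge0// sqr_ge0.
Qed.

Lemma nrm2Z c f : nrm2 (fun x => c * f x) = ((normc c ^+ 2)%:E * nrm2 f)%E.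
Proof.
rewrite /nrm2; under eq_esum do rewrite Normc.normcM exprMn.
by rewrite esumZ// ?sqr_ge0// => x; exact: sqr_ge0.
Qed.

Lemma l2Z c f : l2 f -> l2 (fun x => c * f x).
Proof. by move=> lf; rewrite /l2/= -/(nrm2 _) nrm2Z (l2E lf) -EFinM ltry. Qed.

Lemma nsqZ c f : l2 f -> nsq (fun x => c * f x) = normc c ^+ 2 * nsq f.
Proof. by move=> lf; rewrite /nsq nrm2Z (l2E lf). Qed.

Lemma l2_ext f g : l2 f -> (forall x, g x = f x) -> l2 g.
Proof. by move=> lf /funext ->. Qed.

Lemma l2B f g : l2 f -> l2 g -> l2 (fun x => f x - g x).
Proof. by move=> lf /(l2Z (-1)) lg; apply: l2_ext (l2D lf lg) _ => x; rewrite mulN1r. Qed.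

Lemma l2_0 : l2 (fun _ : X => 0 : C).
Proof. by rewrite /l2/= esum1// => x _; rewrite /= !expr0n /= addr0 sqrtr0 expr0n. Qed.

Lemma l2M f g : l2 f -> l2 g -> csummable (fun x => f x * cj (g x)).
Proof.
move=> lf lg; apply: finsum_le (finsumD _ _ lf lg); try by move=> x; exact: sqr_ge0.
move=> x; rewrite Normc.normcM normc_conj.
have := sqr_ge0 (normc (f x) - normc (g x)).
have := normc_ge0 (f x); have := normc_ge0 (g x); nra.
Qed.

Lemma innerDl f g h : l2 f -> l2 g -> l2 h ->
  inner (fun x => f x + g x) h = inner f h + inner g h.
Proof.
move=> lf lg lh; rewrite /inner -csumD; try exact: l2M.
by congr csum; apply/funext => x; rewrite mulrDl.
Qed.

Lemma innerZl c f h : l2 f -> l2 h -> inner (fun x => c * f x) h = c * inner f h.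
Proof.
move=> lf lh; rewrite /inner -csumZ; last exact: l2M.
by congr csum; apply/funext => x; rewrite mulrA.
Qed.

Lemma innerC f g : inner g f = cj (inner f g).
Proof.
rewrite /inner -csum_conj; congr csum; apply/funext => x.
by rewrite cjM cjK mulrC.
Qed.

Lemma innerBl f g h : l2 f -> l2 g -> l2 h ->
  inner (fun x => f x - g x) h = inner f h - inner g h.
Proof.
move=> lf lg lh; rewrite -mulN1r -innerZl// -innerDl//; last exact: l2Z.
by apply: (congr1 (fun u => inner u h)); apply/funext => x; rewrite mulN1r.
Qed.

Lemma innerBr f g h : l2 f -> l2 g -> l2 h ->
  inner h (fun x => f x - g x) = inner h f - inner h g.
Proof. by move=> lf lg lh; rewrite innerC innerBl// (innerC f h) (innerC g h) cjB. Qed.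

Lemma innerZr c f h : l2 f -> l2 h -> inner h (fun x => c * f x) = cj c * inner h f.
Proof. by move=> lf lh; rewrite innerC innerZl// (innerC f h) cjM. Qed.

Lemma inner_self f : l2 f -> inner f f = (nsq f)%:C.
Proof.
move=> lf; rewrite /nsq /nrm2 -csum_ge0//; last by move=> x; exact: sqr_ge0.
by congr csum; apply/funext => x; rewrite mulcJE.
Qed.

Lemma nsq_ge_pt f x : l2 f -> normc (f x) ^+ 2 <= nsq f.
Proof.
move=> lf; rewrite -lee_fin -l2E//; apply: esum_ge; exists [set x].
  by split=> //; exact: finite_set1.
by rewrite fsbig_set1.
Qed.

Lemma normc_eq0 z : (normc z == 0) = (z == 0).
Proof. by apply/eqP/eqP => [/Normc.eq0_normc//|->]; rewrite Normc.normc0. Qed.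

Lemma nsq_eq0 f : l2 f -> nsq f <= 0 -> f = fun=> 0.
Proof.
move=> lf f0; apply/funext => x; apply: Normc.eq0_normc.
apply/eqP; rewrite -sqrf_eq0 eq_le sqr_ge0 andbT.
exact: le_trans (nsq_ge_pt x lf) f0.
Qed.

Lemma nsqB f g : l2 f -> l2 g ->
  nsq (fun x => f x - g x) = nsq f + nsq g - 2 * complex.Re (inner f g).
Proof.
move=> lf lg; have lfg := l2B lf lg.
have -> : nsq (fun x => f x - g x) =
    complex.Re (inner (fun x => f x - g x) (fun x => f x - g x)).
  by rewrite (inner_self lfg).
rewrite innerBl// !innerBr// !inner_self// (innerC f g).
by case: (inner f g) => a b; simpc => /=; ring.
Qed.

(** Nonnegativity of the squared norm of [f - (<f, g> / |g|^2) g]. *)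
Lemma cauchy_schwarz f g : l2 f -> l2 g ->
  normc (inner f g) ^+ 2 <= nsq f * nsq g.
Proof.
move=> lf lg; have [g0|g_gt0] := leP (nsq g) 0.
  have -> := nsq_eq0 lg g0.
  have -> : inner f (fun=> 0) = 0.
    have -> : (fun=> 0) = (fun x : X => 0 * g x) by apply/funext => x; rewrite mul0r.
    by rewrite innerZr// rmorph0 mul0r.
  by rewrite Normc.normc0 expr0n mulr_ge0// nsq_ge0.
set G := nsq g in g_gt0 *; pose c : C := (G^-1)%:C * inner f g.
have E : cj c * inner f g = (G^-1 * normc (inner f g) ^+ 2)%:C.
  by rewrite /c cjM cjR -mulrA [cj _ * _]mulrC mulcJE -rmorphM.
have := nsq_ge0 (fun x => f x - c * g x).
rewrite (nsqB lf (l2Z c lg)) (nsqZ c lg) (innerZr c lg lf) E -/G /c.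
rewrite Normc.normcM normc_real exprMn.
set n := normc (inner f g) ^+ 2.
rewrite -[complex.Re _]/(G^-1 * n) real_normK ?num_real//.
have -> : G^-1 ^+ 2 * n * G = G^-1 * n.
  by field; rewrite gt_eqF.
rewrite -(ler_pdivrMr _ _ g_gt0) [n / G]mulrC; lra.
Qed.

End L2.

(** * Limits of Cauchy sequences of square-summable functions *)

Section Limits.
Variables (R : realType).
Local Notation C := R[i].

Lemma real_cauchy (u : nat -> R) :
  (forall e : R, 0 < e -> exists N, forall n m, (N <= n)%N -> (N <= m)%N ->
     `|u n - u m| <= e) -> cvgn u.
Proof.
move=> h; apply/cauchy_cvgP/cauchy_exP => e e0.
have [N hN] := h (e / 2) (divr_gt0 e0 (ltr0n _ 2)).
exists (u N), N => // n /= Nn; rewrite /ball /=.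
by apply: le_lt_trans (hN _ _ (leqnn N) Nn) _; rewrite ltr_pdivrMr// ltr_pMr// ltr1n.
Qed.

(** The squared norm of a difference is all that is estimated, so the limit in
    [l2] is only needed pointwise; Fatou recovers the norm. *)
Definition ptcvg (X : Type) (f : nat -> X -> C) (g : X -> C) :=
  forall x, (complex.Re (f n x) @[n --> \oo] --> complex.Re (g x)) /\
            (complex.Im (f n x) @[n --> \oo] --> complex.Im (g x)).

Lemma ptcvg_cauchy (X : choiceType) (f : nat -> X -> C) :
  (forall n, l2 (f n)) ->
  (forall e : R, 0 < e -> exists N, forall n m, (N <= n)%N -> (N <= m)%N ->
     nsq (fun x => f n x - f m x) <= e) -> exists g, ptcvg f g.
Proof.
move=> lf h.
have hx x (F : C -> R) : (forall z w, F (z - w) = F z - F w) ->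
    (forall z, `|F z| <= normc z) -> cvgn (fun n => F (f n x)).
  move=> FB Fn; apply: real_cauchy => e e0.
  have [N hN] := h (e ^+ 2) (exprn_gt0 _ e0).
  exists N => n m Nn Nm; rewrite -FB (le_trans (Fn _))//.
  rewrite -(@ler_pXn2r _ 2)// ?nnegrE ?normc_ge0 ?(ltW e0)//.
  apply: le_trans (hN _ _ Nn Nm).
  exact: (nsq_ge_pt x (l2B (lf n) (lf m))).
exists (fun x => Complex (limn (fun n => complex.Re (f n x)))
                         (limn (fun n => complex.Im (f n x)))) => x /=; split.
  by apply: (hx x (@complex.Re R)); [case=> a b [c d]|exact: Re_le_normc].
by apply: (hx x (@complex.Im R)) ; [case=> a b [c d]|exact: Im_le_normc].
Qed.

Lemma nrm2_fatou (X : choiceType) (f : nat -> X -> C) (g : X -> C) (K : R) N :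
  ptcvg f g -> (forall n, l2 (f n)) -> (forall n, (N <= n)%N -> nsq (f n) <= K) ->
  l2 g /\ nsq g <= K.
Proof.
move=> fg lf fK; apply: l2_le; apply: ge_ereal_sup => _ [A [finA _] <-].
rewrite fsbig_finite//= sumEFin lee_fin.
have cv : (\sum_(x <- fset_set A) normc (f n x) ^+ 2) @[n --> \oo] -->
    \sum_(x <- fset_set A) normc (g x) ^+ 2.
  apply: cvg_big => [|x _]; first exact: add_continuous.
  have [cr ci] := fg x.
  rewrite normc_sqrE; under eq_fun do rewrite normc_sqrE.
  by apply: cvgD; rewrite expr2; under eq_fun do rewrite expr2; apply: cvgM.
apply: (cvgr_to_le cv); exists N => // n /= Nn.
apply: le_trans (fK _ Nn).
rewrite -lee_fin -l2E// -sumEFin -fsbig_finite//.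
by apply: esum_ge; exists A.
Qed.

End Limits.

(** * Powers of 1 - T* T / K and the projection onto the kernel *)

Section AdjointPair.
Variables (R : realType) (X : choiceType).
Local Notation C := R[i].
Implicit Types (f g h v : X -> C).

Definition lin (T : (X -> C) -> (X -> C)) : Prop :=
  forall (c : C) f g, T (fun x => f x + c * g x) = (fun x => T f x + c * T g x).

(** A bounded operator on [l2] and its adjoint, given by formulas on all
    functions; [K] bounds the squares of their norms. *)
Record adjoint_pair (T T' : (X -> C) -> (X -> C)) (K : R) : Prop := AdjointPair {
  ap_gt0 : 0 < K;
  ap_lin : lin T;
  ap_lin' : lin T';
  ap_le : forall f, l2 f -> (nrm2 (T f) <= K%:E * nrm2 f)%E;
  ap_le' : forall f, l2 f -> (nrm2 (T' f) <= K%:E * nrm2 f)%E;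
  ap_adj : forall f g, l2 f -> l2 g -> inner (T f) g = inner f (T' g) }.

(** [1 - T^* T / K] is a positive contraction whose fixed vectors are the kernel
    of [T]. *)
Definition gram (T T' : (X -> C) -> (X -> C)) (K : R) f : X -> C :=
  fun x => f x - (K^-1)%:C * T' (T f) x.

Variables (T T' : (X -> C) -> (X -> C)) (K : R).
Hypothesis TT' : adjoint_pair T T' K.

Let K0 : 0 < K := ap_gt0 TT'.
Let Ki0 : 0 <= K^-1. Proof. by rewrite invr_ge0 ltW. Qed.

Lemma ap_l2 f : l2 f -> l2 (T f) /\ nsq (T f) <= K * nsq f.
Proof. by move=> lf; apply: l2_le; rewrite EFinM -(l2E lf); exact: (ap_le TT' lf). Qed.

Lemma ap_l2' f : l2 f -> l2 (T' f) /\ nsq (T' f) <= K * nsq f.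
Proof. by move=> lf; apply: l2_le; rewrite EFinM -(l2E lf); exact: (ap_le' TT' lf). Qed.

Let l2T f (lf : l2 f) := (ap_l2 lf).1.
Let l2T' f (lf : l2 f) := (ap_l2' lf).1.

Lemma ap_adj' f g : l2 f -> l2 g -> inner (T' f) g = inner f (T g).
Proof. by move=> lf lg; rewrite innerC -(ap_adj TT')// -innerC. Qed.

Lemma linB (S : (X -> C) -> (X -> C)) f g : lin S ->
  S (fun x => f x - g x) = (fun x => S f x - S g x).
Proof.
move=> linS; have := linS (-1) f g.
rewrite (_ : (fun x => f x + -1 * g x) = (fun x => f x - g x)); last first.
  by apply/funext => x; rewrite mulN1r.
by move=> ->; apply/funext => x; rewrite mulN1r.
Qed.

Lemma lin0 (S : (X -> C) -> (X -> C)) : lin S -> S (fun=> 0) = (fun=> 0).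
Proof.
move=> linS; have := @linB S (fun=> 0) (fun=> 0) linS.
rewrite (_ : (fun x : X => 0 - 0) = (fun=> 0 : C)); last first.
  by apply/funext => x; rewrite subrr.
by move=> ->; apply/funext => x; rewrite subrr.
Qed.

Local Notation Q := (gram T T' K).

Lemma gram_l2 f : l2 f -> l2 (Q f).
Proof. by move=> lf; apply: l2B => //; apply: l2Z; apply: l2T'; exact: l2T. Qed.

Lemma iter_gram_l2 n f : l2 f -> l2 (iter n Q f).
Proof. by move=> lf; elim: n => //= n; exact: gram_l2. Qed.

Lemma inner_gram f g : l2 f -> l2 g -> inner (Q f) g = inner f (Q g).
Proof.
move=> lf lg; have lTf := l2T lf; have lTg := l2T lg.
have lA := l2T' lTf; have lB := l2T' lTg.
rewrite /gram (innerBl lf (l2Z _ lA) lg) (innerBr lg (l2Z _ lB) lf).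
by rewrite (innerZl _ lA lg) (innerZr _ lB lf) cjR (ap_adj' lTf lg) -(ap_adj TT' lf lTg).
Qed.

Lemma inner_iter_gram n f g : l2 f -> l2 g ->
  inner (iter n Q f) g = inner f (iter n Q g).
Proof.
move=> lf lg; elim: n g lg => [//|n IH] g lg.
rewrite iterS (inner_gram (iter_gram_l2 n lf) lg) (IH _ (gram_l2 lg)).
by rewrite iterSr.
Qed.

Lemma Re_inner_gram f : l2 f ->
  complex.Re (inner (Q f) f) = nsq f - K^-1 * nsq (T f).
Proof.
move=> lf; have lTf := l2T lf; have lTTf := l2T' lTf.
rewrite /gram (innerBl lf (l2Z _ lTTf) lf) (innerZl _ lTTf lf) (ap_adj' lTf lf).
rewrite (inner_self lf) (inner_self lTf).
by rewrite -rmorphM -rmorphB.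
Qed.

(** A positive contraction [Q] satisfies [Q^2 <= Q]. *)
Lemma nsq_gram_le f : l2 f -> nsq (Q f) <= complex.Re (inner (Q f) f).
Proof.
move=> lf; have lTf := l2T lf; have lTTf := l2T' lTf.
rewrite Re_inner_gram// /gram (nsqB lf (l2Z _ lTTf)) (nsqZ _ lTTf) normc_real.
rewrite (ger0_norm Ki0) (innerZr _ lTTf lf) cjR -(ap_adj TT' lf lTf) (inner_self lTf).
rewrite -rmorphM -[complex.Re _]/(K^-1 * nsq (T f)).
have := (ap_l2' lTf).2; rewrite -(ler_pM2l (_ : 0 < K^-1 ^+ 2)) ?exprn_gt0 ?invr_gt0//.
rewrite [in X in _ <= X]mulrA (_ : K^-1 ^+ 2 * K = K^-1); last by field; rewrite gt_eqF.
lra.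
Qed.

(** The moments of the spectral measure of [Q] at [v]. *)
Definition gmom v n : R := complex.Re (inner (iter n Q v) v).

Variables (v : X -> C) (lv : l2 v).

Lemma gmomD n m : gmom v (n + m) = complex.Re (inner (iter n Q v) (iter m Q v)).
Proof.
by rewrite /gmom addnC iterD inner_iter_gram//; exact: iter_gram_l2.
Qed.

Lemma gmom_double n : gmom v (n + n) = nsq (iter n Q v).
Proof. by rewrite gmomD inner_self//; exact: iter_gram_l2. Qed.

Lemma gmom_doubleS n :
  gmom v (n + n).+1 = complex.Re (inner (Q (iter n Q v)) (iter n Q v)).
Proof. by rewrite -addSn gmomD. Qed.

Lemma gmom0 : gmom v 0 = nsq v.
Proof. by rewrite -(gmom_double 0). Qed.

(** Even steps use [Q <= 1], odd ones [Q^2 <= Q], both at the vector [Q^(n/2) v]. *)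
Lemma gmom_decr n : gmom v n.+1 <= gmom v n.
Proof.
have lQ k := iter_gram_l2 k lv.
rewrite -[n]odd_double_half -addnn; case: (odd n); rewrite ?add1n ?add0n; last first.
  rewrite gmom_doubleS gmom_double Re_inner_gram// gerBl mulr_ge0// nsq_ge0//.
rewrite gmom_doubleS (_ : (_ + _).+2 = n./2.+1 + n./2.+1)%N; last by rewrite addSn addnS.
by rewrite gmom_double /=; exact: nsq_gram_le.
Qed.

Lemma gmom_noninc : {homo gmom v : n m / (n <= m)%N >-> m <= n}.
Proof. by apply: homo_leq => [n|n m p nm mp|n]; rewrite ?gmom_decr//; exact: le_trans mp nm. Qed.

Lemma gmom_ge0 n : 0 <= gmom v n.
Proof.
apply: (@le_trans _ _ (gmom v (n + n))); first by rewrite gmom_double nsq_ge0.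
by apply: gmom_noninc; rewrite leq_addr.
Qed.

Lemma gmom_cvg : cvgn (gmom v).
Proof.
apply: nonincreasing_is_cvgn => [n m nm|]; first exact: gmom_noninc.
by exists 0 => _ [n _ <-]; exact: gmom_ge0.
Qed.

Lemma nsq_iterB n m : nsq (fun x => iter n Q v x - iter m Q v x) =
  gmom v (n + n) + gmom v (m + m) - 2 * gmom v (n + m).
Proof.
by rewrite nsqB; try exact: iter_gram_l2; rewrite !gmom_double gmomD.
Qed.

Lemma iter_gram_cauchy (e : R) : 0 < e -> exists N, forall n m,
  (N <= n)%N -> (N <= m)%N -> nsq (fun x => iter n Q v x - iter m Q v x) <= e.
Proof.
move=> e0; have e2 : 0 < e / 2 by rewrite divr_gt0.
have dec : nonincreasing_seq (gmom v) by move=> n m; exact: gmom_noninc.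
have ge n : limn (gmom v) <= gmom v n by exact: nonincreasing_cvgn_ge dec gmom_cvg n.
have /cvgrPdist_le/(_ _ e2)[N _ hN] := gmom_cvg.
exists N => n m Nn Nm; rewrite nsq_iterB.
have := hN (n + n)%N (leq_trans Nn (leq_addr n n)).
have := hN (m + m)%N (leq_trans Nm (leq_addr m m)).
have := ge (n + m)%N; have := ge (n + n)%N; have := ge (m + m)%N.
rewrite /=; set a := gmom v _; set b := gmom v _; set c := gmom v _.
set l := limn _ => la lb lc.
by rewrite !ler_norml => /andP[A1 A2] /andP[B1 B2]; lra.
Qed.

Lemma gram_fix_ker h : T h = (fun=> 0) -> Q h = h.
Proof.
move=> Th; rewrite /gram Th (lin0 (ap_lin' TT')).
by apply/funext => x; rewrite mulr0 subr0.
Qed.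

Lemma inner_cvg0 h : l2 h -> forall w,
  l2 w -> (forall e : R, 0 < e -> exists2 f, l2 f /\ nsq (fun x => w x - f x) <= e &
     inner f h = 0) -> inner w h = 0.
Proof.
move=> lh w lw H; apply: Normc.eq0_normc; apply/eqP; rewrite -sqrf_eq0 eq_le sqr_ge0 andbT.
apply/ler_addgt0Pr => e e0; rewrite add0r.
have d0 : 0 < e / (nsq h + 1) by rewrite divr_gt0// ltr_wpDl// nsq_ge0.
have [f [lf fe] f0] := H _ d0.
have -> : inner w h = inner (fun x => w x - f x) h by rewrite innerBl// f0 subr0.
apply: (le_trans (cauchy_schwarz (l2B lw lf) lh)).
apply: (le_trans (ler_wpM2r (nsq_ge0 h) fe)).
have h1 : 0 < nsq h + 1 by rewrite ltr_wpDl// nsq_ge0.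
by rewrite -mulrA ger_pMr// mulrC ler_pdivrMr// mul1r lerDl.
Qed.

(** The powers of [Q] converge to the projection onto the kernel of [T]: they
    are Cauchy because [|Q^n v - Q^m v|^2] is a second difference of the
    monotone moments, and [T Q^n v] tends to zero because
    [|T Q^n v|^2 / K] is a difference of consecutive moments. *)
Lemma gram_limit : exists w, [/\ l2 w, T w = (fun=> 0),
    forall h, l2 h -> T h = (fun=> 0) -> inner (fun x => v x - w x) h = 0
  & forall g, l2 g -> complex.Re (inner (iter n Q v) g) @[n --> \oo]
       --> complex.Re (inner w g)].
Proof.
have lQ n := iter_gram_l2 n lv.
have [w fw] := ptcvg_cauchy lQ iter_gram_cauchy.
have near_w (e : R) : 0 < e -> exists N, forall m, (N <= m)%N ->
    l2 (fun x => w x - iter m Q v x) /\ nsq (fun x => w x - iter m Q v x) <= e.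
  move=> e0; have [N hN] := iter_gram_cauchy e0; exists N => m Nm.
  apply: (@nrm2_fatou _ _ (fun n x => iter n Q v x - iter m Q v x) _ _ N).
  - move=> x; have [cr ci] := fw x.
    have E1 (F : C -> R) : (forall z z', F (z - z') = F z - F z') ->
        F (iter n Q v x) @[n --> \oo] --> F (w x) ->
        F (iter n Q v x - iter m Q v x) @[n --> \oo] --> F (w x - iter m Q v x).
      move=> FB cF; rewrite FB; under eq_fun do rewrite FB.
      by apply: cvgB => //; exact: cvg_cst.
    by split; apply: E1 => // -[a b] [].
  - by move=> n; apply: l2B.
  - by move=> n Nn; exact: hN.
have lw : l2 w.
  have [N /(_ N (leqnn N))[l1 _]] := near_w 1 ltr01.
  by apply: l2_ext (l2D l1 (lQ N)) _ => x; rewrite subrK.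
have cvi g : l2 g -> complex.Re (inner (iter n Q v) g) @[n --> \oo]
    --> complex.Re (inner w g).
  move=> lg; apply/cvgrPdist_le => e e0.
  have g1 : 0 < nsq g + 1 by rewrite ltr_wpDl// nsq_ge0.
  have d0 : 0 < e ^+ 2 / (nsq g + 1) by rewrite divr_gt0// exprn_gt0.
  have [N hN] := near_w _ d0; exists N => // n /= Nn.
  have [l1 l2] := hN n Nn.
  have -> : complex.Re (inner w g) - complex.Re (inner (iter n Q v) g) =
      complex.Re (inner (fun x => w x - iter n Q v x) g).
    by rewrite innerBl//; case: (inner w g) => a b; case: (inner _ g).
  apply: (le_trans (Re_le_normc _)).
  rewrite -(@ler_pXn2r _ 2)// ?nnegrE ?normc_ge0 ?(ltW e0)//.
  apply: (le_trans (cauchy_schwarz l1 lg)).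
  apply: (le_trans (ler_wpM2r (nsq_ge0 g) l2)).
  by rewrite -mulrA ger_pMr ?exprn_gt0// mulrC ler_pdivrMr// mul1r lerDl.
exists w; split => //.
- apply: nsq_eq0; first exact: l2T.
  (* With u = Q^n v, the bound |T w|^2 <= 2 |T (w - u)|^2 + 2 |T u|^2 splits e into
     e / 4 and e / 2. *)
  apply/ler_addgt0Pr => e e0; rewrite add0r.
  have d0 : 0 < e / (8 * K) by rewrite divr_gt0// mulr_gt0.
  have [N hN] := near_w _ d0.
  have /cvgrPdist_le/(_ _ d0)[M _ hM] := gmom_cvg.
  pose n := maxn N M; pose u := iter n Q v.
  have [l1 n1] := hN n (leq_maxl N M); rewrite -/u in l1 n1.
  have TuE : nsq (T u) = K * (gmom v (n + n) - gmom v (n + n).+1).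
    rewrite gmom_double gmom_doubleS Re_inner_gram// -/u.
    by field; rewrite gt_eqF.
  have Mn : (M <= n + n)%N by rewrite (leq_trans (leq_maxr N M))// leq_addr.
  have h1 := hM _ Mn; have h2 := hM _ (leqW Mn).
  have Tu : nsq (T u) <= e / 4.
    have -> : e / 4 = K * (2 * (e / (8 * K))) by field; rewrite gt_eqF.
    rewrite TuE ler_pM2l//.
    by move: h1 h2; rewrite !ler_norml => /andP[A1 A2] /andP[B1 B2]; lra.
  have Twu := (ap_l2 l1).2.
  have : (nrm2 (T w) <= (2 * nsq (T (fun x => w x - u x)) + 2 * nsq (T u))%:E)%E.
    have lTu := l2T (lQ n); have lTwu := l2T l1.
    have le2 : (nrm2 (T w) <= \esum_(x in [set: X])
        (2 * normc (T (fun x => w x - u x) x) ^+ 2 + 2 * normc (T u x) ^+ 2)%:E)%E.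
      apply: le_esum => x _; rewrite lee_fin.
      apply: le_trans (normcD_sqr_le _ _).
      by rewrite (linB _ _ (ap_lin TT')) subrK.
    apply: (le_trans le2); under eq_esum do rewrite EFinD.
    rewrite esumD; try by move=> x _; rewrite lee_fin mulr_ge0// sqr_ge0.
    rewrite !esumZ//; try by move=> x; exact: sqr_ge0.
    by rewrite -!/(nrm2 _) (l2E lTu) (l2E lTwu).
  rewrite l2E ?lee_fin; last exact: l2T.
  move=> /le_trans; apply.
  have : K * nsq (fun x => w x - u x) <= e / 8.
    have -> : e / 8 = K * (e / (8 * K)) by field; rewrite gt_eqF.
    by rewrite ler_pM2l.
  lra.
- move=> h lh Th; apply: inner_cvg0 => //; first exact: l2B.
  move=> e e0; have [N hN] := near_w _ e0.
  have [l1 n1] := hN N (leqnn N).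
  exists (fun x => v x - iter N Q v x); last first.
    rewrite innerBl// inner_iter_gram//.
    suff -> : iter N Q h = h by rewrite subrr.
    by elim: (N) => //= n ->; exact: gram_fix_ker.
  split; first exact: l2B.
  have -> : (fun x => v x - w x - (v x - iter N Q v x)) =
      (fun x => -1 * (w x - iter N Q v x)).
    by apply/funext => x; rewrite mulN1r opprB opprD opprK addrA addrAC [v x - w x]addrC addrK addrC.
  by rewrite nsqZ// normc_sqrE /= sqrrN oppr0 expr1n expr0n addr0 mul1r.
Qed.

(** The limit of the moments is the squared norm of the projection, because the
    limit of [Q^n v] satisfies the conditions that characterize the projection. *)
Lemma orth_proj_gmom :
  l2 (orth_proj (ker_on (@l2 R X) T) v) /\
  inner (orth_proj (ker_on (@l2 R X) T) v) v = (limn (gmom v))%:C.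
Proof.
have [w [lw Tw orth cw]] := gram_limit.
set Kr := ker_on _ _.
have -> : orth_proj Kr v = w.
  rewrite /orth_proj; case: xgetP => [g _ [[lg Tg] og]|/(_ w)[]]; last first.
    by split=> // h [lh Th]; exact: orth.
  have lgw := l2B lg lw.
  have Tgw : T (fun x => g x - w x) = (fun=> 0).
    by rewrite (linB _ _ (ap_lin TT')) Tg Tw; apply/funext => x; rewrite subrr.
  have E : inner (fun x => g x - w x) (fun x => g x - w x) = 0.
    have {1}-> : (fun x => g x - w x) = (fun x => (v x - w x) - (v x - g x)).
      by apply/funext => x; rewrite opprB [RHS]addrC addrA subrK.
    rewrite innerBl//; try exact: l2B.
    by rewrite orth// og ?subrr.
  apply/funext => x; apply/eqP; rewrite -subr_eq0; apply/eqP.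
  have := @nsq_eq0 _ _ _ lgw; rewrite inner_self// in E.
  by case: E => -> /(_ (lexx _))/(congr1 (@^~ x)).
split=> //.
have Evw : inner w v = inner w w.
  apply/eqP; rewrite -subr_eq0 -innerBr// innerC (orth w lw Tw).
  by rewrite cjE rmorph0.
have -> : limn (gmom v) = complex.Re (inner w v).
  by apply/cvg_lim; [exact: Rhausdorff|exact: cw].
by rewrite Evw inner_self.
Qed.

End AdjointPair.

(** * Operators built from finitely many translations *)

Section Fibres.
Variables (R : realType) (J : finType) (Y : choiceType).
Local Notation C := R[i].

(** Fubini for the finite factor. *)
Lemma esum_fibre (h : J * Y -> \bar R) : (forall x, (0 <= h x)%E) ->
  (\esum_(x in [set: J * Y]) h x = \sum_(a : J) \esum_(y in [set: Y]) h (a, y))%E.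
Proof.
move=> h0.
have -> : (\sum_(a : J) \esum_(y in [set: Y]) h (a, y) =
    \esum_(a in [set: J]) \esum_(y in [set: Y]) h (a, y))%E.
  rewrite -[in RHS](set_mem_set setT) esum_fset//; last first.
    by move=> a _; apply: esum_ge0 => y _.
  rewrite set_mem_set (fsbigE (index_enum J)) ?index_enum_uniq//.
    by apply: eq_bigl => a; rewrite in_setT.
  by move=> a _; rewrite mem_index_enum.
rewrite esum_esum//; congr (esum _ _); first by apply/seteqP; split=> -[].
by apply/funext => -[].
Qed.

Lemma rsum_fibre (f : J * Y -> R) : absum f ->
  (forall a, absum (fun y => f (a, y))) /\
  rsum f = \sum_(a : J) rsum (fun y => f (a, y)).
Proof.
have key (u : J * Y -> R) : (forall x, 0 <= u x) -> finsum u ->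
    (forall a, finsum (fun y => u (a, y))) /\
    fine (\esum_(x in [set: J * Y]) (u x)%:E) =
    \sum_(a : J) fine (\esum_(y in [set: Y]) (u (a, y))%:E).
  move=> u0 fu; have e0 a : (0 <= \esum_(y in [set: Y]) (u (a, y))%:E)%E.
    by apply: esum_ge0 => y _; rewrite lee_fin.
  have E := @esum_fibre (fun x => (u x)%:E) (fun x => u0 x).
  have fa a : finsum (fun y => u (a, y)).
    rewrite /finsum; apply: le_lt_trans fu; rewrite E (bigD1 a)//= leeDl//.
    exact: sume_ge0.
  split=> //; rewrite E.
  under eq_bigr => a _ do rewrite -(esum_fin (fun y => u0 (a, y)) (fa a)).
  by rewrite sumEFin.
move=> sf; have [sfa _] := key (fun x => `|f x|) (fun x => normr_ge0 _) sf.
split=> //; have [fp fn] := absum_parts sf.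
have m0 (h : J * Y -> R) x : 0 <= Num.max (h x) 0 by rewrite le_max lexx orbT.
have [_ Ep] := key _ (m0 f) fp.
have [_ En] := key (fun x => Num.max (- f x) 0) (m0 (fun x => - f x)) fn.
by rewrite /rsum Ep En -sumrB.
Qed.

Lemma csum_fibre (f : J * Y -> C) : csummable f ->
  csum f = \sum_(a : J) csum (fun y => f (a, y)).
Proof.
move=> /csummable_parts[/rsum_fibre[_ Er] /rsum_fibre[_ Ei]].
rewrite /csum Er Ei; elim/big_rec3 : _ => //= a x y z _ <-.
by rewrite /csum.
Qed.

Lemma l2_fibre (f : J * Y -> C) a : l2 f -> l2 (fun y => f (a, y)).
Proof.
move=> lf; apply: le_lt_trans lf.
rewrite esum_fibre => [|x]; last by rewrite lee_fin sqr_ge0.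
rewrite (bigD1 a)//= leeDl//; apply: sume_ge0 => b _.
by apply: esum_ge0 => y _; rewrite lee_fin sqr_ge0.
Qed.

Lemma inner_fibre (f h : J * Y -> C) : l2 f -> l2 h ->
  inner f h = \sum_(a : J) inner (fun y => f (a, y)) (fun y => h (a, y)).
Proof. by move=> lf lh; rewrite /inner csum_fibre//; exact: l2M. Qed.

End Fibres.

Section FiniteSums.
Variables (R : realType) (X : choiceType) (I : Type).
Local Notation C := R[i].

Lemma l2_sum (r : seq I) (F : I -> X -> C) : (forall i, l2 (F i)) ->
  l2 (fun x => \sum_(i <- r) F i x).
Proof.
move=> lF; elim: r => [|i r IH].
  by apply: l2_ext (l2_0 R X) _ => x; rewrite big_nil.
by apply: l2_ext (l2D (lF i) IH) _ => x; rewrite big_cons.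
Qed.

Lemma inner_suml (r : seq I) (F : I -> X -> C) h : (forall i, l2 (F i)) -> l2 h ->
  inner (fun x => \sum_(i <- r) F i x) h = \sum_(i <- r) inner (F i) h.
Proof.
move=> lF lh; elim: r => [|i r IH].
  rewrite big_nil (_ : (fun x => _) = (fun x => 0 * h x)) ?innerZl ?mul0r//.
  by apply/funext => x; rewrite big_nil mul0r.
rewrite big_cons -IH -(innerDl (lF i) (l2_sum r lF) lh).
by apply: (congr1 (fun u => inner u h)); apply/funext => x; rewrite big_cons.
Qed.

Lemma inner_sumr (r : seq I) (F : I -> X -> C) h : (forall i, l2 (F i)) -> l2 h ->
  inner h (fun x => \sum_(i <- r) F i x) = \sum_(i <- r) inner h (F i).
Proof.
move=> lF lh; rewrite innerC inner_suml// rmorph_sum/=.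
by apply: eq_bigr => i _; rewrite -innerC.
Qed.

End FiniteSums.

Section Reindex.
Variables (R : realType) (Y : choiceType) (e e' : Y -> Y).
Hypotheses (eK : cancel e e') (e'K : cancel e' e).
Local Notation C := R[i].

Lemma esum_bij (u : Y -> \bar R) :
  (\esum_(y in [set: Y]) u (e y) = \esum_(y in [set: Y]) u y)%E.
Proof.
rewrite -(reindex_esum [set: Y] [set: Y] e)//.
by split=> // [x y _ _ /(congr1 e')|y _]; rewrite ?eK//; exists (e' y).
Qed.

Lemma l2_bij (f : Y -> C) : l2 f -> l2 (fun y => f (e y)).
Proof. by rewrite /l2/= (esum_bij (fun y => (normc (f y) ^+ 2)%:E)). Qed.

Lemma csum_bij (f : Y -> C) : csum (fun y => f (e y)) = csum f.
Proof.
rewrite /csum /rsum.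
by congr (Complex (fine _ - fine _) (fine _ - fine _));
  rewrite -[RHS]esum_bij.
Qed.

Lemma inner_bij (f h : Y -> C) :
  inner (fun y => f (e y)) h = inner f (fun y => h (e' y)).
Proof.
rewrite /inner -[RHS]csum_bij; congr csum.
by apply/funext => y; rewrite eK.
Qed.

End Reindex.

Section Operators.
Variables (R : realType) (G : choiceType) (J : finType) (Y : choiceType).
Local Notation C := R[i].
Variables (s : J -> J -> seq G) (c : J -> J -> G -> C).

(** [c a b g] is the coefficient of the translation by [g] from the block [b] to
    the block [a]; [s a b] lists the translations that occur. *)
Definition blockop (e : G -> Y -> Y) (f : J * Y -> C) : J * Y -> C :=
  fun x => \sum_(b : J) \sum_(g <- s x.1 b) c x.1 b g * f (b, e g x.2).

Lemma blockop_lin e : lin (blockop e).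
Proof.
move=> k f h; apply/funext => x; rewrite /blockop mulr_sumr -big_split/=.
apply: eq_bigr => b _; rewrite mulr_sumr -big_split/=; apply: eq_bigr => g _.
by rewrite mulrDr mulrCA.
Qed.

Definition weight (a b : J) : R := \sum_(g <- s a b) normc (c a b g).

Lemma weight_ge0 a b : 0 <= weight a b.
Proof. by apply: sumr_ge0 => g _; exact: normc_ge0. Qed.

Variables (kappa : R).
Hypotheses (rowle : forall a, \sum_b weight a b <= kappa)
  (colle : forall b, \sum_a weight a b <= kappa) (kappa_ge0 : 0 <= kappa).
Variables (e e' : G -> Y -> Y).
Hypotheses (eK : forall g, cancel (e g) (e' g)) (e'K : forall g, cancel (e' g) (e g)).

(** Cauchy-Schwarz for finite sums of products, in a form that is stable under
    addition, so that it passes through nested sums. *)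
Let CS (z : C) (W V : R) := [/\ 0 <= W, 0 <= V & normc z ^+ 2 <= W * V].

Let CS0 : CS 0 0 0.
Proof. by split=> //; rewrite mulr0 Normc.normc0 expr0n. Qed.

Let CSD z1 W1 V1 z2 W2 V2 : CS z1 W1 V1 -> CS z2 W2 V2 ->
  CS (z1 + z2) (W1 + W2) (V1 + V2).
Proof.
move=> [w1 v1 h1] [w2 v2 h2]; split; rewrite ?addr_ge0//.
have n1 := normc_ge0 z1; have n2 := normc_ge0 z2.
have : normc (z1 + z2) ^+ 2 <= (normc z1 + normc z2) ^+ 2.
  by rewrite ler_pXn2r// ?nnegrE ?normc_ge0 ?addr_ge0 ?normc_leD.
move=> /le_trans; apply; rewrite sqrrD.
set p := normc z1 in h1 n1 *; set q := normc z2 in h2 n2 *.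
have : 2 * (p * q) <= W1 * V2 + W2 * V1.
  rewrite -(@ler_pXn2r _ 2)// ?nnegrE ?mulr_ge0 ?addr_ge0 ?mulr_ge0//.
  have h : (p * q) ^+ 2 <= (W1 * V2) * (W2 * V1).
    rewrite exprMn; have := ler_pM (sqr_ge0 p) (sqr_ge0 q) h1 h2.
    by move=> /le_trans; apply; rewrite le_eqVlt; apply/orP; left; apply/eqP; ring.
  have := sqr_ge0 (W1 * V2 - W2 * V1); rewrite exprMn; lra.
rewrite mulrDl !mulrDr -mulr_natl; lra.
Qed.

(** The Schur test: at each point, Cauchy-Schwarz with the coefficients as weights
    costs a row sum; after summation over the points each coordinate of [f] is
    counted with a column sum. *)
Lemma blockop_bound (f : J * Y -> C) :
  (nrm2 (blockop e f) <= (kappa ^+ 2)%:E * nrm2 f)%E.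
Proof.
pose u x := normc (f x) ^+ 2; have u0 x : 0 <= u x by exact: sqr_ge0.
pose V x := \sum_(b : J) \sum_(g <- s x.1 b) normc (c x.1 b g) * u (b, e g x.2).
have V0 x : 0 <= V x.
  by apply: sumr_ge0 => b _; apply: sumr_ge0 => g _; rewrite mulr_ge0 ?normc_ge0.
have ptw x : normc (blockop e f x) ^+ 2 <= kappa * V x.
  have [_ _ /le_trans] : CS (blockop e f x) (\sum_b weight x.1 b) (V x).
    rewrite /blockop /V; apply: (big_ind3 CS) => // b _.
    rewrite /weight; apply: (big_ind3 CS) => // g _; split; rewrite ?normc_ge0 ?mulr_ge0 ?normc_ge0//.
    by rewrite Normc.normcM exprMn [in X in X <= _]expr2 -mulrA.
  by apply; rewrite ler_wpM2r.
have E1 : (nrm2 (blockop e f) <= kappa%:E * \esum_(x in [set: J * Y]) (V x)%:E)%E.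
  rewrite -esumZ//; apply: le_esum => x _; rewrite lee_fin; exact: ptw.
apply: (le_trans E1); rewrite expr2 EFinM -muleA lee_wpmul2l ?lee_fin//.
rewrite esum_fibre; last by move=> x; rewrite lee_fin.
rewrite /nrm2 esum_fibre; last by move=> x; rewrite lee_fin sqr_ge0.
pose U b := (\esum_(y in [set: Y]) (u (b, y))%:E)%E.
have U0 b : (0 <= U b)%E by apply: esum_ge0 => y _; rewrite lee_fin.
have E2 a : (\esum_(y in [set: Y]) (V (a, y))%:E = \sum_b (weight a b)%:E * U b)%E.
  have p0 b g y : 0 <= normc (c a b g) * u (b, e g y) by rewrite mulr_ge0 ?normc_ge0.
  transitivity (\esum_(y in [set: Y])
      \sum_(b : J) \sum_(g <- s a b) (normc (c a b g) * u (b, e g y))%:E)%E.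
    apply: eq_esum => y _; rewrite /V -sumEFin; apply: eq_bigr => b _.
    by rewrite -sumEFin.
  rewrite (@esum_sum R Y J setT (index_enum J) xpredT
    (fun y b => \sum_(g <- s a b) (normc (c a b g) * u (b, e g y))%:E)%E); last first.
    by move=> y b _ _; rewrite sume_ge0// => g _; rewrite lee_fin.
  apply: eq_bigr => b _.
  rewrite (@esum_sum R Y G setT (s a b) xpredT
    (fun y g => (normc (c a b g) * u (b, e g y))%:E)); last by move=> y g _ _; rewrite lee_fin.
  rewrite /weight -sumEFin ge0_sume_distrl; last by move=> g _; rewrite lee_fin normc_ge0.
  apply: eq_bigr => g _; rewrite esumZ ?normc_ge0//; congr (_ * _)%E.
  exact: (esum_bij (eK g) (e'K g) (fun y => (u (b, y))%:E)).
under eq_bigr do rewrite E2.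
rewrite exchange_big ge0_sume_distrr//=; last by move=> b _; exact: U0.
apply: lee_sum => b _; rewrite -ge0_sume_distrl; last by move=> a _; rewrite lee_fin weight_ge0.
by rewrite lee_wpmul2r// sumEFin lee_fin.
Qed.

End Operators.

Section OperatorAdjoint.
Variables (R : realType) (G : choiceType) (J : finType) (Y : choiceType).
Local Notation C := R[i].
Variables (s : J -> J -> seq G) (c : J -> J -> G -> C).
Variables (e e' : G -> Y -> Y).
Hypotheses (eK : forall g, cancel (e g) (e' g)) (e'K : forall g, cancel (e' g) (e g)).

Definition tr_labels (b a : J) := s a b.
Definition tr_coef (b a : J) g := cj (c a b g).

Lemma inner_blockop (f h : J * Y -> C) : l2 f -> l2 h ->
  l2 (blockop s c e f) -> l2 (blockop tr_labels tr_coef e' h) ->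
  inner (blockop s c e f) h = inner f (blockop tr_labels tr_coef e' h).
Proof.
move=> lf lh lof loh; rewrite !inner_fibre// /blockop/=.
pose t a b g := inner (fun y => f (b, y)) (fun y => h (a, e' g y)).
have lfe a g : l2 (fun y => f (a, e g y)).
  exact: (l2_bij (eK g) (e'K g) (l2_fibre a lf)).
have lhe a g : l2 (fun y => h (a, e' g y)).
  exact: (l2_bij (e'K g) (eK g) (l2_fibre a lh)).
have L a : inner (fun y => \sum_b \sum_(g <- s a b) c a b g * f (b, e g y))
    (fun y => h (a, y)) = \sum_b \sum_(g <- s a b) c a b g * t a b g.
  rewrite inner_suml; last exact: l2_fibre.
    apply: eq_bigr => b _; rewrite inner_suml; last exact: l2_fibre.
      apply: eq_bigr => g _; rewrite innerZl//; last exact: l2_fibre.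
      by congr (_ * _); exact: (inner_bij (eK g) (e'K g) (fun y => f (b, y))).
    by move=> g; apply: l2Z.
  by move=> b; apply: l2_sum => g; apply: l2Z.
have M b : inner (fun y => f (b, y))
    (fun y => \sum_a \sum_(g <- s a b) cj (c a b g) * h (a, e' g y)) =
    \sum_a \sum_(g <- s a b) c a b g * t a b g.
  rewrite inner_sumr; last exact: l2_fibre.
    apply: eq_bigr => a _; rewrite inner_sumr; last exact: l2_fibre.
      by apply: eq_bigr => g _; rewrite innerZr// ?cjK//; exact: l2_fibre.
    by move=> g; apply: l2Z.
  by move=> a; apply: l2_sum => g; apply: l2Z.
under eq_bigr do rewrite L.
under [RHS]eq_bigr do rewrite /tr_labels /tr_coef M.
by rewrite exchange_big.
Qed.

Variables (kappa : R).
Hypotheses (rowle : forall a, \sum_b weight s c a b <= kappa)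
  (colle : forall b, \sum_a weight s c a b <= kappa) (kappa_gt0 : 0 < kappa).

Lemma blockop_adjoint :
  adjoint_pair (blockop s c e) (blockop tr_labels tr_coef e') (kappa ^+ 2).
Proof.
have W a b : weight tr_labels tr_coef a b = weight s c b a.
  by apply: eq_bigr => g _; rewrite normc_conj.
have b1 f : (nrm2 (blockop s c e f) <= (kappa ^+ 2)%:E * nrm2 f)%E.
  by apply: (blockop_bound rowle colle _ eK e'K); exact: ltW.
have b2 f : (nrm2 (blockop tr_labels tr_coef e' f) <= (kappa ^+ 2)%:E * nrm2 f)%E.
  apply: (blockop_bound _ _ _ e'K eK); last exact: ltW.
    by move=> a; under eq_bigr do rewrite W.
  by move=> a; under eq_bigr do rewrite W.
have lt (T : (J * Y -> C) -> (J * Y -> C)) f :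
    (nrm2 (T f) <= (kappa ^+ 2)%:E * nrm2 f)%E -> l2 f -> l2 (T f).
  by move=> h lf; apply: (le_lt_trans h); rewrite (l2E lf) -EFinM ltry.
split=> //.
- exact: exprn_gt0.
- exact: blockop_lin.
- exact: blockop_lin.
- move=> f h lf lh; apply: inner_blockop => //; exact: lt.
Qed.

End OperatorAdjoint.

(** * Locality of the powers for group ring matrices *)

Section Delta.
Variables (R : realType) (X : choiceType).
Local Notation C := R[i].

Definition delta (x : X) : X -> C := fun y => (y == x)%:R.

Lemma esum_at (x : X) (u : X -> R) : (forall y, y != x -> u y = 0) ->
  0 <= u x -> (\esum_(y in [set: X]) (u y)%:E)%E = (u x)%:E.
Proof.
move=> u0 ux; rewrite -(@esum_set1 R X x (fun y => (u y)%:E)) ?lee_fin//.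
rewrite [RHS]esum_mkcond; apply: eq_esum => y _.
case: ifPn => //; rewrite notin_setE => /= /eqP yx.
by rewrite u0.
Qed.

Lemma rsum_at (x : X) (u : X -> R) : (forall y, y != x -> u y = 0) -> rsum u = u x.
Proof.
move=> u0; rewrite /rsum (@esum_at x (fun y => Num.max (u y) 0)).
- rewrite (@esum_at x (fun y => Num.max (- u y) 0)) /=.
  + by rewrite -maxr_split.
  + by move=> y /u0 ->; rewrite oppr0 maxxx.
  + by rewrite le_max lexx orbT.
- by move=> y /u0 ->; rewrite maxxx.
- by rewrite le_max lexx orbT.
Qed.

Lemma inner_delta (f : X -> C) x : inner f (delta x) = f x.
Proof.
rewrite /inner /csum !(@rsum_at x) /delta.
- by rewrite eqxx rmorph1 mulr1; case: (f x).
- by move=> y /negbTE ->; rewrite rmorph0 mulr0.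
- by move=> y /negbTE ->; rewrite rmorph0 mulr0.
Qed.

Lemma l2_delta x : l2 (delta x).
Proof.
rewrite /l2/= (@esum_at x) ?ltry// ?sqr_ge0//.
by move=> y /negbTE yx; rewrite /delta yx Normc.normc0 expr0n.
Qed.

Lemma nsq_delta x : nsq (delta x) = 1.
Proof.
rewrite /nsq /nrm2 (@esum_at x) ?sqr_ge0//= /delta ?eqxx ?Normc.normc1 ?expr1n//.
by move=> y /negbTE yx; rewrite yx Normc.normc0 expr0n.
Qed.

Variables (T T' : (X -> C) -> (X -> C)) (K : R).
Hypothesis TT' : adjoint_pair T T' K.

Definition diag x n := complex.Re (iter n (gram T T' K) (delta x) x).

Lemma diagE x : diag x = gmom T T' K (delta x).
Proof. by apply/funext => n; rewrite /gmom inner_delta. Qed.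

Lemma diag_noninc x : {homo diag x : n m / (n <= m)%N >-> m <= n}.
Proof. by rewrite diagE; apply: gmom_noninc TT' _ (l2_delta x). Qed.

Lemma diag_ge0 x n : 0 <= diag x n.
Proof. by rewrite diagE; apply: gmom_ge0 TT' _ (l2_delta x) _. Qed.

Lemma diag_le1 x n : diag x n <= 1.
Proof.
apply: (le_trans (diag_noninc x (leq0n n))).
by rewrite diagE (gmom0 TT' (l2_delta x)) nsq_delta.
Qed.

Lemma diag_cvg x : cvgn (diag x).
Proof. by rewrite diagE; apply: gmom_cvg TT' _ (l2_delta x). Qed.

(** The local dimension of the kernel at [x] is the limit of the diagonal entries
    of the powers. *)
Lemma orth_proj_diag x :
  inner (orth_proj (ker_on (@l2 R X) T) (delta x)) (delta x) = (limn (diag x))%:C.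
Proof. by rewrite diagE; exact: (orth_proj_gmom TT' (l2_delta x)).2. Qed.

End Delta.

Section GroupMatrix.
Variables (R : realType) (G : groupType) (J : finType).
Local Notation C := R[i].
Local Notation gmat := (J -> J -> group_ring R G).
Implicit Types (B : gmat).

Definition labels B (a b : J) : seq G := finsupp (B a b).
Definition coef B (a b : J) (g : G) : C := B a b g.

Definition gop B (Y : choiceType) (e' : G -> Y -> Y) := blockop (labels B) (coef B) e'.
Definition gadj B (Y : choiceType) (e : G -> Y -> Y) :=
  blockop (tr_labels (labels B)) (tr_coef (coef B)) e.

Definition schur B (kappa : R) : Prop := [/\ 0 < kappa,
  forall a, \sum_b weight (labels B) (coef B) a b <= kappa
  & forall b, \sum_a weight (labels B) (coef B) a b <= kappa].

Lemma gop_adjoint B (Y : choiceType) (e e' : G -> Y -> Y) kappa :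
  schur B kappa -> (forall g, cancel (e' g) (e g)) -> (forall g, cancel (e g) (e' g)) ->
  adjoint_pair (gop B e') (gadj B e) (kappa ^+ 2).
Proof. by case=> k0 h1 h2 eK e'K; exact: blockop_adjoint. Qed.

Definition ggram B (K : R) (Y : choiceType) (e e' : G -> Y -> Y) :=
  gram (gop B e') (gadj B e) K.

Definition supp B : seq G :=
  flatten [seq labels B p.1 p.2 | p <- enum {: J * J}].

Lemma mem_supp B a b g : g \in labels B a b -> g \in supp B.
Proof.
move=> gab; apply/flattenP; exists (labels B a b) => //.
by apply/mapP; exists (a, b); rewrite ?mem_enum.
Qed.

Section Locality.
Variables (B : gmat) (Y : choiceType) (e e' : G -> Y -> Y).

Definition nbr (y : Y) : seq Y :=
  y :: [seq e g y | g <- supp B] ++ [seq e' g y | g <- supp B].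

(** A ball in the graph of the translations by the support, seen through the
    predicates that hold on it: inductions on [n] then peel off one step. *)
Definition ball n (P : Y -> Prop) : Y -> Prop :=
  iter n (fun (Q : Y -> Prop) y => forall z, z \in nbr y -> Q z) P.

Lemma ballS n P y : ball n.+1 P y = (forall z, z \in nbr y -> ball n P z).
Proof. by []. Qed.

Lemma nbr_refl y : y \in nbr y.
Proof. by rewrite mem_head. Qed.

Lemma nbr_e g y : g \in supp B -> e g y \in nbr y.
Proof. by move=> gB; rewrite inE mem_cat map_f ?orbT. Qed.

Lemma nbr_e' g y : g \in supp B -> e' g y \in nbr y.
Proof. by move=> gB; rewrite inE mem_cat (map_f (e' ^~ y)) ?orbT. Qed.

Lemma ball_mono n (P Q : Y -> Prop) y :
  (forall z, P z -> Q z) -> ball n P y -> ball n Q y.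
Proof.
move=> PQ; elim: n y => [|n IH] y; first exact: PQ.
by rewrite !ballS => h z /h/IH.
Qed.

Lemma ball_center n P y : ball n P y -> P y.
Proof. by elim: n y => // n IH y; rewrite ballS => /(_ y (nbr_refl y))/IH. Qed.

Lemma ball_center2 n P y z w : ball n.+2 P y -> z \in nbr y -> w \in nbr z -> P w.
Proof. by move=> h zy wz; apply: (@ball_center n); exact: h zy w wz. Qed.

Lemma gop_local f f' a y : (forall z, z \in nbr y -> forall b, f (b, z) = f' (b, z)) ->
  gop B e' f (a, y) = gop B e' f' (a, y).
Proof.
move=> h; apply: eq_bigr => b _; rewrite !big_seq; apply: eq_bigr => g gS /=.
by rewrite h// nbr_e'//; exact: mem_supp gS.
Qed.

Lemma gadj_local f f' a y : (forall z, z \in nbr y -> forall b, f (b, z) = f' (b, z)) ->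
  gadj B e f (a, y) = gadj B e f' (a, y).
Proof.
move=> h; apply: eq_bigr => b _; rewrite !big_seq; apply: eq_bigr => g gS /=.
by rewrite h// nbr_e//; exact: mem_supp gS.
Qed.

(** Each factor of the power looks two steps away, through [B] and its adjoint. *)
Lemma ggram_local K n f f' y : ball (n + n) (fun z => forall b, f (b, z) = f' (b, z)) y ->
  forall a, iter n (ggram B K e e') f (a, y) = iter n (ggram B K e e') f' (a, y).
Proof.
elim: n y => [//|n IH] y; rewrite addSn addnS => h a /=.
rewrite /ggram /gram.
have E z : z \in nbr y -> forall w, w \in nbr z -> forall b,
    iter n (ggram B K e e') f (b, w) = iter n (ggram B K e e') f' (b, w).
  by move=> zy w wz; apply: IH; exact: h zy w wz.
rewrite (E y (nbr_refl y) y (nbr_refl y)); congr (_ - _ * _).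
apply: gadj_local => z zy b; apply: gop_local; exact: E.
Qed.

Definition restr (A : set Y) (f : J * Y -> C) : J * Y -> C :=
  fun x => if x.2 \in A then f x else 0.

Definition rop A f := restr A (gop B e' (restr A f)).
Definition radj A f := restr A (gadj B e (restr A f)).

(** The cut-offs are the identity at all points that enter the computation. *)
Lemma rgram_local (A : set Y) K n f y : ball (n + n) A y -> forall a,
  iter n (gram (rop A) (radj A) K) f (a, y) = iter n (ggram B K e e') f (a, y).
Proof.
elim: n y => [//|n IH] y; rewrite addSn addnS => h a /=.
have inA z : z \in nbr y -> z \in A.
  by move=> zy; rewrite inE; exact: (ball_center2 h zy (nbr_refl z)).
have inA2 z w : z \in nbr y -> w \in nbr z -> w \in A.
  by move=> zy wz; rewrite inE; exact: (ball_center2 h zy wz).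
have E z : z \in nbr y -> forall w, w \in nbr z -> forall b,
    iter n (gram (rop A) (radj A) K) f (b, w) = iter n (ggram B K e e') f (b, w).
  by move=> zy w wz; apply: IH; exact: h zy w wz.
rewrite /ggram /gram (E y (nbr_refl y) y (nbr_refl y)); congr (_ - _ * _).
rewrite /radj {1}/restr /= (inA y (nbr_refl y)).
apply: gadj_local => z zy b; rewrite /restr /= (inA z zy) /rop /restr /= (inA z zy).
by apply: gop_local => w wz b'; rewrite /= (inA2 z w zy wz); exact: (E z zy w wz).
Qed.

End Locality.

Section Pullback.
Variables (B : gmat) (Y1 Y2 : choiceType).
Variables (e1 e1' : G -> Y1 -> Y1) (e2 e2' : G -> Y2 -> Y2) (io : Y1 -> Y2).
Hypotheses (ioe : forall g y, g \in supp B -> io (e1 g y) = e2 g (io y))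
  (ioe' : forall g y, g \in supp B -> io (e1' g y) = e2' g (io y)).

(** Functions are pulled back along a map that intertwines the two actions of the
    support; nothing is required on the remaining group elements. *)
Definition pb (f : J * Y2 -> C) : J * Y1 -> C := fun x => f (x.1, io x.2).

Lemma gop_pb f : gop B e1' (pb f) = pb (gop B e2' f).
Proof.
apply/funext => -[a y]; apply: eq_bigr => b _; rewrite !big_seq.
by apply: eq_bigr => g gS /=; rewrite /pb/= ioe'//; exact: mem_supp gS.
Qed.

Lemma gadj_pb f : gadj B e1 (pb f) = pb (gadj B e2 f).
Proof.
apply/funext => -[a y]; apply: eq_bigr => b _; rewrite !big_seq.
by apply: eq_bigr => g gS /=; rewrite /pb/= ioe//; exact: mem_supp gS.
Qed.

Lemma iter_ggram_pb K n f :
  iter n (ggram B K e1 e1') (pb f) = pb (iter n (ggram B K e2 e2') f).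
Proof.
elim: n => //= n ->; rewrite /ggram /gram gop_pb gadj_pb.
by apply/funext => -[].
Qed.

Lemma ball_pb n (P : Y2 -> Prop) y :
  ball B e1 e1' n (fun z => P (io z)) y -> ball B e2 e2' n P (io y).
Proof.
elim: n y => // n IH y; rewrite !ballS => h z.
rewrite inE mem_cat => /or3P[/eqP->|/mapP[g gS ->]|/mapP[g gS ->]].
- exact/IH/h/nbr_refl.
- by rewrite -ioe//; apply/IH/h/nbr_e.
- by rewrite -ioe'//; apply/IH/h/nbr_e'.
Qed.

End Pullback.

Section FiniteBall.
Variables (B : gmat) (Y : choiceType) (e e' : G -> Y -> Y).

(** Balls are finite, so a condition on a ball holds along a filter as soon as it
    does so at every point. *)
Lemma ball_list n y : exists F : seq Y, forall P : Y -> Prop,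
  (forall z, z \in F -> P z) -> ball B e e' n P y.
Proof.
elim: n y => [|n IH] y; first by exists [:: y] => P; apply; rewrite mem_head.
pose F z := sval (cid (IH z)).
exists (flatten [seq F z | z <- nbr B e e' y]) => P h.
rewrite ballS => z zy; apply: (svalP (cid (IH z))) => w wF.
by apply: h; apply/flatten_mapP; exists z.
Qed.

End FiniteBall.

End GroupMatrix.

(** * Change of group and moments *)

Section Homomorphisms.
Variables (G H : groupType) (p : {multiplicative G -> H}).

Lemma mhom1 : p 1%g = 1%g.
Proof. by apply: (mulgI (p 1%g)); rewrite -gmulfM !mulg1. Qed.

Lemma mhomV x : p x^-1%g = (p x)^-1%g.
Proof. by apply: (mulgI (p x)); rewrite -gmulfM !mulgV mhom1. Qed.

End Homomorphisms.

Section Regroup.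
Variables (R : realType) (G H : groupType) (P : pred G) (q : G -> H).
Local Notation C := R[i].

(** [push_ring] restricted to the group elements in [P]; the restriction occurs in
    compressions, where an element may leave the chosen subset. *)
Definition regroup (a : group_ring R G) : group_ring R H :=
  [fsfun h in [fset q g | g in finsupp a]%fset =>
     \sum_(g <- finsupp a | P g && (q g == h)) a g | 0].

Lemma regroupE (a : group_ring R G) h :
  regroup a h = \sum_(g <- finsupp a | P g && (q g == h)) a g.
Proof.
rewrite fsfunE; case: ifPn => // hN; rewrite big_seq_cond big1// => g /and3P[ga _ /eqP qg].
by move: hN; rewrite -qg in_imfset.
Qed.

Lemma sum_regroup_cond (V : nmodType) (a : group_ring R G) (F : G -> H -> V) :
  \sum_(h <- [fset q g | g in finsupp a]%fset)
     \sum_(g <- finsupp a | P g && (q g == h)) F g h =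
  \sum_(g <- finsupp a | P g) F g (q g).
Proof.
rewrite (exchange_big_dep P)/=; last by move=> h g _ /andP[].
rewrite big_seq_cond [RHS]big_seq_cond; apply: eq_bigr => g /andP[ga Pg].
under eq_bigl => h do rewrite Pg eq_sym /=.
rewrite big_mkcond (big_fsetD1 (q g))/=; last exact: in_imfset.
rewrite eqxx big_seq_cond big1 ?addr0// => h /andP[].
by rewrite !inE => /andP[/negbTE ->].
Qed.

Lemma finsupp_regroup (a : group_ring R G) :
  (finsupp (regroup a) `<=` [fset q g | g in finsupp a])%fset.
Proof.
apply/fsubsetP => h; rewrite mem_finsupp; apply: contraNT => hN.
by rewrite fsfunE (negbTE hN).
Qed.

Lemma sum_regroup (V : zmodType) (a : group_ring R G) (F : C -> H -> V) :
  (forall h, F 0 h = 0) -> (forall z w h, F (z + w) h = F z h + F w h) ->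
  \sum_(h <- finsupp (regroup a)) F (regroup a h) h =
  \sum_(g <- finsupp a | P g) F (a g) (q g).
Proof.
move=> F0 FD; rewrite (big_fset_incl _ (finsupp_regroup a)) /=; last first.
  by move=> h _; rewrite memNfinsupp => /eqP ->.
rewrite -(sum_regroup_cond a (fun g h => F (a g) h)); apply: eq_bigr => h _.
by rewrite regroupE (big_morph (fun z => F z h) (fun z w => FD z w h) (F0 h)).
Qed.

Lemma weight_regroup (a : group_ring R G) :
  \sum_(h <- finsupp (regroup a)) normc (regroup a h) <=
  \sum_(g <- finsupp a | P g) normc (a g).
Proof.
rewrite (big_fset_incl _ (finsupp_regroup a)) /=; last first.
  by move=> h _; rewrite memNfinsupp => /eqP ->; rewrite Normc.normc0.
rewrite -(sum_regroup_cond a (fun g _ => normc (a g))); apply: ler_sum => h _.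
rewrite regroupE; elim/big_rec2 : _ => [|g x y _ xy]; first by rewrite Normc.normc0.
by rewrite (le_trans (normc_leD _ _))// lerD2l.
Qed.

End Regroup.

Section Push.
Variables (R : realType) (G H : groupType) (J : finType) (q : G -> H).
Local Notation C := R[i].
Implicit Types (B : J -> J -> group_ring R G).

Lemma push_ringE (a : group_ring R G) : push_ring q a = regroup xpredT q a.
Proof. by []. Qed.

Definition gpush B : J -> J -> group_ring R H := fun a b => push_ring q (B a b).

Lemma gop_push B (Y : choiceType) (e' : H -> Y -> Y) :
  gop (gpush B) e' = gop B (fun g => e' (q g)).
Proof.
apply/funext => f; apply/funext => x; apply: eq_bigr => b _.
rewrite /labels /coef /gpush push_ringE.
by apply: (@sum_regroup R G H xpredT q _ _ (fun z h => z * f (b, e' h x.2))) => [h|z w h];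
  rewrite ?mul0r ?mulrDl.
Qed.

Lemma gadj_push B (Y : choiceType) (e : H -> Y -> Y) :
  gadj (gpush B) e = gadj B (fun g => e (q g)).
Proof.
apply/funext => f; apply/funext => x; apply: eq_bigr => b _.
rewrite /tr_labels /tr_coef /labels /coef /gpush push_ringE.
by apply: (@sum_regroup R G H xpredT q _ _ (fun z h => cj z * f (b, e h x.2))) => [h|z w h];
  rewrite ?rmorph0 ?mul0r// cjD mulrDl.
Qed.

Lemma schur_push B kappa : schur B kappa -> schur (gpush B) kappa.
Proof.
move=> [k0 h1 h2]; split=> // a.
  by apply: le_trans (h1 a); apply: ler_sum => b _; exact: (@weight_regroup R G H xpredT q).
by apply: le_trans (h2 a); apply: ler_sum => b _; exact: (@weight_regroup R G H xpredT q).
Qed.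

End Push.

Section Moments.
Variables (R : realType).
Local Notation C := R[i].

Definition ltr (G H : groupType) (q : G -> H) (g : G) (h : H) : H := (q g * h)%g.
Definition ltrV (G H : groupType) (q : G -> H) (g : G) (h : H) : H := ((q g)^-1 * h)%g.

Lemma ltrK (G H : groupType) (q : G -> H) g : cancel (ltr q g) (ltrV q g).
Proof. by move=> h; rewrite /ltr /ltrV mulgA mulVg mul1g. Qed.

Lemma ltrVK (G H : groupType) (q : G -> H) g : cancel (ltrV q g) (ltr q g).
Proof. by move=> h; rewrite /ltr /ltrV mulgA mulgV mul1g. Qed.

(** The trace of the [n]-th power when [G] acts on [H] through [q]. The map [q] is
    arbitrary, since a lift to a stage of a direct system is no homomorphism. *)
Definition trmom (G H : groupType) (J : finType) (B : J -> J -> group_ring R G)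
    (q : G -> H) K n : R :=
  \sum_(j : J) complex.Re
    (iter n (ggram B K (ltr q) (ltrV q)) (delta R (j, 1%g)) (j, 1%g)).

Definition mom (G : groupType) (J : finType) (B : J -> J -> group_ring R G) :=
  trmom B id.

Lemma mom_push (G H : groupType) (J : finType) (B : J -> J -> group_ring R G)
  (q : G -> H) : mom (gpush q B) = trmom B q.
Proof. by rewrite /mom /trmom /ggram gop_push gadj_push. Qed.

(** The powers on [H2] are computed on [H1] after pulling the unit vector back
    along [p], which turns it into the indicator of the kernel of [p]. *)
Lemma trmom_transfer (G H1 H2 : groupType) (J : finType)
    (B : J -> J -> group_ring R G) (q1 : G -> H1) (q2 : G -> H2)
    (p : {multiplicative H1 -> H2}) K n :
  (forall g, g \in supp B -> p (q1 g) = q2 g) ->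
  ball B (ltr q1) (ltrV q1) (n + n) (fun z => p z = 1%g -> z = 1%g) 1%g ->
  trmom B q2 K n = trmom B q1 K n.
Proof.
move=> pq bl; apply: eq_bigr => j _; congr (complex.Re _).
transitivity (iter n (ggram B K (ltr q1) (ltrV q1))
    (pb p (delta R (j, 1%g))) (j, 1%g)).
  rewrite (iter_ggram_pb (e2 := ltr q2) (e2' := ltrV q2)); first by rewrite /pb/= mhom1.
    by move=> g y gB; rewrite /ltr gmulfM pq.
  by move=> g y gB; rewrite /ltrV gmulfM mhomV pq.
apply: ggram_local; apply: ball_mono bl => z pz b.
rewrite /pb /delta /= !xpair_eqE; congr ((_ && _)%:R).
by apply/eqP/eqP => [/pz//|->]; rewrite mhom1.
Qed.

(** An injective homomorphism has trivial kernel on every ball. *)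
Lemma trmom_transfer_inj (G H1 H2 : groupType) (J : finType)
    (B : J -> J -> group_ring R G) (q1 : G -> H1) (q2 : G -> H2)
    (p : {multiplicative H1 -> H2}) K n :
  (forall g, g \in supp B -> p (q1 g) = q2 g) -> injective p ->
  trmom B q2 K n = trmom B q1 K n.
Proof.
move=> pq pI; apply: (@trmom_transfer _ _ _ _ B q1 q2 p K n pq).
have key z : p z = 1%g -> z = 1%g by move=> pz; apply: pI; rewrite pz mhom1.
have [F] := ball_list B (ltr q1) (ltrV q1) (n + n) 1%g; apply=> z _; exact: key.
Qed.

Section Dimension.
Variables (G : groupType) (J : finType) (B : J -> J -> group_ring R G).
Variables (kappa : R) (Bk : schur B kappa).

Let ap : adjoint_pair (gop B (ltrV id)) (gadj B (ltr id)) (kappa ^+ 2).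
Proof. by apply: gop_adjoint Bk _ _; [exact: ltrVK|exact: ltrK]. Qed.

Lemma mom_noninc : {homo mom B (kappa ^+ 2) : n m / (n <= m)%N >-> m <= n}.
Proof. by move=> n m nm; apply: ler_sum => j _; exact: (diag_noninc ap _ nm). Qed.

(** Sum of the limits in [orth_proj_diag] over the coordinates. *)
Lemma mom_vndim : exists k : R,
  (mom B (kappa ^+ 2) n @[n --> \oo] --> k) /\
  vndim (ker_on (@l2 R _) (gop B (ltrV id))) = k%:C.
Proof.
exists (\sum_(j : J) limn (diag (gop B (ltrV id)) (gadj B (ltr id)) (kappa ^+ 2) (j, 1%g))).
split.
  apply: cvg_big => [|j _]; first exact: add_continuous.
  exact: (diag_cvg ap).
rewrite /vndim /vntrace rmorph_sum/=; apply: eq_bigr => j _.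
exact: (orth_proj_diag ap).
Qed.

End Dimension.

End Moments.

(** * Logarithmic sums of moments *)

Section LogSums.
Variables (R : realType).

(** Up to sign, a partial sum of the integral of [ln (1 - x)] for a measure on the
    unit interval with moments [m], without its atom at one, whose mass is
    approximated by [m M]. *)
Definition logsum (m : nat -> R) (N M : nat) : R :=
  \sum_(l < N) (m l.+1 - m M) / l.+1%:R.

Lemma logsum_ge0 (m : nat -> R) N M : (N <= M)%N ->
  {homo m : n m / (n <= m)%N >-> m <= n} -> 0 <= logsum m N M.
Proof.
move=> NM dec; apply: sumr_ge0 => l _; rewrite mulr_ge0 ?invr_ge0 ?ler0n//.
by rewrite subr_ge0 dec// (leq_trans (ltn_ord l)).
Qed.

Lemma harmonic_large (A : R) : exists N, A <= \sum_(l < N) l.+1%:R^-1.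
Proof.
have nd : nondecreasing_seq (series (@harmonic R)).
  by apply: nondecreasing_series => n _ _; rewrite invr_ge0 ler0n.
have /cvgryPge/(_ A)[n _ /(_ n (leqnn n))] := nondecreasing_dvgn_lt nd (@dvg_harmonic R).
by rewrite /series/= big_mkord => h; exists n.
Qed.

Variables (I : Type) (F : set_system I) (FF : ProperFilter F).

Lemma logsum_limit (nn : nat) (m_ : I -> 'I_nn -> nat -> R) (m : 'I_nn -> nat -> R) (C : R) N M :
  (forall s n, m_ i s n @[i --> F] --> m s n) ->
  (\forall i \near F, \sum_s logsum (m_ i s) N M <= C) ->
  \sum_s logsum (m s) N M <= C.
Proof.
move=> cm; apply: cvgr_to_le.
apply: cvg_big => [|s _]; first exact: add_continuous.
apply: cvg_big => [|l _]; first exact: add_continuous.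
by apply: cvgMr_tmp; apply: cvgB.
Qed.

(** Convergence of each moment gives convergence of the limits once the logarithmic
    sums are bounded. In such a bound all terms up to the [N]-th are at least
    [m N - k], so [m N - k] is at most the bound divided by a harmonic number,
    uniformly in the index [i]. *)
Lemma moments_to_limits (m_ : I -> nat -> R) (m : nat -> R) (k_ : I -> R) (k C : R) :
  (forall i, {homo m_ i : n m / (n <= m)%N >-> m <= n}) ->
  (forall i, m_ i n @[n --> \oo] --> k_ i) ->
  m n @[n --> \oo] --> k ->
  (forall n, m_ i n @[i --> F] --> m n) ->
  (\forall i \near F, forall N M, (N <= M)%N -> logsum (m_ i) N M <= C) ->
  k_ i @[i --> F] --> k.
Proof.
move=> dec ck_ ck cm bd; apply/cvgrPdist_le => e e0.
have e3 : 0 < e / 3 by rewrite divr_gt0.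
(* N0 makes the common bound divided by the N0-th harmonic number less than e / 3. *)
have [N0 hN0] := harmonic_large (`|C| / (e / 3) + 1).
have /cvgrPdist_le/(_ _ e3)[N1 _ hN1] := ck.
pose N := maxn N0 N1; have hN : `|k - m N| <= e / 3 by apply: hN1; rewrite /= leq_maxr.
have /cvgrPdist_le/(_ _ e3) cmN := cm N.
near=> i.
have h1 : `|m N - m_ i N| <= e / 3 by near: i.
have bdi : forall N M, (N <= M)%N -> logsum (m_ i) N M <= C by near: i.
have kle n : k_ i <= m_ i n.
  apply: (cvgr_to_le (ck_ i)); exists n => // n' /= nn'; exact: dec.
have h2 : \sum_(l < N) (m_ i l.+1 - k_ i) / l.+1%:R <= C.
  have c : logsum (m_ i) N M @[M --> \oo] --> \sum_(l < N) (m_ i l.+1 - k_ i) / l.+1%:R.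
    apply: cvg_big => [|l _]; first exact: add_continuous.
    by apply: cvgMr_tmp; apply: cvgB; [exact: cvg_cst|exact: ck_].
  by apply: (cvgr_to_le c); exists N => // M /= NM; exact: bdi.
have h3 : (m_ i N - k_ i) * \sum_(l < N) l.+1%:R^-1 <= C.
  apply: le_trans h2; rewrite mulr_sumr; apply: ler_sum => l _.
  by rewrite ler_wpM2r ?invr_ge0 ?ler0n// lerB// dec// ltn_ord.
have h4 : `|C| / (e / 3) + 1 <= \sum_(l < N) l.+1%:R^-1.
  apply: (le_trans hN0); move: (leq_maxl N0 N1); rewrite -/N => /subnKC <-.
  by rewrite big_split_ord lerDl sumr_ge0// => l _; rewrite invr_ge0 ler0n.
have h5 : m_ i N - k_ i <= e / 3.
  rewrite leNgt; apply/negP => dlt.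
  have S0 : 0 < \sum_(l < N) l.+1%:R^-1 :> R.
    by apply: lt_le_trans h4; rewrite ltr_wpDl// divr_ge0// ltW.
  have h6 : (e / 3) * (\sum_(l < N) l.+1%:R^-1) < C.
    by apply: lt_le_trans h3; rewrite ltr_pM2r.
  have h7 : (e / 3) * (`|C| / (e / 3) + 1) <= (e / 3) * (\sum_(l < N) l.+1%:R^-1).
    by rewrite ler_pM2l.
  have h8 : (e / 3) * (`|C| / (e / 3) + 1) = `|C| + e / 3 by field; rewrite gt_eqF.
  have := ler_norm C; lra.
have h9 := kle N.
move: h1 hN; rewrite !ler_norml => /andP[? ?] /andP[? ?]; lra.
Unshelve. all: by end_near.
Qed.

End LogSums.

(** * Moments along direct and inverse systems *)

Section Tails.
Variables (disp : Order.disp_t) (I : porderType disp) (dirI : directed I).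

Lemma tails_proper : ProperFilter (tails I).
Proof.
have [[i0 _] dI] := dirI; apply: filter_from_proper.
  apply: filter_fromT_filter => [|i j]; first by exists i0.
  have [k [ik jk]] := dI i j; exists k => l /= kl.
  by split; apply: le_trans kl; exact: ltW.
by move=> i _; exists i => /=.
Qed.

Lemma near_tails_gt i0 : \forall i \near tails I, (i0 < i)%O.
Proof.
have [_ dI] := dirI; have [k [ik _]] := dI i0 i0.
by exists k => // i /= ki; exact: lt_le_trans ki.
Qed.

End Tails.

Section NearList.
Variables (I : Type) (F : set_system I) (FF : Filter F) (T : eqType).

Lemma near_list (s : seq T) (P : T -> I -> Prop) :
  (forall x, x \in s -> \forall i \near F, P x i) ->
  \forall i \near F, forall x, x \in s -> P x i.
Proof.
elim: s => [|x s IH] h; first by apply: nearW => i y.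
have h1 := h x (mem_head x s).
have h2 := IH (fun y ys => h y (mem_behead (s := x :: s) ys)).
near=> i => y; rewrite inE => /orP[/eqP->|ys]; first by near: i.
by move: y ys; near: i.
Unshelve. all: by end_near.
Qed.

End NearList.

Section LimitMoments.
Variables (R : realType) (disp : Order.disp_t) (I : porderType disp).
Variables (G : groupType) (J : finType) (B : J -> J -> group_ring R G) (K : R) (n : nat).

(** Finitely many nontrivial elements stay nontrivial at late stages. *)
Lemma inverse_limit_moments (D : inverse_system I)
    (p : forall i, {multiplicative G -> D i}) : is_inverse_limit p ->
  \forall i \near tails I, trmom B (p i) K n = mom B K n.
Proof.
move=> [pc pu]; have PF := tails_proper (inv_directed D).
have [F hF] := ball_list B (ltr id) (ltrV id) (n + n) (1%g : G).
have : \forall i \near tails I, forall z, z \in F -> p i z = 1%g -> z = 1%g.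
  apply: near_list => z _; have [->|z1] := eqVneq z 1%g; first exact: nearW.
  have [i0 pz] : exists i, p i z <> 1%g.
    apply/existsNP => pz; move/eqP: z1; apply.
    have [i j ij|g [_ gu]] := pu (fun=> 1%g); first exact: mhom1.
    by rewrite -(gu z)// -(gu 1%g)// => i; exact: mhom1.
  exists i0 => // i /=; rewrite le_eqVlt => /orP[/eqP<-//|i0i] piz.
  by case: pz; rewrite -(pc _ _ i0i) piz mhom1.
apply: filterS => i h; apply: trmom_transfer => //.
exact/hF.
Qed.

(** Finitely many relations of [G] hold at late stages. *)
Lemma direct_limit_moments (D : direct_system I)
    (p : forall i, {multiplicative D i -> G}) (j0 : I) (lift : G -> D j0) :
  is_direct_limit p -> (forall g, g \in supp B -> p j0 (lift g) = g) ->
  \forall i \near tails I, forall j0i : (j0 < i)%O,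
    mom B K n = trmom B (dir_map D j0i \o lift) K n.
Proof.
move=> [pc _ pe] pl; have PF := tails_proper (dir_directed D).
have [F hF] := ball_list B (ltr lift) (ltrV lift) (n + n) 1%g.
have : \forall i \near tails I, forall z, z \in F -> forall j0i : (j0 < i)%O,
    p i (dir_map D j0i z) = 1%g -> dir_map D j0i z = 1%g.
  apply: near_list => z _; have [pz|pz] := EM (p j0 z = 1%g); last first.
    by apply: nearW => i j0i; rewrite pc.
  have [|k [ik [jk E]]] := pe j0 j0 z 1%g; first by rewrite pz mhom1.
  rewrite mhom1 in E; exists k => // i /=; rewrite le_eqVlt => /orP[/eqP ki|ki] j0i _.
    by case: i / ki j0i => j0k; rewrite (bool_irrelevance j0k ik).
  by rewrite -(dir_comp ik ki j0i) E mhom1.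
apply: filterS => i h j0i; apply: (trmom_transfer (p := p i)).
  by move=> g gB /=; rewrite pc pl.
have -> : 1%g = dir_map D j0i 1%g by rewrite mhom1.
apply: (@ball_pb _ _ _ B _ _ (ltr lift) (ltrV lift)).
- by move=> g y _; rewrite /ltr gmulfM.
- by move=> g y _; rewrite /ltrV gmulfM mhomV.
- by apply: hF => z zF; rewrite (mhom1 (dir_map D j0i)); exact: h.
Qed.

End LimitMoments.

Section DirectLift.
Variables (disp : Order.disp_t) (I : porderType disp) (G : groupType).
Variables (D : direct_system I) (p : forall i, {multiplicative D i -> G}).

(** Finitely many elements come from a common stage. *)
Lemma direct_lift (s : seq G) : is_direct_limit p ->
  exists j0 (lift : G -> D j0), forall g, g \in s -> p j0 (lift g) = g.
Proof.
move=> [pc ps _]; have [[i0 _] dI] := dir_directed D.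
have [j0 hj] : exists j0, forall g, g \in s -> exists x, p j0 x = g.
  elim: s => [|g s [j hj]]; first by exists i0.
  have [i [x xg]] := ps g; have [k [ik jk]] := dI i j.
  exists k => h; rewrite inE => /orP[/eqP->|/hj[y <-]].
    by exists (dir_map D ik x); rewrite pc.
  by exists (dir_map D jk y); rewrite pc.
exists j0, (fun g => xget 1%g [set x | p j0 x = g]) => g gs.
by case: xgetP => [x _ //|h]; have [x /h] := hj g gs.
Qed.

End DirectLift.

(** * The determinant bound and its permanence under subgroups and limits *)

Section DetBound.
Variables (R : realType).
Local Notation C := R[i].
Variables (nn : nat) (theta : 'I_nn -> C) (dn : nat).

(** The values of one element of [dn^-1 Z[X]] at the conjugates [theta s]. *)
Definition conj_family (x : 'I_nn -> C) : Prop :=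
  exists P : {poly int}, forall s, dn%:R * x s = (map_poly intr P).[theta s].

Lemma conj_family_sum (T : Type) (r : seq T) (P : pred T) (x : T -> 'I_nn -> C) :
  (forall t, conj_family (x t)) -> conj_family (fun s => \sum_(t <- r | P t) x t s).
Proof.
move=> cx; elim: r => [|t r [Q hQ]].
  by exists 0 => s; rewrite big_nil mulr0 rmorph0 horner0.
have [Q' hQ'] := cx t.
have [Pt|Pt] := boolP (P t).
  by exists (Q' + Q) => s; rewrite big_cons Pt mulrDr hQ hQ' rmorphD hornerD.
by exists Q => s; rewrite big_cons (negbTE Pt) hQ.
Qed.

Definition conj_mx (G : groupType) (J : finType)
    (B : 'I_nn -> J -> J -> group_ring R G) : Prop :=
  forall a b g, conj_family (fun s => B s a b g).

(** The support may depend on the conjugate, but a common one exists. *)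
Lemma conj_regroup (G H : groupType) (P : pred G) (q : G -> H)
    (x : 'I_nn -> group_ring R G) :
  (forall g, conj_family (x^~ g)) -> forall h, conj_family (fun s => regroup P q (x s) h).
Proof.
move=> cx h.
pose A := [fset g in flatten [seq (finsupp (x s) : seq G) | s <- enum 'I_nn]]%fset.
have E s : regroup P q (x s) h = \sum_(g <- A | P g && (q g == h)) x s g.
  rewrite regroupE big_mkcond [RHS]big_mkcond; apply: big_fset_incl.
    apply/fsubsetP => g gs; rewrite inE /=; apply/flatten_mapP; exists s => //.
    by rewrite mem_enum.
  move=> g _; rewrite memNfinsupp => /eqP ->; by case: ifP.
have [Q hQ] := @conj_family_sum _ A (fun g => P g && (q g == h)) (fun g s => x s g) cx.
by exists Q => s; rewrite E.
Qed.

Lemma conj_push (G H : groupType) (J : finType) (q : G -> H)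
    (B : 'I_nn -> J -> J -> group_ring R G) :
  conj_mx B -> conj_mx (fun s => gpush q (B s)).
Proof. by move=> cB a b h; apply: (@conj_regroup _ _ xpredT q (fun s => B s a b)). Qed.

Definition logbound (kappa : R) : R := ln (kappa ^+ 2) + 2 * ln dn%:R.

(** A lower bound for the product over the conjugates of the Fuglede-Kadison
    determinants, in terms of moments only, so that it passes to limits. *)
Definition detbound (G : groupType) : Prop :=
  forall (J : finType) (B : 'I_nn -> J -> J -> group_ring R G) kappa,
  conj_mx B -> (forall s, schur (B s) kappa) -> 1 <= kappa ->
  forall N M, (N <= M)%N ->
  \sum_s logsum (mom (B s) (kappa ^+ 2)) N M <= (nn * #|J|)%:R * logbound kappa.

(** A matrix over a subgroup has the same moments over the whole group. *)
Lemma detbound_sub (H G : groupType) (f : {multiplicative H -> G}) :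
  injective f -> detbound G -> detbound H.
Proof.
move=> fI dG J B kappa cB sB k1 N M NM.
have := dG J (fun s => gpush f (B s)) kappa (conj_push f cB)
  (fun s => schur_push f (sB s)) k1 N M NM.
congr (_ <= _); apply: eq_bigr => s _; congr (logsum _ N M).
apply/funext => n; rewrite mom_push.
by apply: (trmom_transfer_inj (p := f)).
Qed.

Lemma near_eq_cvg (I : Type) (F : set_system I) (FF : Filter F) (u : I -> R) (l : R) :
  (\forall i \near F, u i = l) -> u i @[i --> F] --> l.
Proof.
by move=> h; apply/cvgrPdist_le => e e0; apply: filterS h => i ->; rewrite subrr normr0 ltW.
Qed.

Lemma detbound_inverse (disp : Order.disp_t) (I : porderType disp)
    (D : inverse_system I) (G : groupType) (p : forall i, {multiplicative G -> D i}) :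
  (forall i, detbound (D i)) -> is_inverse_limit p -> detbound G.
Proof.
move=> dD lp J B kappa cB sB k1 N M NM.
have PF := tails_proper (inv_directed D).
apply: (logsum_limit PF (m_ := fun i s => trmom (B s) (p i) (kappa ^+ 2))).
  by move=> s n; apply: near_eq_cvg; exact: inverse_limit_moments.
apply: nearW => i.
have := dD i J (fun s => gpush (p i) (B s)) kappa (conj_push _ cB)
  (fun s => schur_push _ (sB s)) k1 N M NM.
by under eq_bigr do rewrite mom_push.
Qed.

Lemma detbound_direct (disp : Order.disp_t) (I : porderType disp)
    (D : direct_system I) (G : groupType) (p : forall i, {multiplicative D i -> G}) :
  (forall i, detbound (D i)) -> is_direct_limit p -> detbound G.
Proof.
move=> dD lp J B kappa cB sB k1 N M NM.
have PF := tails_proper (dir_directed D).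
have [j0 [lift hl]] := direct_lift (flatten [seq supp (B s) | s <- enum 'I_nn]) lp.
have hl' s g : g \in supp (B s) -> p j0 (lift g) = g.
  by move=> gs; apply: hl; apply/flatten_mapP; exists s; rewrite ?mem_enum.
pose m_ i s n := if @idP (j0 < i)%O is ReflectT j0i
  then trmom (B s) (dir_map D j0i \o lift) (kappa ^+ 2) n else 0.
apply: (logsum_limit PF (m_ := m_)).
  move=> s n; apply: near_eq_cvg.
  have h1 := direct_limit_moments (kappa ^+ 2) n lp (hl' s).
  have h2 := near_tails_gt (dir_directed D) j0.
  near=> i; have j0i : (j0 < i)%O by near: i.
  rewrite /m_; case: {-}_ / idP => // j0i'.
  by symmetry; move: j0i'; near: i.
have h2 := near_tails_gt (dir_directed D) j0.
near=> i; have j0i : (j0 < i)%O by near: i.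
have := dD i J (fun s => gpush (dir_map D j0i \o lift) (B s)) kappa (conj_push _ cB)
  (fun s => schur_push _ (sB s)) k1 N M NM.
under eq_bigr do rewrite mom_push.
congr (_ <= _); apply: eq_bigr => s _; congr (logsum _ N M); apply/funext => n.
by rewrite /m_; case: {-}_ / idP => // j0i'; rewrite (bool_irrelevance j0i' j0i).
Unshelve. all: by end_near.
Qed.

End DetBound.

(** * Pseudo-determinants and minors *)

Section PseudoDeterminant.
Variable C : numClosedFieldType.

Definition adjm m n (A : 'M[C]_(m, n)) : 'M[C]_(n, m) := map_mx Num.conj A^T.

Lemma adjmM m n k (A : 'M[C]_(m, n)) (B : 'M[C]_(n, k)) : adjm (A *m B) = adjm B *m adjm A.
Proof. by rewrite /adjm trmx_mul map_mxM. Qed.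

Lemma adjmK m n (A : 'M[C]_(m, n)) : adjm (adjm A) = A.
Proof. by apply/matrixP => i j; rewrite !mxE conjCK. Qed.

Lemma det_adjm n (A : 'M[C]_n) : \det (adjm A) = Num.conj (\det A).
Proof. by rewrite /adjm det_map_mx det_tr. Qed.

Lemma gram_diagE m n (A : 'M[C]_(m, n)) j : (adjm A *m A) j j = \sum_i `|A i j| ^+ 2.
Proof. by rewrite mxE; apply: eq_bigr => i _; rewrite !mxE mulrC -normCK. Qed.

(** Right singular vectors: the spectral theorem for [adjm A *m A]. *)
Lemma spectral_gram m n (A : 'M[C]_(m, n)) : exists (W : 'M[C]_n) (l : 'rV[C]_n),
  [/\ adjm W *m W = 1%:M, W *m adjm W = 1%:M
    & adjm (A *m W) *m (A *m W) = diag_mx l].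
Proof.
pose S := adjm A *m A; have SS : adjm S = S by rewrite /S adjmM adjmK.
have /orthomx_spectralP E : S \is normalmx.
  by apply/normalmxP; rewrite -/(adjm S) SS.
have uU := spectral_unitarymx S; set U := spectralmx S in E uU; set D := spectral_diag S in E.
have U1 : U *m adjm U = 1%:M by apply/unitarymxP.
have U2 : adjm U *m U = 1%:M by exact: mulmx1C.
exists (adjm U), D; split; rewrite ?adjmK//.
rewrite adjmM adjmK mulmxA -[_ *m adjm A *m A]mulmxA -/S E.
by rewrite (invmx_unitary uU) -!mulmxA U1 mulmx1 mulmxA U1 mul1mx.
Qed.

Lemma norm_det_unitary n (W : 'M[C]_n) : adjm W *m W = 1%:M -> `|\det W| ^+ 2 = 1.
Proof. by move=> /(congr1 determinant); rewrite det_mulmx det_adjm det1 mulrC -normCK. Qed.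

Lemma sum_inj_le d r (f : 'I_r -> 'I_d) (F : 'I_d -> C) : injective f ->
  (forall j, 0 <= F j) -> \sum_i F (f i) <= \sum_j F j.
Proof.
move=> fI F0; have -> : \sum_i F (f i) = \sum_(j in codom f) F j.
  by rewrite -big_uniq ?big_image//= map_inj_uniq ?enum_uniq.
by rewrite [leRHS](bigID (mem (codom f)))/= lerDl sumr_ge0.
Qed.

(** Some rows of an isometry form a contraction, and the eigenvalues of the Gram
    matrix of a contraction lie in the unit interval. *)
Lemma det_rowsub_isometry d r (V : 'M[C]_(d, r)) (f : 'I_r -> 'I_d) :
  injective f -> adjm V *m V = 1%:M -> `|\det (rowsub f V)| <= 1.
Proof.
move=> fI V1; have [W [l [W1 W2 ZW]]] := spectral_gram (rowsub f V).
have lE j : l 0 j = \sum_i `|(V *m W) (f i) j| ^+ 2.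
  have /matrixP/(_ j j) := ZW; rewrite gram_diagE !mxE eqxx mulr1n => <-.
  by apply: eq_bigr => i _; rewrite mul_rowsub_mx mxE.
have l0 j : 0 <= l 0 j by rewrite lE sumr_ge0// => i _; rewrite exprn_ge0.
have l1 j : l 0 j <= 1.
  have -> : 1 = \sum_i `|(V *m W) i j| ^+ 2.
    rewrite -gram_diagE adjmM mulmxA -[_ *m _ *m V]mulmxA V1 mulmx1 W1.
    by rewrite mxE eqxx.
  rewrite lE; apply: (@sum_inj_le _ _ f (fun i => `|(V *m W) i j| ^+ 2)) => // i; rewrite exprn_ge0.
have E : `|\det (rowsub f V)| ^+ 2 = \prod_j l 0 j.
  rewrite -det_diag -ZW det_mulmx det_adjm mulrC -normCK det_mulmx normrM exprMn.
  by rewrite (norm_det_unitary W1) mulr1.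
rewrite -(expr_le1 (n := 2))// E.
by apply: prodr_ile1 => j _; rewrite l0 l1.
Qed.

(** The columns of [M *m W] for zero singular values vanish. *)
Lemma gram_factor d k (M : 'M[C]_d) (W : 'M[C]_d) (l : 'rV[C]_d) (h : 'I_k -> 'I_d) :
  W *m adjm W = 1%:M -> adjm (M *m W) *m (M *m W) = diag_mx l ->
  injective h -> (forall j, l 0 j != 0 -> j \in codom h) ->
  M = colsub h (M *m W) *m adjm (colsub h W).
Proof.
move=> W2 MW hI hl; set X := M *m W.
have {1}-> : M = X *m adjm W by rewrite /X -mulmxA W2 mulmx1.
apply/matrixP => i j; rewrite !mxE.
have X0 m : m \notin codom h -> X i m = 0.
  move=> mh; have l0 : l 0 m = 0 by apply/eqP; apply: contraNT mh; exact: hl.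
  have : \sum_i' `|X i' m| ^+ 2 = 0 by rewrite -gram_diagE MW !mxE eqxx l0.
  move/eqP; rewrite psumr_eq0 => [/allP/(_ i)|i' _]; last by rewrite exprn_ge0.
  by rewrite mem_index_enum => /(_ isT); rewrite implyTb sqrf_eq0 normr_eq0 => /eqP.
rewrite (bigID (mem (codom h)))/= [X in _ + X]big1 ?addr0; last first.
  by move=> m mh; rewrite X0// mul0r.
have uh : uniq (codom h) by rewrite map_inj_uniq ?enum_uniq.
rewrite -(big_uniq _ uh) big_image/=.
by apply: eq_bigr => m _; rewrite !mxE.
Qed.

Lemma mxsub_diag d k (D : 'rV[C]_d) (h : 'I_k -> 'I_d) : injective h ->
  mxsub h h (diag_mx D) = diag_mx (\row_i D 0 (h i)).
Proof. by move=> hI; apply/matrixP => i j; rewrite !mxE (inj_eq hI). Qed.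

Lemma mxsub_gram d n k (X : 'M[C]_(d, n)) (h : 'I_k -> 'I_n) :
  adjm (colsub h X) *m colsub h X = mxsub h h (adjm X *m X).
Proof. by apply/matrixP => i j; rewrite !mxE; apply: eq_bigr => m _; rewrite !mxE. Qed.

(** A minor of size the number [k] of nonzero singular values factors through
    the corresponding singular vectors; the two outer factors are square parts
    of isometries. *)
Lemma minor_le_pseudo_det d k (M : 'M[C]_d) (W : 'M[C]_d) (l : 'rV[C]_d)
    (f g : 'I_k -> 'I_d) (h : 'I_k -> 'I_d) :
  adjm W *m W = 1%:M -> W *m adjm W = 1%:M ->
  adjm (M *m W) *m (M *m W) = diag_mx l ->
  injective f -> injective g -> injective h ->
  (forall i, 0 < l 0 (h i)) -> (forall j, l 0 j != 0 -> j \in codom h) ->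
  `|\det (mxsub f g M)| ^+ 2 <= \prod_i l 0 (h i).
Proof.
move=> W1 W2 MW fI gI hI lh hl.
pose s := \row_i sqrtC (l 0 (h i)); pose s' := \row_i (sqrtC (l 0 (h i)))^-1.
have s0 i : sqrtC (l 0 (h i)) != 0 by rewrite sqrtC_eq0 gt_eqF.
set X := colsub h (M *m W); pose V := X *m diag_mx s'.
have XV : X = V *m diag_mx s.
  rewrite /V -mulmxA mulmx_diag (_ : diag_mx _ = 1%:M) ?mulmx1//.
  by apply/matrixP => i j; rewrite !mxE; congr (_ *+ _); exact: mulVf.
have V1 : adjm V *m V = 1%:M.
  rewrite /V adjmM mulmxA -[_ *m adjm X *m X]mulmxA mxsub_gram MW mxsub_diag//.
  rewrite /adjm tr_diag_mx map_diag_mx !mulmx_diag.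
  apply/matrixP => i j; rewrite !mxE; congr (_ *+ _).
  have cE : Num.conj (sqrtC (l 0 (h i)))^-1 = (sqrtC (l 0 (h i)))^-1.
    by rewrite conj_Creal// rpredV ger0_real// sqrtC_ge0 ltW.
  rewrite /= cE -[X in _ * X * _]sqrtCK expr2 mulrA mulVf// mul1r mulfV//.
have Y1 : adjm (colsub h W) *m colsub h W = 1%:M.
  by rewrite mxsub_gram W1; apply/matrixP => i j; rewrite !mxE (inj_eq hI).
have E : mxsub f g M = rowsub f V *m diag_mx s *m adjm (rowsub g (colsub h W)).
  rewrite (gram_factor W2 MW hI hl) -/X mxsub_mul {1}XV -mul_rowsub_mx; congr (_ *m _).
  by apply/matrixP => i j; rewrite !mxE.
rewrite E !det_mulmx !normrM det_diag det_adjm norm_conjC.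
have h1 := det_rowsub_isometry fI V1; have h2 := det_rowsub_isometry gI Y1.
have -> : \prod_i l 0 (h i) = `|\prod_i s 0 i| ^+ 2.
  rewrite -normrX -prodrXl normr_prod; apply: eq_bigr => i _.
  by rewrite mxE sqrtCK gtr0_norm.
rewrite ler_pXn2r ?nnegrE ?mulr_ge0//.
rewrite -[leRHS]mulr1 -[X in _ <= X * _]mul1r ler_pM ?mulr_ge0// ler_wpM2r//.
Qed.

Lemma rank_minor d (M : 'M[C]_d) : exists (f g : 'I_(\rank M) -> 'I_d),
  [/\ injective f, injective g & \det (mxsub f g M) != 0].
Proof.
pose f := maxrankfun M; pose N := rowsub f M.
have fullN : row_full N^T by rewrite /row_full mxrank_tr; exact: maxrowsub_free.
exists f, (fullrankfun fullN); split.
- exact: maxrankfun_inj.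
- exact: fullrankfun_inj.
- have := fullrowsub_unit fullN; rewrite unitmxE unitfE -det_tr.
  rewrite (_ : _^T = mxsub f (fullrankfun fullN) M)//.
  by apply/matrixP => i j; rewrite !mxE.
Qed.

Lemma minor_rank d k (M : 'M[C]_d) (f g : 'I_k -> 'I_d) :
  \det (mxsub f g M) != 0 -> (k <= \rank M)%N.
Proof.
move=> D; have <- : \rank (mxsub f g M) = k.
  by apply: mxrank_unit; rewrite unitmxE unitfE.
have -> : mxsub f g M = rowsub f (colsub g M) by apply/matrixP => i j; rewrite !mxE.
apply: leq_trans (mxrankS (rowsub_sub _ _)) _.
have -> : colsub g M = (rowsub g M^T)^T by apply/matrixP => i j; rewrite !mxE.
by rewrite mxrank_tr (leq_trans (mxrankS (rowsub_sub _ _)))// mxrank_tr.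
Qed.

(** The squared singular values [l]; enumerating the nonzero ones makes
    [minor_le_pseudo_det] applicable to the minors of maximal size. *)
Lemma pseudo_det d (M : 'M[C]_d) : exists (W : 'M[C]_d) (l : 'rV[C]_d),
  [/\ adjm W *m W = 1%:M /\ W *m adjm W = 1%:M,
      adjm (M *m W) *m (M *m W) = diag_mx l,
      (forall j, 0 <= l 0 j),
      #|[pred j | l 0 j != 0]| = \rank M
    & forall f g : 'I_(\rank M) -> 'I_d, injective f -> injective g ->
       `|\det (mxsub f g M)| ^+ 2 <= \prod_(j | l 0 j != 0) l 0 j].
Proof.
have [W [l [W1 W2 MW]]] := spectral_gram M; exists W, l.
have l0 j : 0 <= l 0 j.
  have /matrixP/(_ j j) := MW; rewrite gram_diagE !mxE eqxx mulr1n => <-.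
  by rewrite sumr_ge0// => i _; rewrite exprn_ge0.
set A := [pred j | l 0 j != 0]; pose h := @enum_val _ A.
have hI : injective h by exact: enum_val_inj.
have lh i : 0 < l 0 (h i).
  by rewrite lt_neqAle l0 andbT eq_sym; exact: (enum_valP i).
have hl j : l 0 j != 0 -> j \in codom h.
  by move=> jA; apply/codomP; exists (enum_rank_in (jA : j \in A) j); rewrite /h enum_rankK_in.
have card : #|A| = \rank M.
  apply/eqP; rewrite eqn_leq; apply/andP; split.
    have : \det (mxsub h h (diag_mx l)) != 0.
      by rewrite mxsub_diag// det_diag; apply/prodf_neq0 => i _; rewrite mxE gt_eqF.
    move=> /minor_rank/leq_trans; apply; rewrite -MW.
    by rewrite (leq_trans (mxrankM_maxr _ _))// (leq_trans (mxrankM_maxl _ _)).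
  rewrite (gram_factor W2 MW hI hl).
  by rewrite (leq_trans (mxrankM_maxl _ _))// rank_leq_col.
split=> //; rewrite -card => f g fI gI.
rewrite (big_enum_val (fun j => l 0 j)).
by apply: (minor_le_pseudo_det W1 W2 MW fI gI hI).
Qed.

End PseudoDeterminant.

(** * Partial sums of the logarithmic series *)

Section LogSeries.
Variable R : realType.

Lemma geom_sum (c : R) N : (\sum_(l < N) c ^+ l) * (1 - c) = 1 - c ^+ N.
Proof. by rewrite mulrC -(opprB c) mulNr -subrX1 opprB. Qed.

(** The difference of the two sides has derivative [x^N / (1 - x) >= 0]. *)
Lemma log_series_le (x : R) N : 0 <= x -> x < 1 ->
  \sum_(l < N) x ^+ l.+1 / l.+1%:R <= - ln (1 - x).
Proof.
move=> x0 x1.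
pose p : {poly R} := \sum_(l < N) l.+1%:R^-1 *: 'X^(l.+1).
have pE c : p.[c] = \sum_(l < N) c ^+ l.+1 / l.+1%:R.
  by rewrite horner_sum; apply: eq_bigr => l _; rewrite hornerZ hornerXn mulrC.
have p'E c : p^`().[c] = \sum_(l < N) c ^+ l.
  rewrite raddf_sum horner_sum; apply: eq_bigr => l _.
  rewrite /= derivZ derivXn hornerZ hornerMn hornerXn /= mulrnAr -mulrnAl.
  by rewrite -[X in X * _]mulr_natr mulVf ?mul1r// pnatr_eq0.
pose f c := - ln (1 - c) - p.[c]; pose df c := (1 - c)^-1 - p^`().[c].
have drv (c : R) : c < 1 -> is_derive c (1 : R) f (df c).
  move=> c1; have c0 : 0 < 1 - c by rewrite subr_gt0.
  have h1 : is_derive c (1 : R) (fun c : R => 1 - c : R) (-1).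
    have := @is_deriveB R R R (cst 1) id c 1 0 1 _ _.
    by rewrite sub0r; apply.
  have h2 : is_derive c (1 : R) (fun c : R => ln (1 - c)) (- (1 - c)^-1).
    have := @is_derive1_comp R (@ln R) (fun c => 1 - c) c _ _ (is_derive1_ln c0) h1.
    by rewrite mulrN1.
  have h3 := is_derive_poly p c.
  have := is_deriveB (is_deriveN h2) h3; rewrite opprK; exact.
have hd (c : R) : c \in `]0, x[%R -> is_derive c (1 : R) f (df c).
  by rewrite in_itv/= => /andP[_ cx]; apply: drv; exact: lt_trans x1.
have hc : {within `[0, x], continuous f}.
  apply: derivable_within_continuous => c; rewrite in_itv/= => /andP[_ cx].
  by have [] := drv c (le_lt_trans cx x1).
have [c] := MVT_segment x0 hd hc.
rewrite in_itv/= => /andP[c0 cx]; have c1 : c < 1 by exact: le_lt_trans x1.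
have f0 : f 0 = 0.
  rewrite /f subr0 ln1 pE big1 ?oppr0 ?addr0// => l _.
  by rewrite expr0n mul0r.
rewrite f0 !subr0 => fx; rewrite -pE -subr_ge0 -[X in 0 <= X]/(f x) fx mulr_ge0//.
rewrite /df p'E subr_ge0 -(ler_pM2r (_ : 0 < 1 - c)) ?subr_gt0//.
by rewrite mulVf ?gt_eqF ?subr_gt0// geom_sum gerBl exprn_ge0.
Qed.

End LogSeries.

(** * Matrices over the trivial group *)

Lemma Re_sum (R : realType) (I : Type) (r : seq I) (P : pred I) (F : I -> R[i]) :
  complex.Re (\sum_(i <- r | P i) F i) = \sum_(i <- r | P i) complex.Re (F i).
Proof. by elim/big_rec2 : _ => //= i x y _ <-; case: (F i) y => a b []. Qed.

Section TrivialGroup.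
Variables (R : realType) (G : groupType) (G1 : forall g : G, g = 1%g).
Local Notation C := R[i].
Variables (J : finType) (B : J -> J -> group_ring R G) (kappa : R).
Hypothesis Bk : schur B kappa.
Local Notation d := #|J|.

Definition triv_mx : 'M[C]_d := \matrix_(i, j) B (enum_val i) (enum_val j) 1%g.
Local Notation M := triv_mx.
Local Notation K := (kappa ^+ 2).

Let vec (f : J * G -> C) : 'cV[C]_d := \col_i f (enum_val i, 1%g).

Let finsupp_triv (a : group_ring R G) (F : G -> C) :
  (a 1%g = 0 -> F 1%g = 0) -> \sum_(g <- finsupp a) F g = F 1%g.
Proof.
move=> F1; have [a1|a1] := boolP (1%g \in finsupp a).
  rewrite (big_fsetD1 1%g)//= big_seq_cond big1 ?addr0// => g.
  by rewrite !inE (G1 g) eqxx.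
rewrite memNfinsupp in a1; rewrite F1; last exact/eqP.
rewrite big_seq_cond big1// => g; rewrite (G1 g) mem_finsupp.
by rewrite (eqP a1) eqxx.
Qed.

Let sum_ord (F : J -> C) : \sum_b F b = \sum_(i < d) F (enum_val i).
Proof. by rewrite (reindex _ (onW_bij _ (@enum_val_bij J))). Qed.

Let vec_op f : vec (gop B (ltrV id) f) = M *m vec f.
Proof.
apply/matrixP => i j; rewrite !mxE /gop /blockop sum_ord.
apply: eq_bigr => b _; rewrite !mxE finsupp_triv/= /coef.
  by rewrite [ltrV _ _ _]G1.
by move=> ->; rewrite mul0r.
Qed.

Let vec_adj f : vec (gadj B (ltr id) f) = adjm M *m vec f.
Proof.
apply/matrixP => i j; rewrite !mxE /gadj /blockop sum_ord.
apply: eq_bigr => b _; rewrite !mxE finsupp_triv/= /tr_coef /coef.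
  by rewrite [ltr _ _ _]G1.
by move=> ->; rewrite rmorph0 mul0r.
Qed.

Let ap : adjoint_pair (gop B (ltrV id)) (gadj B (ltr id)) K.
Proof. by apply: gop_adjoint Bk _ _; [exact: ltrVK|exact: ltrK]. Qed.

Let nrm2_triv (f : J * G -> C) : nrm2 f = (\sum_(i < d) normc (vec f i 0) ^+ 2)%:E.
Proof.
rewrite /nrm2 esum_fibre; last by move=> x; rewrite lee_fin sqr_ge0.
rewrite (reindex _ (onW_bij _ (@enum_val_bij J))) -sumEFin; apply: eq_bigr => i _.
rewrite (@esum_at _ _ 1%g (fun y => normc (f (enum_val i, y)) ^+ 2)) ?sqr_ge0 ?mxE//.
by move=> y; rewrite (G1 y) eqxx.
Qed.

(** In an orthonormal basis of right singular vectors [gram] is diagonal, with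
    entries [1 - l i / K] for the squares [l i] of the singular values. *)
Lemma trivial_moments : exists l : 'I_d -> R,
  [/\ forall i, 0 <= l i <= K,
      forall n, mom B K n = \sum_i (1 - l i / K) ^+ n,
      #|[pred j | l j != 0]| = \rank M
    & forall f g : 'I_(\rank M) -> 'I_d, injective f -> injective g ->
       normc (\det (mxsub f g M)) ^+ 2 <= \prod_(j | l j != 0) l j].
Proof.
have [W [lc [[W1 W2] MW lc0 card minor]]] := pseudo_det M.
pose l i := complex.Re (lc 0 i).
have lE i : lc 0 i = (l i)%:C by rewrite RRe_real// ger0_real.
have lE0 i : (lc 0 i != 0) = (l i != 0) by rewrite lE eq_complex /= eqxx andbT.
have l0 i : 0 <= l i by rewrite -lecR -lE.
have K0 : 0 < K := ap_gt0 ap.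
have lK i : l i <= K.
  pose f (x : J * G) : C := W (enum_rank x.1) i.
  have vf : vec f = col i W by apply/matrixP => a b; rewrite !mxE /f/= enum_valK.
  have E2 : nrm2 f = 1%:E.
    rewrite nrm2_triv; congr (_%:E); apply: complexI; rewrite rmorph_sum/=.
    transitivity ((adjm W *m W) i i); last by rewrite W1 mxE eqxx.
    rewrite gram_diagE; by apply: eq_bigr => j _; rewrite vf mxE rmorphXn.
  have E3 : nrm2 (gop B (ltrV id) f) = (l i)%:E.
    have colM : M *m col i W = col i (M *m W).
      by apply/matrixP => a b; rewrite !mxE; apply: eq_bigr => j _; rewrite !mxE.
    rewrite nrm2_triv; congr (_%:E); apply: complexI; rewrite rmorph_sum/= -lE.
    have /matrixP/(_ i i) := MW; rewrite gram_diagE !mxE eqxx mulr1n => <-.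
    by apply: eq_bigr => j _; rewrite vec_op vf colM mxE rmorphXn.
  have lf : l2 f by rewrite /l2/= -/(nrm2 f) E2 ltry.
  by have := ap_le ap lf; rewrite E2 E3 mule1 lee_fin.
have MM : adjm M *m M = W *m diag_mx lc *m adjm W.
  by rewrite -MW adjmM !mulmxA W2 mul1mx -!mulmxA W2 mulmx1.
pose D n : 'M[C]_d := diag_mx (\row_i ((1 - l i / K) ^+ n)%:C).
have vQ n f : vec (iter n (ggram B K (ltr id) (ltrV id)) f) = W *m D n *m adjm W *m vec f.
  elim: n => [|n IH].
    rewrite (_ : D 0%N = 1%:M) ?mulmx1 ?W2 ?mul1mx//.
    by apply/matrixP => i j; rewrite !mxE expr0.
  rewrite iterS; set h := iter n _ f in IH *.
  have -> : vec (ggram B K (ltr id) (ltrV id) h) =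
      vec h - (K^-1)%:C *: (adjm M *m M *m vec h).
    by rewrite -mulmxA -vec_op -vec_adj; apply/matrixP => i j; rewrite !mxE.
  rewrite IH; move: (vec f) => v.
  have -> : adjm M *m M *m (W *m D n *m adjm W *m v) =
      W *m diag_mx lc *m D n *m adjm W *m v.
    by rewrite MM !mulmxA -[W *m _ *m adjm W *m W]mulmxA W1 mulmx1.
  rewrite 2!scalemxAl -mulmxBl -mulmxBl; congr (_ *m _ *m _).
  rewrite -[W *m diag_mx lc *m D n]mulmxA scalemxAr -mulmxBr; congr (_ *m _).
  apply/matrixP => i j; rewrite mulmx_diag !mxE lE.
  case: eqVneq => _; last by rewrite !mulr0n mulr0 subr0.
  rewrite !mulr1n -!rmorphM -rmorphB; congr (_%:C).
  by rewrite [RHS]exprS mulrBl mul1r mulrA [K^-1 * _]mulrC.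
exists l; split=> //.
- by move=> i; rewrite l0 lK.
- move=> n; pose A := W *m D n *m adjm W.
  have E j : iter n (ggram B K (ltr id) (ltrV id)) (delta R (j, 1%g)) (j, 1%g) =
      A (enum_rank j) (enum_rank j).
    transitivity (vec (iter n (ggram B K (ltr id) (ltrV id)) (delta R (j, 1%g))) (enum_rank j) 0).
      by rewrite mxE enum_rankK.
    rewrite vQ -/A mxE (bigD1 (enum_rank j))//= [X in _ + X]big1 ?addr0.
      by rewrite [vec _ _ _]mxE enum_rankK /delta eqxx mulr1.
    move=> i ij; rewrite [vec _ _ _]mxE /delta xpair_eqE eqxx andbT.
    by rewrite -(enum_rankK j) (inj_eq enum_val_inj) (negbTE ij) mulr0.
  transitivity (complex.Re (\tr A)).
    rewrite /mom /trmom /mxtrace Re_sum (reindex _ (onW_bij _ (@enum_val_bij J)))/=.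
    by apply: eq_bigr => i _; rewrite E enum_valK.
  rewrite /A -mulmxA mxtrace_mulC -mulmxA W1 mulmx1 mxtrace_diag Re_sum.
  by apply: eq_bigr => i _; rewrite mxE.
- by rewrite -card; apply: eq_card => j; rewrite !inE lE0.
- move=> f g fI gI; rewrite -lecR; have := minor f g fI gI.
  rewrite (_ : `|_| ^+ 2 = (normc (\det (mxsub f g M)) ^+ 2)%:C) ?rmorphXn//.
  move=> /le_trans; apply; rewrite rmorph_prod/= le_eqVlt; apply/orP; left; apply/eqP.
  by apply: eq_big => [j|j _]; rewrite ?lE0 ?lE.
Qed.

(** The logarithmic series sums the powers of [1 - l j / K] to [ln K - ln (l j)]
    when [l j != 0]; a zero singular value contributes nothing, since its moments
    are constant. *)
Lemma trivial_logsum : 1 <= kappa -> exists l : 'I_d -> R,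
  [/\ forall i, 0 <= l i,
      forall N M', (N <= M')%N -> logsum (mom B K) N M' <=
        (\rank M)%:R * ln K - ln (\prod_(j | l j != 0) l j)
    & forall f g : 'I_(\rank M) -> 'I_d, injective f -> injective g ->
       normc (\det (mxsub f g M)) ^+ 2 <= \prod_(j | l j != 0) l j].
Proof.
move=> k1; have [l [l0K momE card minor]] := trivial_moments.
exists l; split=> // [i|N M' NM]; first by case/andP: (l0K i).
have K0 : 0 < K := ap_gt0 ap.
have lp j : l j != 0 -> 0 < l j by move=> lj; rewrite lt_neqAle eq_sym lj; case/andP: (l0K j).
have -> : ln (\prod_(j | l j != 0) l j) = \sum_(j | l j != 0) ln (l j).
  apply: (@proj1 _ (0 < \prod_(j | l j != 0) l j)).
  elim/big_rec2 : _ => [|j y x /lp lj [<- x0]]; first by rewrite ln1.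
  by rewrite lnM ?posrE// mulr_gt0.
have -> : (\rank M)%:R * ln K = \sum_(j | l j != 0) ln K.
  by rewrite sumr_const -card mulr_natl; congr (_ *+ _); apply: eq_card.
rewrite -sumrB /logsum.
have -> : \sum_(i < N) (mom B K i.+1 - mom B K M') / i.+1%:R =
    \sum_j \sum_(i < N) ((1 - l j / K) ^+ i.+1 - (1 - l j / K) ^+ M') / i.+1%:R.
  rewrite exchange_big/=; apply: eq_bigr => i _.
  by rewrite !momE -sumrB mulr_suml.
rewrite (bigID (fun j => l j != 0))/= [X in _ + X]big1 ?addr0; last first.
  move=> j; rewrite negbK => /eqP ->; rewrite big1// => i _.
  by rewrite mul0r subr0 !expr1n subrr mul0r.
apply: ler_sum => j lj; have lj0 := lp j lj; have /andP[_ ljK] := l0K j.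
have x0 : 0 <= 1 - l j / K by rewrite subr_ge0 ler_pdivrMr// mul1r.
have x1 : 1 - l j / K < 1 by rewrite gtrBl divr_gt0.
have := log_series_le N x0 x1.
rewrite subKr lnM ?posrE ?invr_gt0// lnV ?posrE// opprD opprK [X in _ <= X]addrC => h.
apply: le_trans h; apply: ler_sum => i _.
by rewrite ler_wpM2r ?invr_ge0 ?ler0n// gerBl exprn_ge0.
Qed.

End TrivialGroup.

(** * The determinant bound for the trivial group *)

Section BaseCase.
Variables (R : realType).
Local Notation C := R[i].
Variables (nn : nat) (theta : 'I_nn -> C) (dn : nat).

Definition ev (s : 'I_nn) (P : {poly int}) : C := (map_poly intr P).[theta s].

(** What is used of a full set of conjugate algebraic integers: conjugates have
    the same relations, and norms are integers. *)
Record conjugates : Prop := {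
  conj_zero : forall (P : {poly int}) s t, ev s P = 0 -> ev t P = 0;
  conj_norm : forall P : {poly int}, exists z : int, \prod_s ev s P = z%:~R }.

Hypotheses (theta_conj : conjugates) (dn_gt0 : (0 < dn)%N).

Lemma ev_det s k (A : 'M[{poly int}]_k) : ev s (\det A) = \det (map_mx (ev s) A).
Proof.
have -> : ev s (\det A) = (horner_eval (theta s) \o map_poly intr) (\det A) by [].
by rewrite -det_map_mx.
Qed.

Variables (G : groupType) (G1 : forall g : G, g = 1%g).

(** A nonzero integer has absolute value at least one. *)
Lemma conj_prod_norm (P : {poly int}) s : ev s P != 0 -> 1 <= normc (\prod_t ev t P).
Proof.
move=> sP; have [z hz] := conj_norm theta_conj P; rewrite hz.
have -> : z%:~R = (z%:~R : R)%:C :> C by rewrite rmorph_int.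
rewrite normc_real norm_intr_ge1 ?intr_int// intr_eq0.
apply: contra_neq sP => z0; move: hz; rewrite z0 => /eqP.
rewrite prodf_seq_eq0 => /hasP[t _ /= /eqP tP].
exact: (conj_zero theta_conj s tP).
Qed.

(** A nonzero minor of maximal size has, after multiplication by a power of [dn],
    a nonzero integer as product over the conjugates; it bounds the product of
    the pseudo-determinants from below. The relations between the entries are the
    same for all conjugates, so the same minor serves for all of them. *)
Theorem detbound_trivial : detbound theta dn G.
Proof.
move=> J B kappa cB sB k1 N M' NM.
case: (posnP nn) => [n0|].
  rewrite big1 ?n0 ?mul0n ?mul0r// => s _.
  by have := ltn_ord s; rewrite {2}n0.
move=> nn_gt0; pose s0 : 'I_nn := Ordinal nn_gt0.
pose M s := triv_mx (B s).
pose A : 'M[{poly int}]_#|J| := \matrix_(i, j) sval (cid (cB (enum_val i) (enum_val j) 1%g)).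
have AE s i j : ev s (A i j) = dn%:R * M s i j.
  by rewrite !mxE; case: cid => P /= ->.
have minorE s k (f g : 'I_k -> 'I_#|J|) :
    ev s (\det (mxsub f g A)) = dn%:R ^+ k * \det (mxsub f g (M s)).
  rewrite ev_det -detZ; congr (\det _).
  by apply/matrixP => i j; rewrite !mxE; case: cid => P /= ->.
have dn0 : dn%:R != 0 :> C by rewrite pnatr_eq0 -lt0n.
have minor_conj s t k (f g : 'I_k -> 'I_#|J|) :
    \det (mxsub f g (M s)) != 0 -> \det (mxsub f g (M t)) != 0.
  apply: contra_neq => mt; have := minorE t _ f g; rewrite mt mulr0.
  move=> /(conj_zero theta_conj s); rewrite minorE => /eqP.
  by rewrite mulf_eq0 expf_eq0 (negbTE dn0) andbF/= => /eqP.
have rank_le s t : (\rank (M s) <= \rank (M t))%N.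
  by have [f [g [_ _ /(minor_conj _ t)/minor_rank]]] := rank_minor (M s).
have rankE s : \rank (M s) = \rank (M s0) by apply/eqP; rewrite eqn_leq !rank_le.
have [f [g [fI gI m0]]] := rank_minor (M s0).
set k := \rank (M s0) in rankE f g fI gI m0.
pose D s := normc (\det (mxsub f g (M s))).
have D_gt0 s : 0 < D s.
  by rewrite lt_neqAle normc_ge0 eq_sym andbT normc_eq0 (minor_conj s0).
have one s : logsum (mom (B s) (kappa ^+ 2)) N M' <= k%:R * ln (kappa ^+ 2) - 2 * ln (D s).
  have [l [l0 lsum lminor]] := trivial_logsum G1 (sB s) k1.
  apply: (le_trans (lsum N M' NM)); rewrite -/(M s) rankE lerD2l lerN2.
  have : D s ^+ 2 <= \prod_(j | l j != 0) l j.
    move: lminor; rewrite -/(M s); move: f g fI gI @D D_gt0 {m0 minor_conj}.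
    by case: _ / (rankE s) => f g fI gI D _; apply.
  rewrite -ler_ln ?posrE ?exprn_gt0//; last first.
    by apply: prodr_gt0 => j lj; rewrite lt_neqAle eq_sym lj l0.
  by rewrite lnXn// mulr_natl.
apply: (le_trans (ler_sum _ (fun s _ => one s))).
rewrite sumrB sumr_const card_ord -mulr_sumr.
have lnD : \sum_s ln (D s) = ln (\prod_s D s).
  apply: (@proj1 _ (0 < \prod_s D s)); elim/big_rec2 : _ => [|s y x _ [-> x0]].
    by rewrite ln1.
  by rewrite lnM ?posrE ?D_gt0// mulr_gt0 ?D_gt0.
have K1 : 1 <= kappa ^+ 2 by rewrite exprn_ege1.
have d1 : 1 <= dn%:R :> R by rewrite ler1n.
have norm1 : 1 <= dn%:R ^+ (k * nn) * \prod_s D s.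
  have := @conj_prod_norm (\det (mxsub f g A)) s0.
  rewrite minorE mulf_eq0 expf_eq0 (negbTE dn0) andbF/= => /(_ m0).
  under eq_bigr do rewrite minorE.
  rewrite big_split/= prodr_const card_ord -exprM Normc.normcM normcX.
  rewrite (_ : normc dn%:R = dn%:R); last by rewrite -(rmorph_nat (real_complex R)) normc_real ger0_norm.
  suff -> : normc (\prod_s \det (mxsub f g (M s))) = \prod_s D s by [].
  by elim/big_rec2 : _ => [|s y x _ <-]; rewrite ?Normc.normc1 ?Normc.normcM.
have P_gt0 : 0 < \prod_s D s by apply: prodr_gt0.
have lnP : - ln (\prod_s D s) <= (k * nn)%:R * ln dn%:R.
  have dp : 0 < dn%:R :> R by rewrite ltr0n.
  have : 0 <= ln (dn%:R ^+ (k * nn) * \prod_s D s) by rewrite ln_ge0.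
  by rewrite lnM ?posrE ?exprn_gt0// lnXn// -[ln dn%:R *+ _]mulr_natl -lerBlDr sub0r.
rewrite lnD /logbound.
have kd : (k <= #|J|)%N by exact: rank_leq_row.
have b0 : 0 <= ln (kappa ^+ 2) + 2 * ln dn%:R.
  by rewrite addr_ge0 ?ln_ge0// mulr_ge0// ln_ge0.
apply: (@le_trans _ _ ((nn * k)%:R * (ln (kappa ^+ 2) + 2 * ln dn%:R))); last first.
  by rewrite ler_wpM2r// ler_nat leq_mul2l kd orbT.
rewrite -mulrnAl -[k%:R *+ nn]mulr_natr -natrM mulrDr (mulnC nn).
by rewrite lerD2l -mulrN [leRHS]mulrCA ler_pM2l.
Qed.

End BaseCase.

(** * Conjugates of algebraic numbers *)

Section Norms.
Variable C : numClosedFieldType.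

Lemma char_poly_horner n (A : 'M[C]_n) z : (char_poly A).[z] = \det (z%:M - A).
Proof.
rewrite -[_.[z]]/(horner_eval z (char_poly A)) /char_poly -det_map_mx; congr (\det _).
apply/matrixP => i j; rewrite !mxE -[LHS]/(('X *+ (i == j) - (A i j)%:P).[z]).
rewrite hornerD hornerN hornerC.
by rewrite hornerMn hornerX.
Qed.

(** The norm of [P(theta)] is the determinant of [P(N)] when [N] is an integer
    matrix whose eigenvalues are the conjugates of [theta]. *)
Lemma prod_horner_det n (N : 'M[int]_n) (th : 'I_n -> C) : (0 < n)%N ->
  (forall z, \det (map_mx intr N - z%:M) = \prod_s (th s - z)) ->
  forall P : {poly int}, exists z : int, \prod_s (map_poly intr P).[th s] = z%:~R.
Proof.
case: n N th => // n N th _ detN P; exists (\det (horner_mx N P)).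
have -> : (\det (horner_mx N P))%:~R = \det (horner_mx (map_mx intr N) (map_poly intr P)) :> C.
  by rewrite -map_horner_mx det_map_mx.
have [r ->] := closed_field_poly_normal (map_poly intr P : {poly C}).
set c := lead_coef _; transitivity (\prod_s (c * \prod_(z <- r) (th s - z))).
  apply: eq_bigr => s _; rewrite hornerZ horner_prod; congr (_ * _).
  by apply: eq_bigr => z _; rewrite hornerXsubC.
rewrite linearZ/= detZ rmorph_prod/= big_split/= prodr_const card_ord; congr (_ * _).
rewrite exchange_big/=.
elim: r => [|z r IH]; first by rewrite !big_nil det1.
rewrite !big_cons IH det_mulmx; congr (_ * _).
by rewrite -detN rmorphB /= horner_mx_X horner_mx_C.
Qed.

End Norms.

Section PrimitiveElement.
Variables (R : realType).
Local Notation C := R[i].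
Local Notation alg := (algebraicOver (@ratr R[i])).
Local Notation rp := (map_poly (@ratr R[i])).

(** Iteration of the primitive element theorem for two generators. *)
Lemma primitive_element (xs : seq C) : (forall x, x \in xs -> alg x) ->
  exists g, alg g /\ forall x, x \in xs -> exists q : {poly rat}, (rp q).[g] = x.
Proof.
elim: xs => [|x xs IH] h; first by exists 0; split=> //; exact: algebraic0.
have [|g [ag hg]] := IH; first by move=> y ys; apply: h; rewrite inE ys orbT.
have ax := h x (mem_head _ _).
have [p p0 px] := ax; have [q q0 qg] := ag.
have [n [[qx hx] [qg' hgz]]] := pchar0_PET p0 px q0 qg (@pchar_num _).
exists (g *+ n - x); split.
  apply: algebraic_sub => //; elim: (n) => [|m IHm]; first by rewrite mulr0n; exact: algebraic0.
  by rewrite mulrS; apply: algebraic_add.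
move=> y; rewrite inE => /orP[/eqP ->|/hg[q' <-]]; first by exists qx.
by exists (q' \Po qg'); rewrite map_comp_poly horner_comp hgz.
Qed.

(** Take [h] of least degree. The greatest common divisor of [h] and [q] has the
    root [z]; its cofactor in [h] has smaller degree than [h], so it does not vanish
    at [g], and hence the divisor does and has the degree of [h]. *)
Lemma minimal_poly (g : C) : alg g -> exists h : {poly rat},
  [/\ h != 0, root (rp h) g
    & forall (q : {poly rat}) z, root (rp h) z -> root (rp q) z -> (h %| q)%R].
Proof.
move=> [p0 p0n0 p0g].
pose Q n := `[< exists p : {poly rat}, [/\ p != 0, root (rp p) g & size p = n] >].
have exQ : exists n, Q n by exists (size p0); apply/asboolP; exists p0.
case: (ex_minnP exQ) => m /asboolP[h [h0 hg hm]] mmin.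
have hmin p : p != 0 -> root (rp p) g -> (size h <= size p)%N.
  by move=> p_neq0 pg; rewrite hm; apply: mmin; apply/asboolP; exists p.
exists h; split=> // q z hz qz.
pose d := gcdp q h; have dh : (d %| h)%R by exact: dvdp_gcdr.
have d0 : d != 0 by rewrite gcdp_eq0 (negbTE h0) andbF.
have dz : root (rp d) z by rewrite gcdp_map root_gcd qz hz.
have sd : (1 < size d)%N.
  by have := root_size_gt1 _ dz; rewrite map_poly_eq0 size_map_poly; exact.
have /dvdpP[u hu] := dh.
have u0 : u != 0 by apply: contra_neq h0 => u0; rewrite hu u0 mul0r.
have dg : root (rp d) g.
  have sh : size h = (size u + size d).-1 by rewrite {1}hu size_mul.
  have rE : rp h = rp u * rp d by rewrite {1}hu rmorphM.
  move: hg; rewrite rE rootM => /orP[ug|//].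
  have lt i k : (1 < k)%N -> (i < (i + k).-1)%N.
    by case: k => [|[|k]] // _; rewrite !addnS ltnS leq_addr.
  by have := hmin u u0 ug; rewrite sh leqNgt lt.
have eqdh : d %= h.
  by rewrite -(dvdp_size_eqp dh) eqn_leq dvdp_leq// hmin.
by rewrite -(eqp_dvdl _ eqdh) dvdp_gcdl.
Qed.

(** The conjugates are those of [a * g] for a primitive element [g] and the leading
    coefficient [a] of an integer polynomial of [g]. *)
Lemma conjugates_exist (xs : seq C) : (forall x, x \in xs -> alg x) ->
  exists (nn : nat) (theta : 'I_nn -> C) (dn : nat) (s0 : 'I_nn),
  [/\ conjugates theta, (0 < dn)%N
    & forall x, x \in xs -> exists P : {poly int}, dn%:R * x = ev theta s0 P].
Proof.
move=> axs; have [g [ag hg]] := primitive_element axs.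
have [h [h0 rhg hdvd]] := minimal_poly ag.
have [f [b b0 hf]] := rat_poly_scale h.
have f0 : f != 0 by apply: contra_neq h0 => f0; rewrite hf f0 map_poly0 scaler0.
have bQ : b%:~R != 0 :> rat by rewrite intr_eq0.
pose fC : {poly C} := map_poly intr f.
have fCE z : root fC z = root (rp h) z.
  rewrite hf map_polyZ -map_poly_comp rootZ ?fmorph_eq0 ?invr_eq0//.
  by congr (root _ z); apply: eq_map_poly => m /=; rewrite ratr_int.
have sfC : size fC = size f by rewrite size_map_inj_poly//; exact: intr_inj.
pose a := lead_coef f; have a0 : a%:~R != 0 :> C by rewrite intr_eq0 lead_coef_eq0.
have lfC : lead_coef fC = a%:~R by rewrite lead_coef_map_inj//; exact: intr_inj.
have fg : root fC g by rewrite fCE.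
have fC0 : fC != 0 by rewrite -size_poly_eq0 sfC size_poly_eq0.
have sf : (1 < size f)%N by rewrite -sfC (root_size_gt1 fC0 fg).
have [rs frs] := closed_field_poly_normal fC; rewrite lfC in frs.
pose p : {poly C} := a%:~R^-1 *: fC.
have pE : p = \prod_(z <- rs) ('X - z%:P) by rewrite /p frs scalerA mulVf// scale1r.
have sp : size p = size f by rewrite /p size_scale ?invr_eq0.
have srs : size rs = (size p).-1 by rewrite pE size_prod_XsubC.
pose nn := (size p).-1.
have nn0 : (0 < nn)%N by rewrite /nn sp -ltnS prednK// ltnW.
pose theta (s : 'I_nn) : C := a%:~R * rs`_s.
have rs_prod (F : C -> C) : \prod_(s < nn) F rs`_s = \prod_(z <- rs) F z.
  by rewrite (big_nth 0) srs big_mkord.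
have rs_root (s : 'I_nn) : root (rp h) rs`_s.
  rewrite -fCE frs rootZ// root_prod_XsubC mem_nth// srs.
  exact: ltn_ord.
have grs : g \in rs by move: fg; rewrite frs rootZ// root_prod_XsubC.
have s0P : (index g rs < nn)%N by rewrite /nn -srs index_mem.
pose s0 := Ordinal s0P.
have th0 : theta s0 = a%:~R * g by rewrite /theta nth_index.
(* The factor [a] clears the denominators of the companion matrix: they occur in
   the last row only. *)
pose N : 'M[int]_nn := \matrix_(i, j)
  if (i == nn.-1 :> nat) then - f`_j else a * (i.+1 == j :> nat)%:R.
have NE : map_mx intr N = a%:~R *: companionmx p :> 'M[C]_nn.
  apply/matrixP => i j; rewrite !mxE; case: ifP => _.
    by rewrite coefZ coef_map/= rmorphN mulrN mulrA mulfV// mul1r.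
  by rewrite rmorphM /= rmorph_nat.
have pmonic : p \is monic.
  by rewrite pE monic_prod_XsubC.
have detN z : \det (map_mx intr N - z%:M) = \prod_s (theta s - z).
  have -> : map_mx intr N - z%:M = (- a%:~R) *: ((z / a%:~R)%:M - companionmx p).
    by rewrite NE scaleNr scalerBr opprB scale_scalar_mx mulrCA mulfV// mulr1.
  rewrite detZ -char_poly_horner companionmxK// pE horner_prod -rs_prod.
  rewrite -{1}(card_ord nn) -prodr_const -big_split/=; apply: eq_bigr => s _.
  by rewrite hornerXsubC /theta mulNr mulrBr opprB mulrCA mulfV// mulr1.
have thC : conjugates theta.
  split=> [P s t|P]; last exact: (prod_horner_det nn0 detN).
  pose q : {poly rat} := map_poly intr P \Po (a%:~R *: 'X).
  have qE (u : 'I_nn) : (rp q).[rs`_u] = ev theta u P.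
    rewrite /q map_comp_poly horner_comp map_polyZ map_polyX hornerZ hornerX.
    rewrite -map_poly_comp /ev /theta rmorph_int; congr (_.[_]).
    by apply: eq_map_poly => m /=; rewrite rmorph_int.
  rewrite -!qE => /eqP/(hdvd _ _ (rs_root s))/dvdpP[w ->].
  by rewrite rmorphM hornerM; have /rootP -> := rs_root t; rewrite mulr0.
exists nn, theta.
suff [dn [dn0 hdn]] : exists dn : nat, (0 < dn)%N /\
    forall x, x \in xs -> exists P : {poly int}, dn%:R * x = ev theta s0 P.
  by exists dn, s0.
elim: xs {axs} hg => [|x xs IH] hg; first by exists 1%N.
have [|dn [dn0 hdn]] := IH; first by move=> y ys; apply: hg; rewrite inE ys orbT.
have [q qx] := hg x (mem_head _ _).
pose q' : {poly rat} := q \Po (a%:~R^-1 *: 'X).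
have q'x : (rp q').[theta s0] = x.
  rewrite -qx /q' map_comp_poly horner_comp map_polyZ map_polyX hornerZ hornerX th0.
  by rewrite fmorphV rmorph_int mulrA mulVf// mul1r.
have [P0 [e e0 q'E]] := rat_poly_scale q'.
have eC : e%:~R != 0 :> C by rewrite intr_eq0.
have ex : e%:~R * x = ev theta s0 P0.
  rewrite -q'x q'E map_polyZ hornerZ fmorphV rmorph_int mulrA mulfV// mul1r.
  rewrite -map_poly_comp; congr (_.[_]); apply: eq_map_poly => m /=.
  by rewrite ratr_int.
exists (dn * `|e|)%N; split; first by rewrite muln_gt0 dn0 absz_gt0.
have evZ (k : int) P : ev theta s0 (k *: P) = k%:~R * ev theta s0 P.
  by rewrite /ev map_polyZ hornerZ.
move=> y; rewrite inE => /orP[/eqP ->|/hdn[P hP]]; last first.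
  exists (`|e|%N%:Z *: P); rewrite evZ -hP natrM.
  by rewrite -pmulrn mulrCA mulrA.
exists ((dn%:Z * Num.sg e) *: P0); rewrite evZ -ex natrM rmorphM /= -pmulrn.
rewrite -!mulrA; congr (_ * _); rewrite mulrA; congr (_ * _).
by rewrite -rmorphM/= -normrEsg -abszE -pmulrn.
Qed.

End PrimitiveElement.

(** * Compression to finitely many orbits *)

Section Compression.
Variables (R : realType) (U G : groupType) (X : choiceType).
Variables (lact : G -> X -> X) (ract : X -> U -> X).
Local Notation C := R[i].
Hypotheses (lact1 : forall x, lact 1%g x = x)
  (lactM : forall g h x, lact (g * h)%g x = lact g (lact h x))
  (lfree : forall g x, lact g x = x -> g = 1%g)
  (ract1 : forall x, ract x 1%g = x)
  (ractM : forall x u v, ract x (u * v)%g = ract (ract x u) v)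
  (rfree : forall x u, ract x u = x -> u = 1%g)
  (comm : forall g x u, ract (lact g x) u = lact g (ract x u)).

Definition lactV (g : G) (x : X) : X := lact g^-1%g x.

Lemma lactVK g : cancel (lactV g) (lact g).
Proof. by move=> x; rewrite /lactV -lactM mulgV lact1. Qed.

Lemma ract_inj x u v : ract x u = ract x v -> u = v.
Proof.
move=> /(congr1 (ract^~ v^-1%g)); rewrite -!ractM mulgV ract1 => /rfree.
exact: divg1_eq.
Qed.

Variables (J : finType) (B : J -> J -> group_ring R G).

(** The orbit map [g |-> g x] is injective, so the diagonal entries on [X] are
    those on the group. *)
Lemma diag_orbit K n b x :
  iter n (ggram B K lact lactV) (delta R (b, x)) (b, x) =
  iter n (ggram B K (ltr id) (ltrV id)) (delta R (b, 1%g)) (b, 1%g).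
Proof.
have -> : delta R (b, 1%g : G) = pb (fun g => lact g x) (delta R (b, x)).
  apply/funext => -[c g]; rewrite /pb /delta /= !xpair_eqE; congr ((_ && _)%:R).
  by apply/eqP/eqP => [->|/lfree//]; rewrite lact1.
rewrite (iter_ggram_pb (e2 := lact) (e2' := lactV)); first by rewrite /pb/= lact1.
  by move=> g y _; rewrite /ltr lactM.
by move=> g y _; rewrite /ltrV /lactV lactM.
Qed.

Variables (A : set X) (Ainv : forall x u, A x -> A (ract x u)).
Variables (N : nat) (r : 'I_N -> X) (rA : orbit_reps ract A r).

Lemma reps_inj n m u v : ract (r n) u = ract (r m) v -> n = m /\ u = v.
Proof.
move=> E; have nm : n = m.
  have [k [_ ku]] := rA.2 _ (Ainv u (rA.1 n)).
  by rewrite -(ku n) ?(ku m)//; [exists v|exists u].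
by split=> //; move: E; rewrite nm => /ract_inj.
Qed.

Definition in_orbit (n : 'I_N) (x : X) : bool := `[< exists u, x = ract (r n) u >].

Lemma sum_in_orbit (V : nmodType) x (c : V) :
  \sum_(n < N | in_orbit n x) c = if x \in A then c else 0.
Proof.
case: ifPn => [|xA]; first rewrite inE => /(rA.2)[n [[u xu] nu]].
  rewrite (big_pred1 n)// => m; apply/asboolP/eqP => [/nu//|->].
  by exists u.
rewrite big1// => n /asboolP[u xu]; move: xA.
by rewrite xu notin_setE => /(_ (Ainv u (rA.1 n))).
Qed.

Lemma mem_ract x u : (ract x u \in A) = (x \in A).
Proof.
apply/idP/idP; rewrite !inE => h; last exact: Ainv.
by rewrite -(ract1 x) -(mulgV u) ractM; exact: Ainv.
Qed.

Definition position (n : 'I_N) (x : X) : U := xget 1%g [set u | x = ract (r n) u].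

Lemma positionE n x : in_orbit n x -> ract (r n) (position n x) = x.
Proof. by move=> /asboolP[u xu]; rewrite /position; case: xgetP => [v _ //|/(_ u)[]]. Qed.

(** The entry from the orbit of [r m] to the orbit of [r n] collects the [g] that
    send the former into the latter, relabelled by the element of [U] that
    compares [g^-1 (r n)] with [r m]. *)
Definition compress_mx (n m : 'I_N * J) : group_ring R U :=
  regroup (fun g => in_orbit m.1 (lactV g (r n.1)))
    (fun g => (position m.1 (lactV g (r n.1)))^-1%g) (B n.2 m.2).

Definition coords (f : J * X -> C) : ('I_N * J) * U -> C :=
  fun z => f (z.1.2, ract (r z.1.1) z.2).

Lemma gop_compress f : gop compress_mx (ltrV id) (coords f) = coords (rop B lactV A f).
Proof.
apply/funext => -[[n a] v]; rewrite /gop /blockop /coords /rop /restr /=.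
rewrite mem_ract (_ : r n \in A); last by rewrite inE; exact: rA.1.
rewrite -(pair_bigA _ (fun m b => \sum_(g <- labels compress_mx (n, a) (m, b))
  coef compress_mx (n, a) (m, b) g * f (b, ract (r m) (ltrV id g v)))) /=.
rewrite exchange_big; apply: eq_bigr => b _.
transitivity (\sum_(m < N) \sum_(g <- finsupp (B a b) | in_orbit m (lactV g (r n)))
    B a b g * f (b, lactV g (ract (r n) v))).
  apply: eq_bigr => m _; rewrite /labels /coef /compress_mx /=.
  rewrite (@sum_regroup _ _ _ _ _ _ _ (fun z h => z * f (b, ract (r m) (ltrV id h v)))); first last.
    - by move=> z w h; rewrite mulrDl.
    - by move=> h; rewrite mul0r.
  apply: eq_bigr => g gn; rewrite /ltrV invgK ractM positionE//.
  by rewrite /lactV comm.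
rewrite (exchange_big_dep xpredT)//=; apply: eq_bigr => g _.
rewrite sum_in_orbit /lactV -comm mem_ract.
by case: ifP; rewrite ?mulr0.
Qed.

Lemma in_orbit_sym n m g : in_orbit m (lactV g (r n)) = in_orbit n (lact g (r m)).
Proof.
have half n' m' g' : in_orbit m' (lact g' (r n')) -> in_orbit n' (lact g'^-1%g (r m')).
  move=> /asboolP[u E]; apply/asboolP; exists u^-1%g.
  have : lact g'^-1%g (lact g' (r n')) = lact g'^-1%g (ract (r m') u) by rewrite E.
  rewrite -lactM mulVg lact1 -comm => ->.
  by rewrite -ractM mulgV ract1.
by apply/idP/idP => /half//; rewrite invgK.
Qed.

Lemma gadj_compress f : gadj compress_mx (ltr id) (coords f) = coords (radj B lact A f).
Proof.
apply/funext => -[[m b] v]; rewrite /gadj /blockop /coords /radj /restr /=.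
rewrite mem_ract (_ : r m \in A); last by rewrite inE; exact: rA.1.
rewrite -(pair_bigA _ (fun n a => \sum_(g <- tr_labels (labels compress_mx) (m, b) (n, a))
  tr_coef (coef compress_mx) (m, b) (n, a) g * f (a, ract (r n) (ltr id g v)))) /=.
rewrite exchange_big; apply: eq_bigr => a _.
transitivity (\sum_(n < N) \sum_(g <- finsupp (B a b) | in_orbit n (lact g (r m)))
    cj (B a b g) * f (a, lact g (ract (r m) v))).
  apply: eq_bigr => n _; rewrite /tr_labels /tr_coef /labels /coef /compress_mx /=.
  rewrite (@sum_regroup _ _ _ _ _ _ _ (fun z h => cj z * f (a, ract (r n) (ltr id h v)))); first last.
    - by move=> z w h; rewrite cjD mulrDl.
    - by move=> h; rewrite rmorph0 mul0r.
  rewrite [LHS](eq_bigl (fun g => in_orbit n (lact g (r m)))); last first.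
    by move=> g; exact: in_orbit_sym.
  apply: eq_bigr => g gn; congr (_ * f (_, _)); rewrite /ltr.
  rewrite -in_orbit_sym in gn; have E := positionE gn.
  set p := position _ _ in E *.
  have -> : r n = lact g (ract (r m) p) by rewrite E lactVK.
  by rewrite comm -ractM mulgA mulgV mul1g.
rewrite (exchange_big_dep xpredT)//=; apply: eq_bigr => g _.
rewrite sum_in_orbit -comm mem_ract.
by case: ifP; rewrite ?mulr0.
Qed.

Lemma schur_compress kappa : schur B kappa -> schur compress_mx kappa.
Proof.
move=> [k0 h1 h2]; split=> // [[n a]|[m b]].
- apply: le_trans (h1 a).
  rewrite -(pair_bigA _ (fun m b => weight (labels compress_mx) (coef compress_mx) (n, a) (m, b))) /=.
  rewrite exchange_big; apply: ler_sum => b _.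
  apply: (@le_trans _ _ (\sum_(m < N) \sum_(g <- finsupp (B a b) | in_orbit m (lactV g (r n)))
    normc (B a b g))).
    by apply: ler_sum => m _; exact: weight_regroup.
  rewrite (exchange_big_dep xpredT)//=; apply: ler_sum => g _.
  by rewrite sum_in_orbit; case: ifP => // _; exact: normc_ge0.
- apply: le_trans (h2 b).
  rewrite -(pair_bigA _ (fun n a => weight (labels compress_mx) (coef compress_mx) (n, a) (m, b))) /=.
  rewrite exchange_big; apply: ler_sum => a _.
  apply: (@le_trans _ _ (\sum_(n < N) \sum_(g <- finsupp (B a b) | in_orbit n (lact g (r m)))
    normc (B a b g))).
    apply: ler_sum => n _.
    under [leRHS]eq_bigl do rewrite -in_orbit_sym.
    exact: weight_regroup.
  rewrite (exchange_big_dep xpredT)//=; apply: ler_sum => g _.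
  by rewrite sum_in_orbit; case: ifP => // _; exact: normc_ge0.
Qed.

Lemma delta_coords m b : delta R ((m, b), 1%g) = coords (delta R (b, r m)).
Proof.
apply/funext => -[[n c] u]; rewrite /coords /delta /= !xpair_eqE.
rewrite [(n == m) && _]andbC -andbA; congr ((_ && _)%:R).
apply/andP/eqP => [[/eqP -> /eqP ->]|E]; first by rewrite ract1.
have E' : ract (r n) u = ract (r m) 1%g by rewrite ract1.
by have [-> ->] := reps_inj E'; rewrite !eqxx.
Qed.

Lemma iter_compress K n f :
  iter n (ggram compress_mx K (ltr id) (ltrV id)) (coords f) =
  coords (iter n (gram (rop B lactV A) (radj B lact A) K) f).
Proof.
elim: n => //= n ->; rewrite {1}/ggram {1}/gram gop_compress gadj_compress.
by apply/funext => -[].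
Qed.

(** Far from the boundary neither the cut-off nor the difference between [X] and
    the group is visible. *)
Lemma diag_compress K n m b : ball B lact lactV (n + n) A (r m) ->
  iter n (ggram compress_mx K (ltr id) (ltrV id)) (delta R ((m, b), 1%g)) ((m, b), 1%g) =
  iter n (ggram B K (ltr id) (ltrV id)) (delta R (b, 1%g)) (b, 1%g).
Proof.
move=> bl; rewrite delta_coords iter_compress /coords /= ract1.
by rewrite (rgram_local K _ bl) diag_orbit.
Qed.

Lemma l2_coords f : restr A f = f -> l2 (coords f) = l2 f.
Proof.
move=> fA; rewrite /l2/=.
pose e (z : ('I_N * J) * U) : J * X := (z.1.2, ract (r z.1.1) z.2).
have eb : set_bij [set: ('I_N * J) * U] [set x : J * X | A x.2] e.
  split=> [[[n b] u] _|[[n b] u] [[m c] v] _ _ [-> /reps_inj[-> ->]] //|[b x] /=].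
    exact/Ainv/rA.1.
  by move=> /(rA.2)[n [[u ->] _]]; exists ((n, b), u).
have -> : (\esum_(x in [set: J * X]) (normc (f x) ^+ 2)%:E =
    \esum_(x in [set x : J * X | A x.2]) (normc (f x) ^+ 2)%:E)%E.
  rewrite [RHS]esum_mkcond; apply: eq_esum => x _; case: ifPn => // xA.
  rewrite -fA /restr; case: ifPn => [|_]; last by rewrite Normc.normc0 expr0n.
  by rewrite inE => Ax; move: xA; rewrite notin_setE.
by rewrite (reindex_esum _ _ _ _ eb).
Qed.

Definition uncoords (h : ('I_N * J) * U -> C) (y : J * X) : C :=
  \sum_(n < N | in_orbit n y.2) h ((n, y.1), position n y.2).

Lemma restr_uncoords h : restr A (uncoords h) = uncoords h.
Proof.
apply/funext => -[b x]; rewrite /restr /uncoords /=; case: ifPn => // xA.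
rewrite big1// => n /asboolP[u xu]; move: xA.
by rewrite xu notin_setE => /(_ (Ainv u (rA.1 n))).
Qed.

Lemma uncoordsK h : coords (uncoords h) = h.
Proof.
apply/funext => -[[m b] u]; rewrite /coords /uncoords /=.
rewrite (big_pred1 m) => [|n] /=.
  congr (h (_, _)); have um : in_orbit m (ract (r m) u) by apply/asboolP; exists u.
  by have [] := reps_inj (positionE um).
by apply/asboolP/eqP => [[v /reps_inj[]]//|->]; exists u.
Qed.

Lemma coords_eq0 f : restr A f = f -> coords f = (fun=> 0) -> f = (fun=> 0).
Proof.
move=> fA f0; rewrite -fA; apply/funext => -[b x]; rewrite /restr /=; case: ifPn => //.
by rewrite inE => /(rA.2)[n [[u ->] _]]; exact: (congr1 (@^~ ((n, b), u)) f0).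
Qed.

Lemma restr_id (f : J * X -> C) : restr A (restr A f) = restr A f.
Proof. by apply/funext => x; rewrite /restr; case: (x.2 \in A). Qed.

(** Coordinates identify the square-summable functions on [A] with those on copies
    of [U], and intertwine the compression with [compress_mx]. *)
Lemma ker_coords :
  coords @` ker_on [set f | l2 f /\ restr A f = f] (fun f => restr A (gop B lactV f)) =
  ker_on (@l2 R _) (gop compress_mx (ltrV id)).
Proof.
apply/seteqP; split=> [_ [f [[lf fA] f0] <-]|h [lh h0]].
  split; first by rewrite l2_coords.
  by rewrite gop_compress /rop fA f0.
exists (uncoords h); last exact: uncoordsK.
have uA := restr_uncoords h.
split; first by split=> //; rewrite -l2_coords// uncoordsK.
apply: coords_eq0; first exact: restr_id.
by rewrite -[in restr A (gop _ _ _)]uA -/(rop _ _ _ _) -gop_compress uncoordsK.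
Qed.

End Compression.

(** * Folner sets and moments *)

Section Words.
Variables (G : groupType) (X : Type) (lact : G -> X -> X) (S : {fset G}).
Hypotheses (lact1 : forall x, lact 1%g x = x)
  (lactM : forall g h x, lact (g * h)%g x = lact g (lact h x)).
Hypothesis genS : sym_generators S.

Definition word (w : seq G) : G := foldr (fun s t => s * t)%g 1%g w.

Lemma word_cat v w : word (v ++ w) = (word v * word w)%g.
Proof. by elim: v => [|s v IH] /=; rewrite ?mul1g// IH mulgA. Qed.

Lemma generated_word g : exists2 w, (forall s, s \in w -> s \in S) & g = word w.
Proof.
pose H : {pred G} := fun g => `[< exists2 w, (forall s, s \in w -> s \in S) & g = word w >].
suff /asboolP : g \in H by [].
apply: (gen_all genS) => [|s sS]; last first.
  apply/asboolP; exists [:: s]; last by rewrite /= mulg1.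
  by move=> t; rewrite inE => /eqP ->.
split; first by apply/asboolP; exists [::].
move=> u v /asboolP[w wS ->] /asboolP[w' wS' ->]; apply/asboolP.
have [v' vS' vE] : exists2 v', (forall s, s \in v' -> s \in S) & (word w')^-1%g = word v'.
  elim: w' wS' => [|s w' IH] wS'; first by exists [::]; rewrite //= invg1.
  have [|v' vS' vE] := IH; first by move=> t tw; apply: wS'; rewrite inE tw orbT.
  exists (v' ++ [:: s^-1%g]); last by rewrite word_cat /= invgM vE mulg1.
  move=> t; rewrite mem_cat inE => /orP[/vS'//|/eqP ->].
  by apply: (gen_sym genS); apply: wS'; rewrite mem_head.
exists (w ++ v'); last by rewrite word_cat vE.
by move=> t; rewrite mem_cat => /orP[/wS|/vS'].
Qed.

(** A path from [x] to [g x] along generators that leaves [A] meets the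
    boundary at one of finitely many translates of [x]. *)
Lemma exit_boundary (F : seq G) : exists W : seq G, forall (A : set X) x, A x ->
  (exists2 g, g \in F & ~ A (lact g x)) ->
  exists2 w, w \in W & boundary lact S A (lact w x).
Proof.
have one g : exists W : seq G, forall (A : set X) x, A x -> ~ A (lact g x) ->
    exists2 w, w \in W & boundary lact S A (lact w x).
  have [w wS ->] := generated_word g.
  elim: w wS => [|s w IH] wS /=; first by exists [::] => A x; rewrite lact1.
  have [|W hW] := IH; first by move=> t tw; apply: wS; rewrite inE tw orbT.
  exists ((s * word w)%g :: W) => A x Ax out.
  have [Aw|Aw] := EM (A (lact (word w) x)); last first.
    by have [v vW bv] := hW A x Ax Aw; exists v => //; rewrite inE vW orbT.
  exists (s * word w)%g; first exact: mem_head.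
  split=> //; exists s, (lact (word w) x); split; rewrite ?lactM//.
  by apply: wS; exact: mem_head.
elim: F => [|g F [W hW]]; first by exists [::] => A x _ [].
have [W' hW'] := one g; exists (W' ++ W) => A x Ax [h].
rewrite inE => /orP[/eqP ->|hF] out.
  by have [w wW bw] := hW' A x Ax out; exists w => //; rewrite mem_cat wW.
have [|w wW bw] := hW A x Ax; first by exists h.
by exists w => //; rewrite mem_cat wW orbT.
Qed.

End Words.

Section OrbitCount.
Variables (U G : groupType) (X : choiceType) (lact : G -> X -> X) (ract : X -> U -> X).
Hypotheses (lact1 : forall x, lact 1%g x = x)
  (lactM : forall g h x, lact (g * h)%g x = lact g (lact h x))
  (ract1 : forall x, ract x 1%g = x)
  (ractM : forall x u v, ract x (u * v)%g = ract (ract x u) v)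
  (comm : forall g x u, ract (lact g x) u = lact g (ract x u)).
Variables (S : {fset G}) (A : set X) (Ainv : forall x u, A x -> A (ract x u)).
Hypothesis Afin : finite_set (orbits ract A).

Lemma boundary_finite : finite_set (orbits ract (boundary lact S A)).
Proof.
apply: (@sub_finite_set _ _ ((fun p : G * set X => lact p.1 @` p.2) @`
    ([set` S] `*` orbits ract A))); last first.
  by apply: finite_image; apply: finite_setX => //; exact: finite_fset.
move=> _ [y [[s [x [sS Ax ->]]] _] <-].
exists (s, range (ract x)); first by split=> //=; exists x.
by apply/seteqP; split=> z /= [] => [_ [u _ <-] <-|u _ <-];
  [exists u|exists (ract x u) => //; exists u].
Qed.

(** Distinct representatives are moved by [g] into distinct orbits. *)
Lemma count_boundary (N : nat) (r : 'I_N -> X) (g : G) : orbit_reps ract A r ->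
  (#|[pred m | `[< boundary lact S A (lact g (r m)) >]]| <=
   num_orbits ract (boundary lact S A))%N.
Proof.
move=> rA; set P := [pred m | _].
pose f (m : 'I_N) : set X := range (ract (lact g (r m))).
rewrite cardE -(size_map f); apply: uniq_leq_size.
  rewrite map_inj_in_uniq ?enum_uniq// => m m' _ _ E.
  have : f m (lact g (r m)) by exists 1%g.
  rewrite E => -[u _]; rewrite comm => /(congr1 (lact g^-1%g)).
  rewrite -!lactM mulVg !lact1 => E'.
  have [n [_ nu]] := rA.2 _ (rA.1 m).
  by rewrite -(nu m) ?(nu m')//; [exists u|exists 1%g].
move=> _ /mapP[m + ->]; rewrite mem_enum => /asboolP bm.
rewrite in_fset_set; last exact: boundary_finite.
by rewrite inE; exists (lact g (r m)).
Qed.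

Lemma orbit_reps_exist : exists r : 'I_(num_orbits ract A) -> X, orbit_reps ract A r.
Proof.
pose Os := fset_set (orbits ract A).
have mO (O : set X) : O \in Os -> exists2 x, A x & range (ract x) = O.
  by rewrite in_fset_set// inE => -[x]; exists x.
pose o (n : 'I_(num_orbits ract A)) : set X := nth set0 Os n.
have oO n : o n \in Os by apply: mem_nth; exact: ltn_ord.
pose r n := sval (cid2 (mO _ (oO n))).
have rA n : A (r n) by rewrite /r; case: cid2.
have ro n : range (ract (r n)) = o n by rewrite /r; case: cid2.
exists r; split=> // x Ax.
have xO : range (ract x) \in Os by rewrite in_fset_set// inE; exists x.
have xI : (index (range (ract x)) Os < num_orbits ract A)%N by rewrite index_mem.
exists (Ordinal xI); split.
  have : range (ract (r (Ordinal xI))) x.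
    by rewrite ro /o /= nth_index//; exists 1%g.
  by case=> u _ E; exists u.
move=> n [u xu]; apply/val_inj => /=.
have -> : range (ract x) = o n.
  rewrite -ro; apply/seteqP; split=> _ [v _ <-].
    by exists (u * v)%g => //; rewrite ractM -xu.
  by exists (u^-1 * v)%g => //; rewrite xu -ractM mulgA mulgV mul1g.
by rewrite /o index_uniq ?fset_uniq.
Qed.

End OrbitCount.

Section Folner.
Variables (R : realType) (U G : groupType) (iota : {multiplicative U -> G}).
Variables (X : choiceType) (lact : G -> X -> X) (ract : X -> U -> X) (X_ : nat -> set X).
Local Notation C := R[i].
Hypothesis gad : gen_amenable_data R iota lact ract X_.

Lemma gad_schur_compress (J : finType) (B : J -> J -> group_ring R G) kappa k N
    (r : 'I_N -> X) :
  orbit_reps ract (X_ k) r -> schur B kappa -> schur (compress_mx lact ract B r) kappa.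
Proof.
move=> rX Bk; refine (@schur_compress R U G X lact ract _ _ _ _ _ J B (X_ k) _ N r rX kappa Bk).
- exact: gad_lact1 gad.
- exact: gad_lactM gad.
- exact: gad_ract1 gad.
- exact: gad_ractM gad.
- exact: gad_comm gad.
- exact: (@gad_inv _ _ _ _ _ _ _ _ gad k).
Qed.

Variable r : forall k, 'I_(num_orbits ract (X_ k)) -> X.
Hypothesis rX : forall k, orbit_reps ract (X_ k) (@r k).
Variables (J : finType) (B : J -> J -> group_ring R G).
Variables (kappa : R) (Bk : schur B kappa).
Local Notation K := (kappa ^+ 2).
Local Notation Nk k := (num_orbits ract (X_ k)).
Local Notation cm k := (compress_mx lact ract B (@r k)).

Lemma num_orbits_gt0 : \forall k \near \oo, (0 < Nk k)%N.
Proof.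
have [x0 _] := gad_nonempty gad.
have : (\bigcup_k X_ k) x0 by rewrite (gad_cover gad).
move=> [k0 _ Xx0]; exists k0 => // k /= k0k.
have Xk : X_ k x0.
  rewrite -(subnKC k0k); elim: (k - k0)%N => [|j IH]; first by rewrite addn0.
  by rewrite addnS; apply: (gad_incr gad).
by have [n _] := (rX k).2 _ Xk; apply: leq_ltn_trans (ltn_ord n).
Qed.

Let apG : adjoint_pair (gop B (ltrV id)) (gadj B (ltr id)) K.
Proof. by apply: gop_adjoint Bk _ _; [exact: ltrVK|exact: ltrK]. Qed.

Let apk k : adjoint_pair (gop (cm k) (ltrV id)) (gadj (cm k) (ltr id)) K.
Proof.
apply: gop_adjoint; [exact: gad_schur_compress|exact: ltrVK|exact: ltrK].
Qed.

(** By [diag_compress], only the orbits near the boundary spoil the equality, and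
    the proportion of orbits that reach the boundary in a bounded number
    of steps tends to zero. *)
Lemma folner_moments n :
  mom (cm k) K n / (Nk k)%:R @[k --> \oo] --> mom B K n.
Proof.
have [F hF] := ball_list B (ltr id) (ltrV id) (n + n) (1%g : G).
have [S genS cvS] := gad_folner gad.
have [W hW] := exit_boundary (gad_lact1 gad) (gad_lactM gad) genS (F : seq G).
pose bd k := num_orbits ract (boundary lact S (X_ k)).
pose t k (m : 'I_(Nk k)) b : R := complex.Re (iter n (ggram (cm k) K (ltr id) (ltrV id))
  (delta R ((m, b), 1%g)) ((m, b), 1%g)).
pose g b : R := complex.Re (iter n (ggram B K (ltr id) (ltrV id))
  (delta R (b, 1%g)) (b, 1%g)).
have t01 k m b : 0 <= t k m b <= 1.
  by apply/andP; split; [exact: (diag_ge0 (apk k))|exact: (diag_le1 (apk k))].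
have g01 b : 0 <= g b <= 1.
  by apply/andP; split; [exact: (diag_ge0 apG)|exact: (diag_le1 apG)].
pose bad k (m : 'I_(Nk k)) := has (fun w => `[< boundary lact S (X_ k) (lact w (r m)) >]) W.
have good k m b : ~~ bad k m -> t k m b = g b.
  move=> mgood; rewrite /t /g; congr (complex.Re _).
  apply: (diag_compress (gad_lact1 gad) (gad_lactM gad) (gad_lfree gad) (gad_ract1 gad)
    (gad_ractM gad) (gad_rfree gad) (gad_comm gad) (@gad_inv _ _ _ _ _ _ _ _ gad k) (rX k)).
  rewrite -(gad_lact1 gad (r m)).
  apply: (@ball_pb _ _ _ B _ _ (ltr id) (ltrV id) _ _ (fun h => lact h (r m))).
  - by move=> h y _; rewrite /ltr (gad_lactM gad).
  - by move=> h y _; rewrite /ltrV /lactV (gad_lactM gad).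
  apply: hF => h hFh; apply: contrapT => out; move/negP: mgood; apply; apply/hasP.
  have [|w wW bw] := hW _ _ ((rX k).1 m); first by exists h.
  by exists w => //; apply/asboolP.
have nbad k : (\sum_(m : 'I_(Nk k)) bad k m <= size W * bd k)%N.
  apply: (@leq_trans (\sum_(m : 'I_(Nk k))
      \sum_(w <- W) `[< boundary lact S (X_ k) (lact w (r m)) >])%N).
    apply: leq_sum => m _; rewrite /bad; elim: (W) => [|w W' IH]; first by rewrite big_nil.
    by rewrite big_cons /=; case: asboolP => _ //=; rewrite add0n.
  rewrite exchange_big/=; elim: (W) => [|w W' IH]; first by rewrite big_nil mul0n.
  rewrite big_cons /= mulSn leq_add//.
  apply: leq_trans (count_boundary (gad_lact1 gad) (gad_lactM gad) (gad_ract1 gad)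
    (gad_comm gad) S (gad_finite gad k) w (rX k)).
  by rewrite -sum1_card [leqRHS]big_mkcond.
have diff k : `|mom (cm k) K n - (Nk k)%:R * mom B K n| <= (#|J| * (size W * bd k))%:R.
  have -> : mom (cm k) K n - (Nk k)%:R * mom B K n = \sum_(m : 'I_(Nk k)) \sum_b (t k m b - g b).
    under [RHS]eq_bigr do rewrite sumrB.
    rewrite sumrB sumr_const card_ord mulr_natl; congr (_ - _).
    by rewrite /mom /trmom pair_bigA /=; apply: eq_bigr => -[m b] _.
  apply: (@le_trans _ _ (\sum_(m : 'I_(Nk k)) (#|J| * bad k m)%:R)); last first.
    by rewrite -natr_sum ler_nat -big_distrr/= leq_mul2l nbad orbT.
  apply: (le_trans (ler_norm_sum _ _ _)); apply: ler_sum => m _.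
  have [bm|bm] := boolP (bad k m); last first.
    by rewrite big1 ?normr0 ?ler0n// => b _; rewrite good// subrr.
  apply: (le_trans (ler_norm_sum _ _ _)); rewrite muln1.
  rewrite -sum1_card natr_sum; apply: ler_sum => b _.
  have /andP[t0 t1] := t01 k m b; have /andP[g0 g1] := g01 b.
  rewrite ler_norml; apply/andP; split; lra.
apply/cvgrPdist_le => e e0.
pose c : R := (#|J| * size W)%:R + 1.
have c0 : 0 < c by rewrite ltr_wpDl.
have ec : 0 < e / c by rewrite divr_gt0.
have /cvgrPdist_le/(_ _ ec) cv := cvS.
have Npos := num_orbits_gt0.
near=> k.
have Nk0 : (0 < Nk k)%N by near: k.
have NR : 0 < (Nk k)%:R :> R by rewrite ltr0n.
have : `|0 - (bd k)%:R / (Nk k)%:R| <= e / c by near: k.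
rewrite sub0r normrN ger0_norm ?divr_ge0// => h.
have -> : mom B K n - mom (cm k) K n / (Nk k)%:R =
    - ((mom (cm k) K n - (Nk k)%:R * mom B K n) / (Nk k)%:R).
  by field; rewrite gt_eqF.
rewrite normrN normrM normfV (ger0_norm (ltW NR)).
have h1 := diff k; rewrite -(ler_pM2r (_ : 0 < (Nk k)%:R^-1)) ?invr_gt0// in h1.
apply: (le_trans h1); rewrite mulnA natrM -mulrA.
apply: (@le_trans _ _ (c * (e / c))); last by rewrite mulrCA mulfV ?gt_eqF// mulr1.
by rewrite ler_pM// ?divr_ge0// lerDl.
Unshelve. all: by end_near.
Qed.

End Folner.

(** * The determinant bound for amenable extensions and for the class G *)

Section Closure.
Variables (R : realType) (nn : nat) (theta : 'I_nn -> R[i]) (dn : nat).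
Local Notation C := R[i].

Lemma logsumZ (m : nat -> R) (c : R) N M :
  logsum (fun n => m n / c) N M = logsum m N M / c.
Proof.
by rewrite /logsum mulr_suml; apply: eq_bigr => l _; rewrite -mulrBl mulrAC.
Qed.

Lemma conj_compress (U G : groupType) (X : choiceType) (lact : G -> X -> X)
    (ract : X -> U -> X) (J : finType) (N : nat) (r : 'I_N -> X)
    (B : 'I_nn -> J -> J -> group_ring R G) :
  conj_mx theta dn B -> conj_mx theta dn (fun s => compress_mx lact ract (B s) r).
Proof.
by move=> cB a b u; apply: (@conj_regroup _ _ _ _ _ _ _ _ (fun s => B s a.2 b.2)).
Qed.

(** A compression has [N_k * #|J|] rows and its moments are divided by [N_k]. *)
Lemma detbound_amenable (U G : groupType) :
  gen_amenable_ext R U G -> detbound theta dn U -> detbound theta dn G.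
Proof.
move=> [iota [X [lact [ract [X_ gad]]]]] dU J B kappa cB sB k1 N M NM.
pose r k := sval (cid (orbit_reps_exist (gad_ract1 gad) (gad_ractM gad) (gad_finite gad k))).
have rX k : orbit_reps ract (X_ k) (r k) by rewrite /r; case: cid.
pose m_ k s n := mom (compress_mx lact ract (B s) (r k)) (kappa ^+ 2) n
  / (num_orbits ract (X_ k))%:R.
apply: (@logsum_limit R nat \oo _ nn m_); first by move=> s n; exact: (folner_moments gad rX (sB s)).
have Npos := num_orbits_gt0 gad rX.
near=> k; have Nk0 : (0 < num_orbits ract (X_ k))%N by near: k.
have := dU ('I_(num_orbits ract (X_ k)) * J)%type _ kappa (conj_compress lact ract (r k) cB)
  (fun s => gad_schur_compress gad (rX k) (sB s)) k1 N M NM.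
under [X in _ -> X <= _]eq_bigr do rewrite logsumZ.
rewrite -mulr_suml ler_pdivrMr ?ltr0n//; congr (_ <= _).
by rewrite card_prod card_ord mulrAC -natrM mulnAC mulnA.
Unshelve. all: by end_near.
Qed.

Hypotheses (theta_conj : conjugates theta) (dn_gt0 : (0 < dn)%N).

Lemma detbound_class (G : groupType) : class_G R G -> detbound theta dn G.
Proof.
elim=> {G} [G G1|H G _ dH HG|H G f fI _ dG|disp I D G p _ dD lp|disp I D G p _ dD lp].
- exact: (detbound_trivial theta_conj dn_gt0 G1).
- exact: (detbound_amenable HG dH).
- exact: (detbound_sub fI dG).
- exact: (detbound_direct dD lp).
- exact: (detbound_inverse dD lp).
Qed.

End Closure.

(** * Conjugate families of matrices *)

Section Family.
Variables (R : realType) (G : groupType) (J : finType).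
Variable B : J -> J -> group_ring R G.
Hypothesis B_alg : forall a b g, algebraicOver (@ratr R[i]) (B a b g).
Local Notation C := R[i].

Lemma common_schur (nn : nat) (Bs : 'I_nn -> J -> J -> group_ring R G) :
  exists2 kappa, 1 <= kappa & forall s, schur (Bs s) kappa.
Proof.
pose w s a b := weight (labels (Bs s)) (coef (Bs s)) a b.
have w0 s a b : 0 <= w s a b by exact: weight_ge0.
pose kappa : R := 1 + \sum_s \sum_a \sum_b w s a b.
have k1 : 1 <= kappa by rewrite lerDl !sumr_ge0// => s _; rewrite sumr_ge0// => a _; rewrite sumr_ge0.
have le_total s : \sum_a \sum_b w s a b <= kappa.
  apply: ler_wpDl => //; rewrite [leRHS](bigD1 s)//= lerDl sumr_ge0// => t _.
  by rewrite sumr_ge0// => a _; rewrite sumr_ge0.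
exists kappa => // s; split=> [|a|b]; first exact: lt_le_trans k1.
- apply: le_trans (le_total s); rewrite [leRHS](bigD1 a)//= lerDl sumr_ge0// => a' _.
  by rewrite sumr_ge0.
- apply: le_trans (le_total s); apply: ler_sum => a _.
  by rewrite [leRHS](bigD1 b)//= lerDl sumr_ge0.
Qed.

(** The coefficients are polynomial expressions in one algebraic number; the
    other matrices of the family replace it by its conjugates. *)
Lemma conjugate_matrices :
  exists (nn : nat) (theta : 'I_nn -> C) (dn : nat) (s0 : 'I_nn)
    (Bs : 'I_nn -> J -> J -> group_ring R G),
  [/\ conjugates theta, (0 < dn)%N, conj_mx theta dn Bs & Bs s0 = B].
Proof.
pose xs := flatten [seq [seq B p.1 p.2 g | g <- labels B p.1 p.2] | p <- enum {: J * J}].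
have axs x : x \in xs -> algebraicOver (@ratr C) x.
  by move=> /flattenP[_ /mapP[p _ ->] /mapP[g _ ->]]; exact: B_alg.
have Bxs a b g : g \in finsupp (B a b) -> B a b g \in xs.
  move=> gs; apply/flattenP; exists [seq B a b g | g <- labels B a b].
    by apply/mapP; exists (a, b); rewrite ?mem_enum.
  by apply/mapP; exists g.
have [nn [theta [dn [s0 [thC dn0 hP]]]]] := conjugates_exist axs.
have dC : dn%:R != 0 :> C by rewrite pnatr_eq0 -lt0n.
pose P a b g := xget 0 [set P : {poly int} | dn%:R * B a b g = ev theta s0 P].
have PE a b g : g \in finsupp (B a b) -> dn%:R * B a b g = ev theta s0 (P a b g).
  move=> gs; rewrite /P; case: xgetP => [_ _ //|no].
  by have [Q QE] := hP _ (Bxs _ _ _ gs); have := no Q.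
pose Bs s a b : group_ring R G :=
  [fsfun g in finsupp (B a b) => ev theta s (P a b g) / dn%:R | 0].
exists nn, theta, dn, s0, Bs; split=> //.
- move=> a b g; exists (if g \in finsupp (B a b) then P a b g else 0) => s.
  rewrite /Bs fsfunE; case: ifP => _; first by rewrite mulrCA mulfV// mulr1.
  by rewrite mulr0 rmorph0 horner0.
- apply/funext => a; apply/funext => b; apply/fsfunP => g; rewrite /Bs fsfunE.
  case: ifPn => gs; first by rewrite -PE// mulrAC mulfV// mul1r.
  by rewrite memNfinsupp in gs; rewrite (eqP gs).
Qed.

End Family.

Section OneConjugate.
Variables (R : realType) (nn : nat) (theta : 'I_nn -> R[i]) (dn : nat).

(** All the terms of the bound are nonnegative, so it holds for each conjugate. *)
Lemma detbound_single (G : groupType) (J : finType)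
    (Bs : 'I_nn -> J -> J -> group_ring R G) kappa s0 N M :
  detbound theta dn G -> conj_mx theta dn Bs -> (forall s, schur (Bs s) kappa) ->
  1 <= kappa -> (N <= M)%N ->
  logsum (mom (Bs s0) (kappa ^+ 2)) N M <= (nn * #|J|)%:R * logbound dn kappa.
Proof.
move=> dG cB sB k1 NM; apply: le_trans (dG J Bs kappa cB sB k1 N M NM).
rewrite (bigD1 s0)//= lerDl sumr_ge0// => s _.
by apply: logsum_ge0 => //; exact: mom_noninc.
Qed.

End OneConjugate.

Lemma real_complex_cvg (R : realType) (I : Type) (F : set_system I) (FF : Filter F)
    (u : I -> R) (v : I -> (R[i])^o) (l : R) :
  (\forall i \near F, v i = (u i)%:C) -> u i @[i --> F] --> l -> v i @[i --> F] --> (l%:C : (R[i])^o).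
Proof.
move=> uv /cvgrPdist_le ul.
apply/(@cvgrPdist_le R[i] (R[i])^o I F FF v l%:C) => e e0.
have eR : e = (complex.Re e)%:C.
  by case: e e0 => a b; rewrite ltcE /= => /andP[/eqP -> _].
have Re0 : 0 < complex.Re e by move: e0; rewrite ltcE /= => /andP[].
apply: filterS2 uv (ul _ Re0) => i -> h.
by rewrite -rmorphB normc_def/= expr0n/= addr0 sqrtr_sqr eR lecR.
Qed.

(** * Convergence of the kernel dimensions *)

Lemma mom_push_push (R : realType) (G H L : groupType) (J : finType)
    (B : J -> J -> group_ring R G) (q : G -> H) (q' : H -> L) :
  mom (gpush q' (gpush q B)) = trmom B (q' \o q).
Proof. by rewrite mom_push /trmom /ggram !gop_push !gadj_push. Qed.

Lemma ker_mxE (R : realType) (G : groupType) (d : nat) (B : 'M[group_ring R G]_d)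
    (A : 'I_d -> 'I_d -> group_ring R G) :
  (forall a b, B a b = A a b) -> ker_mx B = ker_on (@l2 R _) (gop A (ltrV id)).
Proof.
move=> BA; have -> : A = (fun a b => B a b) by apply/funext => a; apply/funext => b.
by [].
Qed.

Section Approximation.
Variables (R : realType) (G : groupType) (d : nat) (B : 'M[group_ring R G]_d).
Variables (nn : nat) (theta : 'I_nn -> R[i]) (dn : nat) (s0 : 'I_nn).
Variable Bs : 'I_nn -> 'I_d -> 'I_d -> group_ring R G.
Hypotheses (theta_conj : conjugates theta) (dn_gt0 : (0 < dn)%N).
Hypotheses (cB : conj_mx theta dn Bs) (B_s0 : Bs s0 = (fun a b => B a b)).
Variable kappa : R.
Hypotheses (kappa_ge1 : 1 <= kappa) (sB : forall s, schur (Bs s) kappa).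
Local Notation K := (kappa ^+ 2).

Let ker_B : ker_mx B = ker_on (@l2 R _) (gop (Bs s0) (ltrV id)).
Proof. by apply: ker_mxE => a b; rewrite B_s0. Qed.

Let dim (H : groupType) (J : finType) (A : J -> J -> group_ring R H) (sA : schur A kappa) : R :=
  sval (cid (mom_vndim sA)).

Let dim_cvg (H : groupType) (J : finType) (A : J -> J -> group_ring R H) (sA : schur A kappa) :
  mom A K n @[n --> \oo] --> dim sA.
Proof. by rewrite /dim; case: cid => k []. Qed.

Let dimE (H : groupType) (J : finType) (A : J -> J -> group_ring R H) (sA : schur A kappa) :
  vndim (ker_on (@l2 R _) (gop A (ltrV id))) = (dim sA)%:C.
Proof. by rewrite /dim; case: cid => k []. Qed.

Lemma inverse_limit_dim (disp : Order.disp_t) (I : porderType disp)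
    (D : inverse_system I) (p : forall i, {multiplicative G -> D i}) :
  is_inverse_limit p -> (forall i, class_G R (D i)) ->
  vndim (ker_mx (push_mx (p i) B)) @[i --> tails I] --> (vndim (ker_mx B) : (R[i])^o).
Proof.
move=> lp cD; have PF := tails_proper (inv_directed D).
pose sP i s := schur_push (p i) (sB s).
rewrite ker_B (dimE (sB s0)).
apply: (@real_complex_cvg _ _ _ _ (fun i => dim (sP i s0))).
  apply: nearW => i; rewrite -dimE; congr vndim; apply: ker_mxE => a b.
  by rewrite mxE B_s0.
apply: (@moments_to_limits _ _ _ PF (fun i => mom (gpush (p i) (Bs s0)) K)
  (mom (Bs s0) K) _ _ ((nn * #|'I_d|)%:R * logbound dn kappa)).
- by move=> i; exact: mom_noninc (sP i s0).
- by move=> i; exact: dim_cvg.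
- exact: dim_cvg.
- by move=> n; apply: near_eq_cvg; under eq_near do rewrite mom_push; exact: inverse_limit_moments.
- apply: nearW => i N M NM.
  have dD := detbound_class theta_conj dn_gt0 (cD i).
  exact: (@detbound_single _ _ _ _ _ _ (fun s => gpush (p i) (Bs s)) _ _ _ _ dD (conj_push _ cB) (sP i)).
Qed.

Lemma direct_limit_dim (disp : Order.disp_t) (I : porderType disp)
    (D : direct_system I) (p : forall i, {multiplicative D i -> G})
    (j0 : I) (lift : G -> D j0) (Bi : forall i, 'M[group_ring R (D i)]_d) :
  is_direct_limit p ->
  (forall g : G, (exists a b, B a b g != 0) -> p j0 (lift g) = g) ->
  (forall i (j0i : (j0 < i)%O), Bi i = push_mx (dir_map D j0i) (push_mx lift B)) ->
  (forall i, (j0 < i)%O -> class_G R (D i)) ->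
  vndim (ker_mx (Bi i)) @[i --> tails I] --> (vndim (ker_mx B) : (R[i])^o).
Proof.
move=> lp pl BiE cD; have PF := tails_proper (dir_directed D).
have gtj0 := near_tails_gt (dir_directed D) j0.
pose sP i (j0i : (j0 < i)%O) s := schur_push (dir_map D j0i) (schur_push lift (sB s)).
pose k_ i := if @idP (j0 < i)%O is ReflectT j0i then dim (sP i j0i s0) else 0.
pose m_ i n := if @idP (j0 < i)%O is ReflectT j0i
  then mom (gpush (dir_map D j0i) (gpush lift (Bs s0))) K n else 0.
rewrite ker_B (dimE (sB s0)).
apply: (@real_complex_cvg _ _ _ _ k_).
  apply: filterS gtj0 => i j0i; rewrite /k_; case: {-}_ / idP => // {}j0i.
  rewrite -dimE; congr vndim; apply: ker_mxE => a b.
  by rewrite (BiE i j0i) !mxE B_s0.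
have pl' g : g \in supp (Bs s0) -> p j0 (lift g) = g.
  move=> /flattenP[_ /mapP[[a b] _ ->]]; rewrite /labels B_s0 mem_finsupp => Bg.
  by apply: pl; exists a, b.
apply: (@moments_to_limits _ _ _ PF m_
  (mom (Bs s0) K) _ _ ((nn * #|'I_d|)%:R * logbound dn kappa)).
- move=> i n m nm; rewrite /m_; case: {-}_ / idP => // j0i.
  exact: (mom_noninc (sP i j0i s0)).
- move=> i; rewrite /m_ /k_; case: {-}_ / idP => [j0i|_]; last exact: cvg_cst.
  exact: dim_cvg.
- exact: dim_cvg.
- move=> n; apply: near_eq_cvg.
  apply: filterS2 gtj0 (direct_limit_moments K n lp pl') => i j0i E.
  by rewrite /m_; case: {-}_ / idP => // {}j0i; rewrite mom_push_push E.
- apply: filterS gtj0 => i j0i N M NM.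
  have dD := detbound_class theta_conj dn_gt0 (cD i j0i).
  have -> : m_ i = mom (gpush (dir_map D j0i) (gpush lift (Bs s0))) K.
    by apply/funext => n; rewrite /m_; case: {-}_ / idP => // j0i'; rewrite (bool_irrelevance j0i' j0i).
  exact: (@detbound_single _ _ _ _ _ _ (fun s => gpush (dir_map D j0i) (gpush lift (Bs s)))
    _ _ _ _ dD (conj_push _ (conj_push _ cB)) (sP i j0i)).
Qed.

Lemma amenable_dim (U : groupType) (iota : {multiplicative U -> G})
    (X : choiceType) (lact : G -> X -> X) (ract : X -> U -> X) (X_ : nat -> set X)
    (r : forall k, 'I_(num_orbits ract (X_ k)) -> X) :
  gen_amenable_data R iota lact ract X_ ->
  (forall k, orbit_reps ract (X_ k) (r k)) -> class_G R U ->
  vndim (orbit_coords ract (r k) @` ker_compress B lact (X_ k))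
      / (num_orbits ract (X_ k))%:R @[k --> \oo] --> (vndim (ker_mx B) : (R[i])^o).
Proof.
move=> gad rX cU; have dU := detbound_class theta_conj dn_gt0 cU.
pose cm k s := compress_mx lact ract (Bs s) (r k).
have sC k s : schur (cm k s) kappa := gad_schur_compress gad (rX k) (sB s).
have Npos := num_orbits_gt0 gad rX.
rewrite ker_B (dimE (sB s0)).
apply: (@real_complex_cvg _ _ _ _ (fun k => dim (sC k s0) / (num_orbits ract (X_ k))%:R)).
  apply: nearW => k.
  have -> (x : R) n : (x / n%:R)%:C = x%:C / n%:R by rewrite rmorphM fmorphV rmorph_nat.
  congr (_ / _); rewrite -dimE -(ker_coords (gad_ract1 gad) (gad_ractM gad) (gad_rfree gad) (gad_comm gad)
    (Bs s0) (@gad_inv _ _ _ _ _ _ _ _ gad k) (rX k)).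
  by rewrite B_s0.
apply: (@moments_to_limits _ _ \oo _ (fun k n => mom (cm k s0) K n / (num_orbits ract (X_ k))%:R)
  (mom (Bs s0) K) _ _ ((nn * #|'I_d|)%:R * logbound dn kappa)).
- move=> k n m nm; rewrite ler_wpM2r ?invr_ge0 ?ler0n//.
  exact: (mom_noninc (sC k s0)).
- by move=> k; apply: cvgMr_tmp; exact: dim_cvg.
- exact: dim_cvg.
- by move=> n; exact: (folner_moments gad rX (sB s0)).
- apply: filterS Npos => k Nk0 N M NM.
  rewrite logsumZ ler_pdivrMr ?ltr0n//.
  apply: le_trans (detbound_single s0 dU (conj_compress lact ract (r k) cB) (sC k) kappa_ge1 NM) _.
  by rewrite card_prod !card_ord mulrAC -natrM mulnAC mulnA.
Qed.

End Approximation.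

Theorem theorem3p12 (R : realType) (G : groupType) (d : nat)
    (B : 'M[group_ring R G]_d)
    (B_alg : forall (a b : 'I_d) (g : G),
       algebraicOver (@ratr R[i]) (B a b g)) :
  [/\ forall (disp : Order.disp_t) (I : porderType disp)
        (D : inverse_system I) (p : forall i, {multiplicative G -> D i}),
        is_inverse_limit p ->
        (forall i, class_G R (D i)) ->
        vndim (ker_mx (push_mx (p i) B)) @[i --> tails I]
          --> (vndim (ker_mx B) : (R[i])^o),

      forall (disp : Order.disp_t) (I : porderType disp)
        (D : direct_system I) (p : forall i, {multiplicative D i -> G})
        (j0 : I) (lift : G -> D j0)
        (Bi : forall i, 'M[group_ring R (D i)]_d),
        is_direct_limit p ->
        (forall g : G, (exists a b, B a b g != 0) -> p j0 (lift g) = g) ->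
        (forall i (j0i : (j0 < i)%O),
           Bi i = push_mx (dir_map D j0i) (push_mx lift B)) ->
        (forall i, (j0 < i)%O -> class_G R (D i)) ->
        vndim (ker_mx (Bi i)) @[i --> tails I]
          --> (vndim (ker_mx B) : (R[i])^o)
    & forall (U : groupType) (iota : {multiplicative U -> G})
        (X : choiceType) (lact : G -> X -> X) (ract : X -> U -> X)
        (X_ : nat -> set X)
        (r : forall k, 'I_(num_orbits ract (X_ k)) -> X),
        gen_amenable_data R iota lact ract X_ ->
        (forall k, orbit_reps ract (X_ k) (r k)) ->
        class_G R U ->
        vndim (orbit_coords ract (r k) @` ker_compress B lact (X_ k))
            / (num_orbits ract (X_ k))%:R @[k --> \oo]
          --> (vndim (ker_mx B) : (R[i])^o)].
Proof.
have [nn [theta [dn [s0 [Bs [thC dn0 cB Bs0]]]]]] := conjugate_matrices B_alg.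
have [kappa k1 sB] := common_schur Bs.
split.
- by move=> disp I D p lp cD; exact: (inverse_limit_dim thC dn0 cB Bs0 k1 sB).
- move=> disp I D p j0 lift Bi lp pl BiE cD.
  exact: (direct_limit_dim thC dn0 cB Bs0 k1 sB lp pl BiE cD).
- by move=> U iota X lact ract X_ r gad rX cU; exact: (amenable_dim thC dn0 cB Bs0 k1 sB gad rX cU).
Qed.
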